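(* Let $\mu:\mathbb{R}\to\mathbb{R}^+$ be a differentiable growth rate, let $d,\ell\in\mathbb{N}$, and consider the system $$\dot x=A(t)x+F(t,x),\qquad t\in\mathbb{R},\ x\in\mathbb{R}^d. \qquad (\ast)$$ Suppose: (1) The map $t\mapsto A(t)\in\mathcal{M}_d(\mathbb{R})$ is locally integrable, and the linear system $\dot x=A(t)x$ has uniform $\mu$-bounded growth. Moreover, there are $n\in\{1,\dots,d\}$ and $d_1,\dots,d_n\in\mathbb{N}$ with $d_1+\cdots+d_n=d$, and maps $A_i:\mathbb{R}\to\mathcal{M}_{d_i}(\mathbb{R})$, such that $A(t)=\mathrm{diag}(A_1(t),\dots,A_n(t))$ (block diagonal), the uniform $\mu$-dichotomy spectrum is $\Sigma_{\mu\mathrm D}(A)=\lambda_1\cup\cdots\cup\lambda_n$ with spectral intervals $\lambda_i=[a_i,b_i]$, and $\Sigma_{\mu\mathrm D}(A_i)=\lambda_i$ for every $i=1,\dots,n$. (2) $F=(F_1,\dots,F_n):\mathbb{R}\times\mathbb{R}^d\to\mathbb{R}^d$, with $F_i:\mathbb{R}\times\mathbb{R}^d\to\mathbb{R}^{d_i}$, is a $C^\ell$-Carathéodory map with $F(t,0)=0$ and $D_2F(t,0)=0$, and there is a uniformly $\mu$-admissible function $\psi$ such that $\|D_2^mF(t,0)\|\le\psi(t)$ for all $m=2,\dots,\ell$ and almost all $t\in\mathbb{R}$. (3) For a given $j\in\{1,\dots,n\}$ and a given multi-index $\mathbf{k}=(k_1,\dots,k_n)\in\mathbb{N}_0^n$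 with $2\le|\mathbf{k}|\le\ell$, one has $$\lambda_j\cap\sum_{i=1}^n k_i\lambda_i=\emptyset .$$ Then there is a $C^\ell$-Carathéodory function $G=(G_1,\dots,G_n)$ such that the system $(\ast)$ and the system $$\dot x=A(t)x+G(t,x)$$ are uniformly locally $C^\ell$-equivalent around the zero solution, and $G$ eliminates the $\mathbf{k}$-th Taylor term of $F$ on position $j$ and keeps all other Taylor terms fixed up to order $|\mathbf{k}|$; that is, for every multi-index $\mathbf{m}\in\mathbb{N}_0^n$ with $1\le|\mathbf{m}|\le|\mathbf{k}|$, every $i\in\{1,\dots,n\}$ and almost all $t\in\mathbb{R}$, $$D_2^{\mathbf{m}}G_i(t,0)=\begin{cases}D_2^{\mathbf{m}}F_i(t,0)&\text{if }\mathbf{m}\ne\mathbf{k}\text{ or }i\ne j,\\ 0&\text{if }\mathbf{m}=\mathbf{k}\text{ and }i=j.\end{cases}$$ Moreover, there is a uniformly $\mu$-admissible map $\widetilde\psi$ such that $$\|D_2^mG(t,0)\|\le\widetilde\psi(t)\qquad\text{for all }m=2,\dots,\ell\text{ and almost all }t\in\mathbb{R}.$$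
   Context: **Growth rates.** A function $\mu:\mathbb{R}\to\mathbb{R}^+$ is a growth rate if it is strictly increasing, $\mu(0)=1$, $\lim_{t\to+\infty}\mu(t)=+\infty$ and $\lim_{t\to-\infty}\mu(t)=0$; it is a differentiable growth rate if moreover it is differentiable. **Linear systems.** For a linear system $\dot x=A(t)x$ with locally integrable $A$, let $\Phi(t,s)$ be its evolution operator. An invariant projector is a map $t\mapsto P(t)$ with values in projections such that $P(t)\Phi(t,s)=\Phi(t,s)P(s)$ for all $t,s$. The system has uniform $\mu$-bounded growth if there are $K\ge1$, $a\ge0$ with $\|\Phi(t,s)\|\le K(\mu(t)/\mu(s))^{\mathrm{sgn}(t-s)a}$ for all $t,s\in\mathbb{R}$. It admits a uniform $\mu$-dichotomy if there are an invariant projector $P$ and constants $K\ge1$, $\alpha<0$, $\beta>0$ such that $\|\Phi(t,s)P(s)\|\le K(\mu(t)/\mu(s))^{\alpha}$ for $t\ge s$ and $\|\Phi(t,s)[\mathrm{Id}-P(s)]\|\le K(\mu(t)/\mu(s))^{\beta}$ for $t\le s$. The uniform $\mu$-dichotomy spectrum is $$\Sigma_{\mu\mathrm D}(A)=\Big\{\gamma\in\mathbb{R}:\ \dot y=\big[A(t)-\gamma\tfrac{\mu'(t)}{\mu(t)}\mathrm{Id}\big]y \text{ does not admit a uniform }\mu\text{-dichotomy}\Big\}.$$ Under uniform $\mu$-bounded growth it is a nonempty finite union of compact intervals; its connected components $[a_i,b_i]$, $a_i\le b_i$, are called spectral intervals. **Interval arithmetic and multi-indices.** $[a,b]+[c,d]=[a+c,b+d]$,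 and $\gamma\cdot[a,b]=[\gamma a,\gamma b]$ (used for $\gamma\geq 0$). For $\mathbf{k}=(k_1,\dots,k_n)\in\mathbb{N}_0^n$, $|\mathbf{k}|=k_1+\cdots+k_n$. **Derivatives.** Write $x=(x_1,\dots,x_n)$ with $x_i\in\mathbb{R}^{d_i}$, according to $\mathbb{R}^d=\mathbb{R}^{d_1}\oplus\cdots\oplus\mathbb{R}^{d_n}$. $D_2^mF(t,x)$ is the $m$-th derivative with respect to $x\in\mathbb{R}^d$; $D_{2_i}$ is the derivative (Jacobian) with respect to the block $x_i$; and $D_2^{\mathbf{k}}=D_{2_1}^{k_1}\cdots D_{2_n}^{k_n}$. **Carathéodory functions.** A map $F:\mathrm{Dom}_F\subset\mathbb{R}\times\mathbb{R}^d\to\mathbb{R}^d$ is of Carathéodory class if for every interval $I\subset\mathbb{R}$ and open $U\subset\mathbb{R}^d$ with $I\times U\subset\mathrm{Dom}_F$: $F(t,\cdot):U\to\mathbb{R}^d$ is continuous for almost all $t\in I$, and $F(\cdot,x):I\to\mathbb{R}^d$ is measurable for all $x\in U$. It is $C^\ell$-Carathéodory if moreover, for almost all $t\in I$ and all $x\in U$, the $\ell$-th derivative $D_2^\ell F(t,x)$ exists, and $D_2^jF$ is of Carathéodory class for each $j\in\{1,\dots,\ell\}$. **Admissibility.** A measurable $\psi:\mathbb{R}\to[0,\infty)$ is $\mu$-admissible if for every $\delta>0$ and $t\in\mathbb{R}$, $\int_{-\infty}^t\psi(s)\mu(s)^\delta ds+\int_t^\infty\psi(s)\mu(s)^{-\delta}ds<\infty$.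 It is uniformly $\mu$-admissible if furthermore, for every $\delta>0$, $\sup_{t\in\mathbb{R}}\big\{\int_{-\infty}^t\psi(s)(\mu(t)/\mu(s))^{-\delta}ds+\int_t^\infty\psi(s)(\mu(t)/\mu(s))^{\delta}ds\big\}<\infty$. **Local equivalence.** For $\xi:\mathbb{R}\to\mathbb{R}^+$ let $T_\xi=\{(t,x)\in\mathbb{R}\times\mathbb{R}^d:|x|\le\xi(t)\}$. Two systems $\dot x=f(t,x)$ (X) and $\dot y=g(t,y)$ (Y) having the zero solution are nonuniformly locally $C^\ell$-equivalent around the zero solution if there are functions $\xi,\widetilde\xi:\mathbb{R}\to\mathbb{R}^+$ and maps $H:T_\xi\to\mathbb{R}^d$, $H^{-1}:T_{\widetilde\xi}\to\mathbb{R}^d$ such that: (i) for every fixed $t$, $H(t,\cdot)$ and $H^{-1}(t,\cdot)$ are $C^\ell$-diffeomorphisms from the ball $B_{\xi(t)}(0)$ (resp. $B_{\widetilde\xi(t)}(0)$) onto its image, and they are inverse to each other wherever the compositions are defined; (ii) if $t\mapsto y(t)$ is a solution of (Y) with graph in $T_{\widetilde\xi}$, then $t\mapsto H^{-1}(t,y(t))$ is a solution of (X), and if $t\mapsto x(t)$ is a solution of (X) with graph in $T_\xi$, then $t\mapsto H(t,x(t))$ is a solution of (Y); (iii) $\lim_{x\to0}H(t,x)=\lim_{x\to0}H^{-1}(t,x)=0$ for each $t$, not necessarily uniformly in $t$. They are uniformly locally $C^\ell$-equivalent if moreover $\xi,\widetilde\xi$ take values in some interval $[\varepsilon,\varepsilon']$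 with $\varepsilon>0$ and the convergence in (iii) is uniform in $t\in\mathbb{R}$. *)

(* Defs.v *)
(* MathComp-Analysis *)
From HB Require Import structures.
From mathcomp Require Import all_boot all_order all_algebra.
From mathcomp Require Import all_classical all_reals all_analysis.
Import Order.TTheory GRing.Theory Num.Theory.
Import numFieldNormedType.Exports.

Set Implicit Arguments.
Unset Strict Implicit.
Unset Printing Implicit Defensive.

Local Open Scope classical_set_scope.
Local Open Scope ring_scope.

(* "Measurable", "integrable" and "almost all" refer to the Lebesgue
   sigma-algebra (not only the Borel one), so that they are insensitive to
   changes on null sets. *)
Notation leb := (@completed_lebesgue_measure _).

Notation lebesgueType R := (caratheodory_type (wlength (@idfun R))^*%mu).

Definition Lmeasurable (R : realType) (D : set R) (f : R -> R) : Prop :=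
  @measurable_fun _ _ (lebesgueType R) R D f.

Definition Lintegrable (R : realType) (D : set R) (f : R -> R) : Prop :=
  leb.-integrable D (fun t => (f t)%:E).

Definition growth_rate (R : realType) (mu : R -> R) : Prop :=
  [/\ forall t, 0 < mu t, {homo mu : s t / s < t}, mu 0 = 1,
      mu @ +oo --> +oo & mu @ -oo --> 0].

Definition differentiable_growth_rate (R : realType) (mu : R -> R) : Prop :=
  growth_rate mu /\ forall t, derivable mu t 1.

Definition admissible (R : realType) (mu psi : R -> R) : Prop :=
  [/\ Lmeasurable setT psi, forall t, 0 <= psi t &
      forall delta t : R, 0 < delta ->
        (\int[leb]_(s in `]-oo, t]) (psi s * mu s `^ delta)%:E
         + \int[leb]_(s in `[t, +oo[) (psi s * mu s `^ (- delta))%:E < +oo)%E].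

Definition uniformly_admissible (R : realType) (mu psi : R -> R) : Prop :=
  admissible mu psi /\
  forall delta : R, 0 < delta ->
    (ereal_sup (range (fun t : R =>
       \int[leb]_(s in `]-oo, t]) (psi s * (mu t / mu s) `^ (- delta))%:E
       + \int[leb]_(s in `[t, +oo[) (psi s * (mu t / mu s) `^ delta)%:E))
     < +oo)%E.

(* R^p carries the library norm `|x|, the maximum norm; a function into R^p is
   measurable, resp. integrable, iff its coordinates are. *)

(* Caratheodory solutions: [x] is absolutely continuous on compact
   subintervals of [J] and satisfies x' = f(t, x) almost everywhere on [J],
   in integrated form. *)
Definition solution (R : realType) (p : nat)
    (f : R -> 'cV[R]_p -> 'cV[R]_p) (J : set R) (x : R -> 'cV[R]_p) : Prop :=
  forall s t, J s -> J t -> s <= t -> forall c : 'I_p,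
    Lintegrable `[s, t] (fun r => f r (x r) c 0) /\
    x t c 0 = x s c 0 + \int[leb]_(r in `[s, t]) (f r (x r) c 0).

Definition loc_integrable (R : realType) (p : nat) (A : R -> 'M[R]_p) : Prop :=
  forall (a b : R) (i j : 'I_p), Lintegrable `[a, b] (fun t => A t i j).

Definition evolution (R : realType) (p : nat)
    (A : R -> 'M[R]_p) (Phi : R -> R -> 'M[R]_p) : Prop :=
  forall s, Phi s s = 1%:M /\
    forall v, solution (fun t x => A t *m x) setT (fun t => Phi t s *m v).

(* For locally integrable [A] there is exactly one [Phi] with
   [evolution A Phi].  The norm `| _ | on matrices is the maximum of the absolute
   values of the entries; the constant [K] absorbs the choice of norm. *)
Definition uniform_bounded_growth (R : realType) (mu : R -> R) (p : nat)
    (A : R -> 'M[R]_p) : Prop :=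
  exists2 Phi, evolution A Phi &
  exists K a : R, [/\ 1 <= K, 0 <= a &
    forall t s, `|Phi t s| <= K * (mu t / mu s) `^ (Num.sg (t - s) * a)].

Definition invariant_projector (R : realType) (p : nat)
    (Phi : R -> R -> 'M[R]_p) (P : R -> 'M[R]_p) : Prop :=
  (forall t, P t *m P t = P t) /\
  (forall t s, P t *m Phi t s = Phi t s *m P s).

Definition uniform_dichotomy (R : realType) (mu : R -> R) (p : nat)
    (A : R -> 'M[R]_p) : Prop :=
  exists2 Phi, evolution A Phi &
  exists2 P, invariant_projector Phi P &
  exists K alpha beta : R, [/\ 1 <= K, alpha < 0, 0 < beta,
    forall t s, s <= t ->
      `|Phi t s *m P s| <= K * (mu t / mu s) `^ alpha &
    forall t s, t <= s ->
      `|Phi t s *m (1%:M - P s)| <= K * (mu t / mu s) `^ beta].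

Definition dichotomy_spectrum (R : realType) (mu : R -> R) (p : nat)
    (A : R -> 'M[R]_p) : set R :=
  [set gamma | ~ uniform_dichotomy mu
     (fun t => A t - (gamma * (derive1 mu t / mu t)) *: 1%:M)].

(* The compact interval with endpoints [I.1] and [I.2].  The componentwise
   operations of [R * R] on endpoints are exactly interval arithmetic:
   I + J for the sum and I *+ k for the multiple k . I. *)
Definition cint (R : realType) (I : R * R) : set R := `[I.1, I.2].

Definition spectral_interval (R : realType) (S : set R) (I : R * R) : Prop :=
  I.1 <= I.2 /\ cint I = connected_component S I.1.

(* [nder f [:: v1; ...; vm] x] is D^m f(x)(v1, ..., vm), the iterated Frechet
   derivative as an m-linear map.  As V is finite dimensional in all uses,
   differentiability and continuity of x |-> D^m f(x) can be tested on every
   fixed tuple of vectors. *)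
Fixpoint nder (R : realType) (V W : normedModType R) (f : V -> W)
    (vs : seq V) {struct vs} : V -> W :=
  match vs with
  | [::] => f
  | v :: vs' => fun x => 'd (nder f vs') x v
  end.

Definition nderivable (R : realType) (V W : normedModType R) (l : nat)
    (f : V -> W) (x : V) : Prop :=
  forall vs, (size vs < l)%N -> differentiable (nder f vs) x.

Definition Cn (R : realType) (V W : normedModType R) (l : nat)
    (U : set V) (f : V -> W) : Prop :=
  (forall x, U x -> nderivable l f x) /\
  (forall vs, (size vs <= l)%N -> forall x, U x ->
     {for x, continuous (nder f vs)}).

Definition Cn_diffeo (R : realType) (V W : normedModType R) (l : nat)
    (U : set V) (h : V -> W) : Prop :=
  [/\ Cn l U h, open (h @` U) &
      exists2 g : W -> V, Cn l (h @` U) g & forall x, U x -> g (h x) = x].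

Definition caratheodory (R : realType) (p q : nat) (Dom : set (R * 'cV[R]_p))
    (F : R -> 'cV[R]_p -> 'cV[R]_q) : Prop :=
  forall (I : set R) (U : set 'cV[R]_p),
    is_interval I -> open U -> I `*` U `<=` Dom ->
    {ae leb, forall t, I t -> forall x, U x -> {for x, continuous (F t)}} /\
    (forall x, U x -> forall c : 'I_q, Lmeasurable I (fun t => F t x c 0)).

(* In the last clause the null set may depend on [vs]; this is immaterial since
   D_2^m F is m-linear in [vs]. *)
Definition Cn_caratheodory (R : realType) (l p q : nat)
    (Dom : set (R * 'cV[R]_p)) (F : R -> 'cV[R]_p -> 'cV[R]_q) : Prop :=
  [/\ caratheodory Dom F,
      forall (I : set R) (U : set 'cV[R]_p),
        is_interval I -> open U -> I `*` U `<=` Dom ->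
        {ae leb, forall t, I t -> forall x, U x -> nderivable l (F t) x} &
      forall vs : seq 'cV[R]_p, (1 <= size vs <= l)%N ->
        caratheodory Dom (fun t => nder (F t) vs)].

(* The bound on the operator norm of the m-linear maps D_2^m F(t,0), m = 2..l *)
Definition derivative_bound (R : realType) (l p : nat)
    (F : R -> 'cV[R]_p -> 'cV[R]_p) (psi : R -> R) : Prop :=
  {ae leb, forall t, forall vs : seq 'cV[R]_p, (2 <= size vs <= l)%N ->
     `|nder (F t) vs 0| <= psi t * \prod_(v <- vs) `|v|}.

Section Blocks.
Context (R : realType) (n : nat) (d_ : 'I_n -> nat).
Local Notation V := 'cV[R]_(\sum_i d_ i).

Definition set_block (x : V) (i : 'I_n) (u : 'cV[R]_(d_ i)) : V :=
  \mxcol_h dfwith (fun h => submxcol x h) i u h.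

Definition partial_der (W : normedModType R) (i : 'I_n) (g : V -> W) (x : V)
    (u : 'cV[R]_(d_ i)) : W :=
  'd (fun z : 'cV[R]_(d_ i) => g (set_block x z)) (submxcol x i) u.

Fixpoint block_der (W : normedModType R) (g : V -> W)
    (us : seq {i : 'I_n & 'cV[R]_(d_ i)}) {struct us} : V -> W :=
  match us with
  | [::] => g
  | existT i u :: us' => fun x => partial_der (block_der g us') x u
  end.

(* D^m g(x) = D_1^(m_1) ... D_n^(m_n) g(x) as a multilinear map, evaluated at
   m_i vectors [w i] of the i-th block for every i *)
Definition multi_der (W : normedModType R) (m : {ffun 'I_n -> nat})
    (g : V -> W) (x : V) (w : forall i, (m i).-tuple 'cV[R]_(d_ i)) : W :=
  block_der g
    (flatten [seq [seq Tagged (fun i => 'cV[R]_(d_ i)) u | u <- w i]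
             | i <- enum 'I_n]) x.

End Blocks.

Definition mdeg (n : nat) (m : {ffun 'I_n -> nat}) : nat := (\sum_i m i)%N.

Section Equivalence.
Context (R : realType) (p : nat).
Local Notation V := 'cV[R]_p.
Implicit Types (f g H Hinv : R -> V -> V) (xi eta : R -> R).

(* [eta] and [Hinv] are the xi-tilde and H^{-1} of the definition; [H] and
   [Hinv] are total functions of which only the values on the tubes
   |x| <= xi(t), resp. |x| <= eta(t), matter. *)
Definition local_equivalence_by (l : nat) f g xi eta H Hinv : Prop :=
  [/\ (forall t, 0 < xi t) /\ (forall t, 0 < eta t),
      forall t, [/\ Cn_diffeo l (ball (0 : V) (xi t)) (H t),
        Cn_diffeo l (ball (0 : V) (eta t)) (Hinv t),
        forall x, `|x| <= xi t -> `|H t x| <= eta t -> Hinv t (H t x) = x &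
        forall y, `|y| <= eta t -> `|Hinv t y| <= xi t -> H t (Hinv t y) = y],
      forall (J : set R) (y : R -> V), is_interval J -> solution g J y ->
        (forall t, J t -> `|y t| <= eta t) ->
        solution f J (fun t => Hinv t (y t)),
      forall (J : set R) (x : R -> V), is_interval J -> solution f J x ->
        (forall t, J t -> `|x t| <= xi t) ->
        solution g J (fun t => H t (x t)) &
      forall t, H t x @[x --> (0 : V)] --> (0 : V) /\
                Hinv t x @[x --> (0 : V)] --> (0 : V)].

Definition has_zero_solution f : Prop := solution f setT (fun=> 0).

Definition locally_equivalent (l : nat) f g : Prop :=
  [/\ has_zero_solution f, has_zero_solution g &
      exists xi eta H Hinv, local_equivalence_by l f g xi eta H Hinv].

Definition uniform_limit0 H xi : Prop :=
  forall e : R, 0 < e -> exists2 delta : R, 0 < delta &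
    forall t x, `|x| <= xi t -> `|x| < delta -> `|H t x| < e.

Definition uniformly_locally_equivalent (l : nat) f g : Prop :=
  [/\ has_zero_solution f, has_zero_solution g &
      exists xi eta H Hinv, [/\ local_equivalence_by l f g xi eta H Hinv,
        exists eps eps' : R, 0 < eps /\
          forall t, eps <= xi t <= eps' /\ eps <= eta t <= eps' &
        uniform_limit0 H xi /\ uniform_limit0 Hinv eta]].

End Equivalence.

(* Main.v *)
Require Import Defs.
From HB Require Import structures.
From mathcomp Require Import all_boot all_order all_algebra fingroup perm.
From mathcomp Require Import all_classical all_reals all_analysis.
From mathcomp Require Import measurable_realfun ring lra zify.
Import Order.TTheory GRing.Theory Num.Theory.
Import numFieldNormedType.Exports.

Set Implicit Arguments.
Unset Strict Implicit.
Unset Printing Implicit Defensive.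

Local Open Scope classical_set_scope.
Local Open Scope ring_scope.

(** Let h(t, y) be a polynomial map in y, homogeneous of degree |k|, of block
    type k and with values in block j.  Under the change of variables
    x = y - h(t, y) the Taylor terms of F up to order |k| are unchanged, except
    that the term F^k of type k in position j becomes
    F^k + h_t - A h + (D h) A y.  So F^k disappears as soon as h is a bounded
    solution of the linear homological equation h_t = A h - (D h) A y - F^k.

    The homogeneous part of that equation moves the coefficients of h by the
    tensor built from Phi(t, s) on the values and Phi(s, t) on the arguments
    (tensor, hpoly_transport).  Outside the dichotomy spectrum of a block, its
    evolution operator is dominated by powers of mu(t) / mu(s) with exponents
    arbitrarily close to the endpoints of the spectral interval (upper_rate,
    lower_rate).  As the interval of block j misses the interval combination of
    type k, it lies on one side of it (resonance_cases), and the tensor decays like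
    (mu(t) / mu(s))^(-delta) in one direction of time.  The integral of the
    transported F^k over the corresponding ray therefore converges and solves
    the equation (homological_solution, homological_block), and uniform
    admissibility is exactly the boundedness of that integral in t.

    The change of variables is made global by feeding h with the saturated
    variables u / (1 + (u / ep)^M), which agree with u up to order M > l.  For ep
    small this perturbation of the identity is contracting with constant 1/2 for
    all t simultaneously, so the transformation is a bijection by the Banach
    fixed point theorem (shear_surj), with the radius 1 on both sides.
    Saturation only leaves an error that is flat at the origin
    (ordge_cutoff_error), hence it does not touch the jet.

    Solutions are only absolutely continuous and A, F only measurable in time.
    Everything is therefore expressed by slopes,
    f(x) - f(y) = sum_i g_i(x, y) (x_i - y_i) with g_i continuous on the diagonal.
    Slopes transport absolutely continuous functions (abs_cont_chain), which gives
    the correspondence of solutions in both directions, and they differentiate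
    the inverse transformation (slope_diff).

    The new nonlinearity G is an explicit expression in F, A and h.  Its smoothness
    and the bound by psi follow from the closure properties of families with
    bounded jets (jet_bound).  For its Taylor terms, G - (F - F^k) is shown to be
    o(|y|^|k|) (flat_nform), so that its derivatives up to order |k| vanish
    (flat_nder); and the derivatives of the diagonal of a symmetric form are the
    form itself (form_nder_full), which identifies those of F^k
    (nder_type_part). *)

(** * Differentials of sums, products and compositions *)

Section Calculus.
Context {R : realType}.

Lemma cvg_bigsum (V : normedModType R) (U : Type) (D : set_system U)
    (FF : Filter D) (I : Type) (s : seq I) (P : pred I) (f : I -> U -> V) (l : I -> V) :
  (forall i, f i @ D --> l i) ->
  (fun x => \sum_(i <- s | P i) f i x) @ D --> \sum_(i <- s | P i) l i.
Proof.
move=> H; elim: s => [|i s IH].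
  under eq_fun do rewrite big_nil; rewrite big_nil; exact: cvg_cst.
under eq_fun do rewrite big_cons; rewrite big_cons.
by case: (P i) => //; apply: cvgD.
Qed.

Lemma continuous_bigsum (U : topologicalType) (V : normedModType R) (I : Type)
    (s : seq I) (P : pred I) (f : I -> U -> V) x :
  (forall i, {for x, continuous (f i)}) ->
  {for x, continuous (fun y => \sum_(i <- s | P i) f i y)}.
Proof. by move=> H; apply: cvg_bigsum. Qed.

Lemma continuous_scale (U : topologicalType) (V : normedModType R)
    (f : U -> R) (v : V) x :
  {for x, continuous f} -> {for x, continuous (fun y => f y *: v)}.
Proof. by move=> H; apply: cvgZr_tmp. Qed.

Lemma diffD_fun (V W : normedModType R) (f g : V -> W) x :
  differentiable f x -> differentiable g x ->
  differentiable (fun y => f y + g y) x /\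
  forall v, 'd (fun y => f y + g y) x v = 'd f x v + 'd g x v.
Proof.
move=> df dg; rewrite (_ : (fun y => _) = f + g)//.
by split=> [|v]; [exact: differentiableD|rewrite diffD].
Qed.

Lemma diffM_fun (V : normedModType R) (f g : V -> R) x :
  differentiable f x -> differentiable g x ->
  differentiable (fun y => f y * g y) x /\
  forall v, 'd (fun y => f y * g y) x v = f x * 'd g x v + g x * 'd f x v.
Proof.
move=> df dg; rewrite (_ : (fun y => _) = f * g)//.
by split=> [|v]; [exact: differentiableM|rewrite diffM].
Qed.

Lemma diff_comp_fun (U V W : normedModType R) (f : U -> V) (g : V -> W) x :
  differentiable f x -> differentiable g (f x) ->
  differentiable (fun y => g (f y)) x /\
  forall v, 'd (fun y => g (f y)) x v = 'd g (f x) ('d f x v).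
Proof.
move=> df dg; rewrite (_ : (fun y => _) = g \o f)//.
by split=> [|v]; [exact: differentiable_comp|rewrite diff_comp].
Qed.

Lemma diffV_fun (V : normedModType R) (f : V -> R) x :
  differentiable f x -> f x != 0 ->
  differentiable (fun y => (f y)^-1) x /\
  forall v, 'd (fun y => (f y)^-1) x v = - (f x)^-1 * (f x)^-1 * 'd f x v.
Proof.
move=> df f0; split=> [|v]; first exact: differentiableV.
by rewrite diffV//= mulNr -expr2 exprVn.
Qed.

Lemma diff_const (V W : normedModType R) (a : W) (y : V) :
  differentiable (fun _ : V => a) y /\ forall v, 'd (fun _ : V => a) y v = 0.
Proof.
split; first exact: differentiable_cst.
by move=> v; have -> : 'd (fun _ : V => a) y = 0 :> (V -> W) by exact: diff_cst.
Qed.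

Lemma diff_bigsum (V W : normedModType R) (I : Type) (s : seq I)
    (F : I -> V -> W) (x : V) :
  (forall i, differentiable (F i) x) ->
  differentiable (fun y => \sum_(i <- s) F i y) x /\
  forall v, 'd (fun y => \sum_(i <- s) F i y) x v = \sum_(i <- s) 'd (F i) x v.
Proof.
move=> dF; elim: s => [|i s [IH1 IH2]].
  have -> : (fun y => \sum_(i <- [::]) F i y) = cst 0.
    by apply/funext => y; rewrite big_nil.
  by split => [|v]; [exact: differentiable_cst | rewrite diff_cst big_nil].
have -> : (fun y => \sum_(i <- i :: s) F i y)
   = (fun y => F i y + \sum_(i <- s) F i y).
  by apply/funext => y; rewrite big_cons.
have [d1 d2] := diffD_fun (dF i) IH1.
split=> // v; apply: etrans (d2 v) _; rewrite big_cons; congr (_ + _); exact: IH2.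
Qed.

Definition partial (p : nat) (i : 'I_p) (f : 'cV[R]_p -> R) : 'cV[R]_p -> R :=
  fun x => 'd f x (delta_mx i 0).

Lemma cV_sum_delta (p : nat) (v : 'cV[R]_p) :
  v = \sum_i v i 0 *: delta_mx i 0.
Proof.
by rewrite {1}[v]matrix_sum_delta; apply: eq_bigr => i _; rewrite big_ord1.
Qed.

Lemma diff_pd (W : normedModType R) (p : nat) (f : 'cV[R]_p -> W) x v :
  'd f x v = \sum_i v i 0 *: 'd f x (delta_mx i 0).
Proof.
rewrite {1}[v]cV_sum_delta linear_sum; apply: eq_bigr => i _.
by rewrite linearZ.
Qed.

Lemma colE_delta (q : nat) (h : 'I_q -> R) :
  \col_r h r = \sum_r h r *: delta_mx r 0 :> 'cV[R]_q.
Proof. by rewrite [LHS]cV_sum_delta; apply: eq_bigr => r _; rewrite mxE. Qed.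

Lemma continuous_col (V : topologicalType) (q : nat) (g : 'I_q -> V -> R) x :
  (forall r, {for x, continuous (g r)}) ->
  {for x, continuous (fun y => \col_r g r y : 'cV[R]_q)}.
Proof.
move=> cg; rewrite /prop_for /continuous_at colE_delta.
under eq_fun do rewrite colE_delta.
by apply: cvg_bigsum => r; apply: cvgZr_tmp; exact: cg.
Qed.

Lemma differentiable_col (V : normedModType R) (q : nat) (g : 'I_q -> V -> R) x :
  (forall r, differentiable (g r) x) ->
  differentiable (fun y => \col_r g r y : 'cV[R]_q) x /\
  forall v, 'd (fun y => \col_r g r y : 'cV[R]_q) x v = \col_r 'd (g r) x v.
Proof.
move=> dg.
have -> : (fun y => \col_r g r y : 'cV[R]_q)
        = (fun y => \sum_r g r y *: delta_mx r 0).
  by apply/funext => y; rewrite colE_delta.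
have [|d1 d2] := @diff_bigsum V 'cV[R]_q 'I_q (index_enum _)
    (fun r y => g r y *: delta_mx r 0) x.
  by move=> r; exact: differentiableZl.
split => // v; rewrite d2 colE_delta; apply: eq_bigr => r _.
by rewrite diffZl.
Qed.

(** * Families with bounded jets at the origin *)

Section Jets.
Context {T : Type} (S : set T).
Implicit Types (psi : T -> R).

(** A family f t, t in S, is smooth to order l and its partial derivatives of
    order at most l at the origin are O(psi t), uniformly on S.  Only partial
    derivatives enter, so that closure under algebraic operations and
    composition is a structural induction on l. *)
Fixpoint jet_bound (p l : nat) psi (f : T -> 'cV[R]_p -> R) : Prop :=
  (exists C, forall t, S t -> `|f t 0| <= C * psi t) /\
  match l with
  | 0 => forall t, S t -> continuous (f t)
  | l'.+1 => (forall t, S t -> forall x, differentiable (f t) x) /\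
     forall i, jet_bound l' psi (fun t => partial i (f t))
  end.

Lemma jet_bound_cont p l psi (f : T -> 'cV[R]_p -> R) t :
  jet_bound l psi f -> S t -> continuous (f t).
Proof.
case: l => [[_ +]|l [_ [+ _]]]; first exact.
move=> + St x => /(_ _ St x); exact: differentiable_continuous.
Qed.

Lemma jet_bound_at0 p l psi (f : T -> 'cV[R]_p -> R) :
  jet_bound l psi f -> exists C, forall t, S t -> `|f t 0| <= C * psi t.
Proof. by case: l => [[]|l []]. Qed.

Lemma jet_bound_diff p l psi (f : T -> 'cV[R]_p -> R) t x :
  jet_bound l.+1 psi f -> S t -> differentiable (f t) x.
Proof. by case=> _ [+ _] St => /(_ _ St x). Qed.

Lemma jet_boundS p l psi (f : T -> 'cV[R]_p -> R) : jet_bound l.+1 psi f -> jet_bound l psi f.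
Proof.
elim: l f => [|l IH] f.
  by move=> H; split; [exact: jet_bound_at0 H | move=> t; exact: jet_bound_cont H].
by case=> H0 [H1 H2]; split => //; split => // i; apply: IH.
Qed.

Lemma jet_bound_le p l l' psi (f : T -> 'cV[R]_p -> R) :
  (l' <= l)%N -> jet_bound l psi f -> jet_bound l' psi f.
Proof.
elim: l => [|l IH]; first by rewrite leqn0 => /eqP ->.
by rewrite leq_eqVlt => /orP[/eqP -> //|/IH{}IH /jet_boundS].
Qed.

Lemma jet_bound_eq p l psi (f g : T -> 'cV[R]_p -> R) :
  (forall t, S t -> f t = g t) -> jet_bound l psi f -> jet_bound l psi g.
Proof.
elim: l f g => [|l IH] f g fg [[C f0] H]; (split;
  first by exists C => t St; rewrite -fg//; exact: f0).
  by move=> t St; rewrite -fg//; exact: H.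
case: H => H1 H2; split => [t St x|i]; first by rewrite -fg//; exact: H1.
by apply: IH (H2 i) => t St; rewrite fg.
Qed.

Lemma jet_bound_cst p l psi (a : T -> R) :
  (exists C, forall t, S t -> `|a t| <= C * psi t) ->
  jet_bound l psi (fun t (_ : 'cV[R]_p) => a t).
Proof.
elim: l a => [|l IH] a [C aC]; (split; first by exists C).
  by move=> t _; exact: cst_continuous.
split => [t _ x|i]; first exact: differentiable_cst.
apply: (@jet_bound_eq _ _ _ (fun _ _ => 0)).
  move=> t _; apply/funext => x; rewrite /partial.
  by rewrite (_ : (fun=> a t) = cst (a t))// diff_cst.
by apply: IH; exists 0 => t _; rewrite normr0 mul0r.
Qed.

Lemma jet_bound_add p l psi (f g : T -> 'cV[R]_p -> R) :
  jet_bound l psi f -> jet_bound l psi g -> jet_bound l psi (fun t x => f t x + g t x).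
Proof.
elim: l f g => [|l IH] f g [[C f0] Hf] [[D g0] Hg]; (split;
  first by exists (C + D) => t St; rewrite mulrDl (le_trans (ler_normD _ _))//;
    rewrite lerD ?f0 ?g0).
  by move=> t St x; apply: continuousD; [exact: Hf|exact: Hg].
case: Hf Hg => Hf1 Hf2 [Hg1 Hg2]; split => [t St x|i].
  exact: (diffD_fun (Hf1 t St x) (Hg1 t St x)).1.
apply: jet_bound_eq (IH _ _ (Hf2 i) (Hg2 i)) => t St; apply/funext => x.
exact/esym/(diffD_fun (Hf1 t St x) (Hg1 t St x)).2.
Qed.

(** By the Leibniz rule; the bounds of the two factors multiply, so one of
    them is taken bounded to stay within O(psi). *)
Lemma jet_bound_mul p l psi (f g : T -> 'cV[R]_p -> R) :
  jet_bound l (cst 1) f -> jet_bound l psi g -> jet_bound l psi (fun t x => f t x * g t x).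
Proof.
elim: l f g => [|l IH] f g Hf Hg.
  case: (Hf) (Hg) => [[C f0] cf] [[D g0] cg]; split.
    exists (C * D) => t St; rewrite -mulrA normrM.
    by apply: ler_pM => //; [rewrite -[C]mulr1; exact: f0|exact: g0].
  by move=> t St x; apply: continuousM; [exact: cf|exact: cg].
case: (Hf) (Hg) => [[C f0] [Hf1 Hf2]] [[D g0] [Hg1 Hg2]]; split.
  exists (C * D) => t St; rewrite -mulrA normrM.
  by apply: ler_pM => //; [rewrite -[C]mulr1; exact: f0|exact: g0].
split => [t St x|i].
  exact: (diffM_fun (Hf1 t St x) (Hg1 t St x)).1.
apply: jet_bound_eq (jet_bound_add (IH _ _ (jet_boundS Hf) (Hg2 i)) _).
  2: by apply: jet_bound_eq (IH _ _ (Hf2 i) (jet_boundS Hg)) => t St; reflexivity.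
move=> t St; apply/funext => x.
apply: etrans (esym ((diffM_fun (Hf1 t St x) (Hg1 t St x)).2 _)).
by rewrite [partial _ _ _ * _]mulrC.
Qed.

Lemma jet_bound_sum p l psi (I : Type) (s : seq I) (P : pred I)
    (f : I -> T -> 'cV[R]_p -> R) :
  (forall i, P i -> jet_bound l psi (f i)) ->
  jet_bound l psi (fun t x => \sum_(i <- s | P i) f i t x).
Proof.
move=> H; elim: s => [|i s IH].
  apply: jet_bound_eq (@jet_bound_cst p l psi (fun=> 0) _) => [t _|].
    by apply/funext => x; rewrite big_nil.
  by exists 0 => t _; rewrite normr0 mul0r.
case Pi : (P i); last first.
  by apply: jet_bound_eq IH => t _; apply/funext => x; rewrite big_cons Pi.
apply: jet_bound_eq (jet_bound_add (H i Pi) IH) => t _.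
by apply/funext => x; rewrite big_cons Pi.
Qed.

Lemma jet_bound_prod p l (I : Type) (s : seq I) (P : pred I)
    (f : I -> T -> 'cV[R]_p -> R) :
  (forall i, P i -> jet_bound l (cst 1) (f i)) ->
  jet_bound l (cst 1) (fun t x => \prod_(i <- s | P i) f i t x).
Proof.
move=> H; elim: s => [|i s IH].
  apply: jet_bound_eq (@jet_bound_cst p l (cst 1) (fun=> 1) _) => [t _|].
    by apply/funext => x; rewrite big_nil.
  by exists 1 => t _; rewrite normr1 mul1r.
case Pi : (P i); last first.
  by apply: jet_bound_eq IH => t _; apply/funext => x; rewrite big_cons Pi.
apply: jet_bound_eq (jet_bound_mul (H i Pi) IH) => t _.
by apply/funext => x; rewrite big_cons Pi.
Qed.

Lemma jet_bound_opp p l psi (f : T -> 'cV[R]_p -> R) :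
  jet_bound l psi f -> jet_bound l psi (fun t x => - f t x).
Proof.
move=> H; apply: jet_bound_eq (jet_bound_mul (@jet_bound_cst p l (cst 1) (fun=> -1) _) H).
  by move=> t _; apply/funext => x; rewrite mulN1r.
by exists 1 => t _; rewrite normrN normr1 mulr1.
Qed.

Lemma jet_bound_sub p l psi (f g : T -> 'cV[R]_p -> R) :
  jet_bound l psi f -> jet_bound l psi g -> jet_bound l psi (fun t x => f t x - g t x).
Proof. by move=> Hf Hg; exact: (jet_bound_add Hf (jet_bound_opp Hg)). Qed.

Lemma jet_bound_mulc p l psi (a : T -> R) (f : T -> 'cV[R]_p -> R) :
  (exists C, forall t, S t -> `|a t| <= C * psi t) ->
  jet_bound l (cst 1) f -> jet_bound l psi (fun t x => a t * f t x).
Proof.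
move=> Ha Hf; have := jet_bound_mul Hf (@jet_bound_cst p l psi a Ha).
by apply: jet_bound_eq => t _; apply/funext => x; rewrite mulrC.
Qed.

Lemma diff_coord p (i : 'I_p) (x v : 'cV[R]_p) :
  'd (fun y : 'cV[R]_p => y i 0) x v = v i 0.
Proof.
have lin : linear (fun y : 'cV[R]_p => y i 0).
  by move=> a u w; rewrite !mxE.
pose L := GRing.isLinear.Build R _ _ _ _ lin.
pose f : {linear 'cV[R]_p -> R} := HB.pack (fun y : 'cV[R]_p => y i 0) L.
have cf : continuous f by move=> y; exact: coord_continuous.
by rewrite (_ : (fun _ => _) = f)// (diff_lin _ cf).
Qed.

Lemma jet_bound_coord p l (i : 'I_p) : jet_bound l (cst 1) (fun (_ : T) (x : 'cV[R]_p) => x i 0).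
Proof.
have H0 : exists C : R, forall t, S t -> `|(0 : 'cV[R]_p) i 0| <= C * cst 1 t.
  by exists 0 => t _; rewrite mxE normr0 mul0r.
case: l => [|l]; split => //; first by move=> t _ x; exact: coord_continuous.
split => [t _ x|i']; first exact: differentiable_coord.
apply: jet_bound_eq (@jet_bound_cst p l (cst 1) (fun=> (delta_mx i' 0 : 'cV[R]_p) i 0) _).
  by move=> t _; apply/funext => x; rewrite /partial diff_coord.
by exists `|(delta_mx i' 0 : 'cV[R]_p) i 0| => t _; rewrite mulr1.
Qed.

(** The partial derivatives of 1/q are products of those of q and of 1/q
    itself, so the induction on l closes; the hypothesis on the value at the
    origin starts it. *)
Lemma jet_bound_inv p l (q : T -> 'cV[R]_p -> R) :
  (forall t x, S t -> q t x != 0) ->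
  (exists C, forall t, S t -> `|(q t 0)^-1| <= C) ->
  jet_bound l (cst 1) q -> jet_bound l (cst 1) (fun t x => (q t x)^-1).
Proof.
move=> q0 [C qC]; elim: l q q0 qC => [|l IH] q q0 qC Hq.
  split; first by exists C => t St; rewrite mulr1; exact: qC.
  move=> t St x.
  by apply: (@continuousV _ _ (q t) x (q0 t x St)); exact: (jet_bound_cont Hq).
split; first by exists C => t St; rewrite mulr1; exact: qC.
case: (Hq) => _ [H1 H2]; split => [t St x|i].
  exact: (diffV_fun (H1 t St x) (q0 t x St)).1.
have IHq := IH q q0 qC (jet_boundS Hq).
apply: jet_bound_eq (jet_bound_opp (jet_bound_mul (jet_bound_mul IHq IHq) (H2 i))) => t St.
apply/funext => x; apply: etrans (esym ((diffV_fun (H1 t St x) (q0 t x St)).2 _)).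
by rewrite -!mulNr.
Qed.

(** The inner maps fix the origin, so the derivatives of f are evaluated at
    the origin, where they are O(psi). *)
Lemma jet_bound_comp p q l psi (f : T -> 'cV[R]_q -> R) (g : T -> 'I_q -> 'cV[R]_p -> R) :
  (forall t r, S t -> g t r 0 = 0) ->
  jet_bound l psi f -> (forall r, jet_bound l (cst 1) (fun t => g t r)) ->
  jet_bound l psi (fun t x => f t (\col_r g t r x)).
Proof.
move=> g0.
have E0 t : S t -> \col_r g t r 0 = 0 :> 'cV[R]_q.
  by move=> St; apply/matrixP => r z; rewrite !mxE g0.
elim: l f => [|l IH] f Hf Hg.
  case: (Hf) => [[C fC] cf]; split.
    by exists C => t St; rewrite E0//; exact: fC.
  move=> t St x; apply: (@continuous_comp _ _ _ (fun x => \col_r g t r x) (f t)); last exact: cf.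
  by apply: continuous_col => r; exact: (jet_bound_cont (Hg r) St).
case: (Hf) => [[C fC] [H1 H2]]; split.
  by exists C => t St; rewrite E0//; exact: fC.
have dg t x : S t -> forall r, differentiable (g t r) x.
  by move=> St r; exact: (jet_bound_diff _ (Hg r)).
split => [t St x|i].
  exact: (diff_comp_fun (differentiable_col (dg t x St)).1 (H1 t St _)).1.
have K r : jet_bound l psi (fun t x => partial i (g t r) x * partial r (f t) (\col_r g t r x)).
  apply: jet_bound_mul; last first.
    by apply: (IH (fun t => partial r (f t)) (H2 r)) => r'; exact: jet_boundS (Hg r').
  by case: (Hg r) => _ [_ /(_ i)].
apply: jet_bound_eq (jet_bound_sum (index_enum 'I_q) (fun r (_ : xpredT r) => K r)) => t St.
apply/funext => x.
have [d1 d2] := differentiable_col (dg t x St).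
apply: etrans (esym ((diff_comp_fun d1 (H1 t St _)).2 _)).
by rewrite diff_pd d2; apply: eq_bigr => r _; rewrite mxE.
Qed.

End Jets.
End Calculus.

(** * Iterated derivatives and flat functions *)

Section Nder.
Context {R : realType}.

(** The recursion of nder differentiates last in the head of the list; this is
    the opposite decomposition, which lets inductions start from 'd f. *)
Lemma nder_rcons (V W : normedModType R) (f : V -> W) vs v :
  nder f (rcons vs v) = nder (fun x => 'd f x v) vs.
Proof. by elim: vs => [//|u vs IH] /=; rewrite IH. Qed.

Definition bvec p (i : 'I_p) : 'cV[R]_p := delta_mx i 0.

Lemma normrV_ge p (x : 'cV[R]_p) i : `|x i 0| <= `|x|.
Proof.
by rewrite {2}/Num.norm/= mx_normrE; apply: (le_bigmax _ (fun ij => `|x ij.1 ij.2|) (i, 0)).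
Qed.

Lemma normrM_ge m n (x : 'M[R]_(m, n)) i j : `|x i j| <= `|x|.
Proof.
by rewrite {2}/Num.norm/= mx_normrE; apply: (le_bigmax _ (fun ij => `|x ij.1 ij.2|) (i, j)).
Qed.

Lemma normrM_le m n (x : 'M[R]_(m, n)) B : 0 <= B ->
  (forall i j, `|x i j| <= B) -> `|x| <= B.
Proof.
move=> B0 H; rewrite {1}/Num.norm/= mx_normrE.
by apply: bigmax_le => // -[i j] _; exact: H.
Qed.

Lemma norm_bvec p (i : 'I_p) : `|bvec i| <= 1.
Proof. by apply: normrM_le => // a b; rewrite mxE; case: (_ && _); rewrite ?normr1 ?normr0 ?ler01. Qed.

Lemma diff_translation (V : normedModType R) (a x : V) :
  differentiable (fun y : V => y + a) x /\
  forall v, 'd (fun y : V => y + a) x v = v.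
Proof.
have did : differentiable (@id V) x by [].
have := diffD_fun did (differentiable_cst a x).
rewrite (_ : (fun y : V => id y + cst a y) = (fun y => y + a))// => -[e1 e2].
split=> [|v]; first exact: e1.
have E1 : 'd (@id V) x = id :> (V -> V) by apply: diff_val.
have E2 : 'd (cst a) x = 0 :> (V -> V) by apply: diff_cst.
by rewrite e2 E1 E2 addr0.
Qed.

Lemma diff_line (V : normedModType R) (x v : V) (s : R) :
  differentiable (fun s : R => x + s *: v) s /\
  forall w, 'd (fun s : R => x + s *: v) s w = w *: v.
Proof.
have did : differentiable (@id R) s by [].
have dz : differentiable (fun s : R => s *: v) s by exact: (differentiableZl (k := id)).
have := diffD_fun (differentiable_cst x s) dz.
rewrite (_ : (fun s : R => cst x s + s *: v) = (fun s => x + s *: v))// => -[e1 e2].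
split=> [|w]; first exact: e1.
have E1 : 'd (@id R) s = id :> (R -> R) by apply: diff_val.
have E2 : 'd (cst x) s = 0 :> (R -> V) by apply: diff_cst.
rewrite e2 E2 add0r.
have E3 := diffZl v did.
by rewrite (_ : (fun s : R => s *: v) = (fun z => id z *: v))// E3 E1.
Qed.

Section Family.
Context {T : Type} (S : set T) (p : nat).
Implicit Types (psi : T -> R) (f : T -> 'cV[R]_p -> R).
Notation V := 'cV[R]_p.

Lemma jet_bound_dir l psi f v : jet_bound S l.+1 psi f ->
  jet_bound S l psi (fun t x => 'd (f t) x v).
Proof.
case=> _ [_ H].
have K i : jet_bound S l psi (fun t x => v i 0 * partial i (f t) x).
  apply: jet_bound_mul (H i); apply: jet_bound_cst.
  by exists `|v i 0| => t _; rewrite mulr1.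
apply: jet_bound_eq (jet_bound_sum (index_enum 'I_p) (fun i (_ : xpredT i) => K i)) => t _.
by apply/funext => x; rewrite [RHS]diff_pd.
Qed.

Lemma jet_bound_nder l psi f vs : (size vs <= l)%N -> jet_bound S l psi f ->
  jet_bound S (l - size vs) psi (fun t => nder (f t) vs).
Proof.
elim/last_ind: vs l f => [|vs v IH] l f; first by rewrite subn0.
case: l => [|l]; first by rewrite size_rcons.
rewrite size_rcons ltnS subSS => svs Hf.
by under [X in jet_bound _ _ _ X]eq_fun do rewrite nder_rcons; exact: IH (jet_bound_dir v Hf).
Qed.

Lemma jet_bound_nder_cont l psi f t vs : jet_bound S l psi f -> S t -> (size vs <= l)%N ->
  continuous (nder (f t) vs).
Proof. by move=> Hf St s; exact: (jet_bound_cont (jet_bound_nder s Hf) St). Qed.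

Lemma jet_bound_nder_diff l psi f t vs x : jet_bound S l psi f -> S t -> (size vs < l)%N ->
  differentiable (nder (f t) vs) x.
Proof.
move=> Hf St s; have := jet_bound_nder (ltnW s) Hf; rewrite -(subnSK s) => H.
exact: jet_bound_diff H St.
Qed.

Lemma nder_sum (I : Type) (s : seq I) (a : I -> R) (g : I -> V -> R) l vs :
  (forall i vs, (size vs < l)%N -> forall x, differentiable (nder (g i) vs) x) ->
  (size vs <= l)%N ->
  nder (fun x => \sum_(i <- s) a i * g i x) vs =
  (fun x => \sum_(i <- s) a i * nder (g i) vs x).
Proof.
move=> dg; elim: vs => [//|v vs IH] /= svs; rewrite IH ?(ltnW svs)//.
apply/funext => x.
have d i : differentiable (fun y => a i *: nder (g i) vs y) x.
  by apply: differentiableZ; exact: dg.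
have [_ ->] := @diff_bigsum _ _ _ _ s _ x d.
by apply: eq_bigr => i _; rewrite diffZ//; exact: dg.
Qed.

(** Multilinearity turns the bounds on partial derivatives into a bound on
    the whole derivative as a multilinear map. *)
Lemma jet_bound_nder_bound l psi f : (forall t, S t -> 0 <= psi t) -> jet_bound S l psi f ->
  exists2 C, 0 <= C & forall t vs, S t -> (size vs <= l)%N ->
    `|nder (f t) vs 0| <= C * psi t * \prod_(v <- vs) `|v|.
Proof.
move=> psi0; elim: l f => [|l IH] f Hf.
  have [C HC] := jet_bound_at0 Hf; exists `|C| => // t [|//] St _.
  by rewrite big_nil mulr1 (le_trans (HC t St))// ler_wpM2r ?psi0// ler_norm.
have [C HC] := jet_bound_at0 Hf.
have /choice[D HD] : forall i, exists D : R, 0 <= D /\ forall t vs, S t -> (size vs <= l)%N ->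
    `|nder (partial i (f t)) vs 0| <= D * psi t * \prod_(v <- vs) `|v|.
  by move=> i; case: (Hf) => _ [_ /(_ i)/IH[D D0 HD]]; exists D.
have D0 : 0 <= \sum_i D i by apply: sumr_ge0 => i _; exact: (HD i).1.
exists (`|C| + \sum_i D i); first exact: addr_ge0.
move=> t vs St; elim/last_ind: vs => [_|vs v _].
  rewrite big_nil mulr1 (le_trans (HC t St))// ler_wpM2r ?psi0//.
  by rewrite (le_trans (ler_norm _))// lerDl.
rewrite size_rcons ltnS nder_rcons => svs.
have -> : (fun x => 'd (f t) x v) = (fun x => \sum_i v i 0 * partial i (f t) x).
  by apply/funext => x; rewrite [LHS]diff_pd.
have dd i us : (size us < l)%N -> forall x, differentiable (nder (partial i (f t)) us) x.
  move=> sus x; case: (Hf) => _ [_ /(_ i) Hi]; exact: (jet_bound_nder_diff x Hi St sus).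
rewrite (nder_sum _ _ dd svs) -cats1 big_cat big_seq1/=.
rewrite (le_trans (ler_norm_sum _ _ _))//.
apply: (@le_trans _ _ (\sum_i D i * psi t * (\prod_(u <- vs) `|u|) * `|v|)).
  apply: ler_sum => i _; rewrite normrM mulrC ler_pM//; last exact: normrV_ge.
  exact: (HD i).2.
rewrite -!mulr_suml -!mulrA ler_wpM2r//; last by rewrite lerDr.
by rewrite !mulr_ge0 ?psi0 ?prodr_ge0.
Qed.

(** Converse passage, from derivatives along basis vectors to jets. *)
Lemma nder_jet_bound l psi f :
  (forall t bs, S t -> (size bs < l)%N -> forall x,
      differentiable (nder (f t) (map (@bvec p) bs)) x) ->
  (forall t bs, S t -> (size bs <= l)%N -> continuous (nder (f t) (map (@bvec p) bs))) ->
  (forall bs, (size bs <= l)%N ->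
     exists C, forall t, S t -> `|nder (f t) (map (@bvec p) bs) 0| <= C * psi t) ->
  jet_bound S l psi f.
Proof.
elim: l f => [|l IH] f Hd Hc Hb; (split; first exact: (Hb [::])).
  by move=> t St; exact: (Hc t [::] St).
split=> [t St x|i]; first exact: (Hd t [::]).
have E t bs : nder (partial i (f t)) (map (@bvec p) bs)
            = nder (f t) (map (@bvec p) (rcons bs i)).
  by rewrite map_rcons nder_rcons.
apply: IH => [t bs St sb x|t bs St sb|bs sb].
- by rewrite E; apply: Hd => //; rewrite size_rcons.
- by rewrite E; apply: Hc => //; rewrite size_rcons.
- have [|C HC] := Hb (rcons bs i); first by rewrite size_rcons.
  by exists C => t St; rewrite E; exact: HC.
Qed.

End Family.

Section Flat.
Context (p : nat).
Notation V := 'cV[R]_p.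
Implicit Types (f : V -> R).

Definition flat (m : nat) (f : V -> R) : Prop :=
  forall e : R, 0 < e -> exists2 dl : R, 0 < dl &
    forall y, `|y| < dl -> `|f y| <= e * `|y| ^+ m.

(** Iterated differences; they satisfy a mean value theorem and, unlike
    derivatives, are visibly symmetric and bounded by the size of f. *)
Fixpoint fdiff f (vs : seq V) : V -> R :=
  match vs with
  | [::] => f
  | v :: vs' => fun x => fdiff f vs' (x + v) - fdiff f vs' x
  end.

Lemma diff_shift (W : normedModType R) (f : V -> W) (a x : V) :
  differentiable f (x + a) ->
  differentiable (fun y => f (y + a)) x /\
  forall v, 'd (fun y => f (y + a)) x v = 'd f (x + a) v.
Proof.
move=> df.
have [d1 d2] := diff_translation a x.
have [d3 d4] := @diff_comp_fun _ _ _ _ (fun y => y + a) f x d1 df.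
by split=> [|v]; [exact: d3|]; apply: etrans (d4 v) _; congr ('d f _ _); exact: d2.
Qed.

Lemma fdiff_diff f vs : (forall x, differentiable f x) -> forall x,
  differentiable (fdiff f vs) x /\
  forall v, 'd (fdiff f vs) x v = fdiff (fun y => 'd f y v) vs x.
Proof.
move=> df; elim: vs => [//|u vs IH] x /=.
have [d1 d2] := diff_shift (IH (x + u)).1.
have [d3 d4] := IH x.
have [dN dN'] : differentiable (fun y => - fdiff f vs y) x /\
    forall v, 'd (fun y => - fdiff f vs y) x v = - 'd (fdiff f vs) x v.
  split => [|v]; first exact: (differentiableN (f := fdiff f vs)).
  by rewrite (diffN (f := fdiff f vs)).
have [d5 d6] := diffD_fun d1 dN; split=> [|v]; first exact: d5.
apply: etrans (d6 v) _; congr (_ + _).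
  by apply: etrans (d2 v) _; exact: (IH (x + u)).2.
by apply: etrans (dN' v) _; congr (- _); exact: d4.
Qed.

Lemma mean_value f (x v : V) : (forall y, differentiable f y) ->
  exists2 th : R, 0 <= th <= 1 & f (x + v) - f x = 'd f (x + th *: v) v.
Proof.
move=> df; pose g (s : R) := f (x + s *: v).
have dg (s : R) : is_derive s 1 g ('d f (x + s *: v) v).
  have [d1 d2] := diff_line x v s.
  have [d3 d4] := @diff_comp_fun _ _ _ _ (fun s : R => x + s *: v) f s d1 (df (x + s *: v)).
  apply: DeriveDef; first exact/derivable1_diffP.
  rewrite deriveE//; apply: etrans (d4 1) _; congr ('d f _ _).
  by apply: etrans (d2 1) _; rewrite scale1r.
have cg : {within `[0, 1], continuous g}.
  by apply: derivable_within_continuous => s _; exact: ex_derive.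
have [c + gc] := @MVT_segment R g (fun s => 'd f (x + s *: v) v) 0 1 ler01
    (fun s _ => dg s) cg.
rewrite in_itv /= => c01; exists c; first exact: c01.
by move: gc; rewrite /g scale1r scale0r addr0 subr0 mulr1.
Qed.

(** Iterated mean value theorem. *)
Lemma fdiff_nder f l vs : (size vs <= l)%N ->
  (forall ws, (size ws < l)%N -> forall x, differentiable (nder f ws) x) ->
  forall x, exists2 xi, `|xi - x| <= \sum_(v <- vs) `|v| &
    fdiff f vs x = nder f (rev vs) xi.
Proof.
elim: vs l f => [|v vs IH] l f svs df x.
  by exists x => //; rewrite subrr normr0 big_nil.
case: l svs df => [//|l]; rewrite ltnS => svs df.
have df0 : forall y, differentiable f y by exact: (df [::]).
have [th /andP[th0 th1] E] := mean_value x v (fun y => (fdiff_diff vs df0 y).1).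
rewrite /= E (fdiff_diff vs df0 _).2.
have [|xi xi1 ->] := IH l (fun y => 'd f y v) svs _ (x + th *: v).
  by move=> ws sws y; rewrite -nder_rcons; apply: df; rewrite size_rcons.
exists xi; last by rewrite rev_cons nder_rcons.
have -> : xi - x = (xi - (x + th *: v)) + th *: v.
  by rewrite opprD addrA subrK.
rewrite (le_trans (ler_normD _ _))// big_cons addrC lerD//.
by rewrite normrZ ger0_norm// ler_piMl.
Qed.

Lemma fdiff_bound f vs (r B : R) :
  (forall y, `|y| <= r -> `|f y| <= B) ->
  forall x, `|x| + \sum_(v <- vs) `|v| <= r ->
  `|fdiff f vs x| <= 2 ^+ size vs * B.
Proof.
move=> fB; elim: vs => [|v vs IH] x.
  by rewrite big_nil addr0 expr0 mul1r; exact: fB.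
rewrite big_cons => xr /=; rewrite (le_trans (ler_normB _ _))//.
rewrite exprS -mulrA mulr_natl mulr2n lerD//; apply: IH.
  by rewrite (le_trans _ xr)// addrA lerD2r ler_normD.
by rewrite (le_trans _ xr)// lerD2l lerDr.
Qed.

Lemma nder_scale f l (s : R) vs :
  (forall ws, (size ws < l)%N -> forall x, differentiable (nder f ws) x) ->
  (size vs <= l)%N ->
  nder f (map ( *:%R s) vs) = (fun x => s ^+ size vs * nder f vs x).
Proof.
move=> df; elim: vs => [|v vs IH] svs.
  by apply/funext => x; rewrite /= mul1r.
apply/funext => x /=; rewrite (IH (ltnW svs)).
rewrite (diffZ (f := nder f vs) (s ^+ size vs)); last exact: df.
by rewrite linearZ/= exprS scalerA mulrC [_ * s]mulrC.
Qed.

(** If D^m f(0)(v_1, ..., v_m) were nonzero, the iterated difference with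
    steps s v_i would be of exact order s^m by the mean value theorem, whereas
    flatness makes it o(s^m). *)
Lemma flat_nder f l vs : flat l f ->
  (forall ws, (size ws < l)%N -> forall x, differentiable (nder f ws) x) ->
  (forall ws, (size ws <= l)%N -> continuous (nder f ws)) ->
  (size vs <= l)%N -> nder f vs 0 = 0.
Proof.
move=> fl df cf svs; apply/eqP/negPn/negP => nz.
pose eta := `|nder f vs 0| / 2.
have eta0 : 0 < eta by rewrite divr_gt0// normr_gt0.
have [d1 d10 Hd1] : exists2 d1 : R, 0 < d1 &
    forall y, `|y| < d1 -> eta < `|nder f vs y|.
  have := cf vs svs 0 => /cvgrPdist_lt /(_ eta eta0)/nbhs_ballP[d1 /= d10 H].
  exists d1 => // y yd; have := H y; rewrite -ball_normE /= sub0r normrN => /(_ yd) Hy.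
  by have := lerB_dist (nder f vs 0) (nder f vs y); rewrite /eta in Hy *; lra.
pose us := rev vs.
pose M := 1 + \sum_(v <- us) `|v|.
have M0 : 0 < M by rewrite ltr_pwDl// sumr_ge0.
(* with this e flatness bounds the iterated difference by s^l eta / 2 *)
pose e := eta / 2 / (2 ^+ size vs * M ^+ l).
have den0 : 0 < 2 ^+ size vs * M ^+ l by rewrite mulr_gt0// exprn_gt0.
have e0 : 0 < e by rewrite /e; apply: divr_gt0 => //; exact: divr_gt0.
have [d2 d20 Hd2] : exists2 dl : R, 0 < dl &
    forall y, `|y| < dl -> `|f y| <= e * `|y| ^+ l by exact: fl.
(* all points of the iterated difference stay where both bounds hold *)
pose s := Num.min 1 (Num.min d1 d2 / 2 / M).
have d120 : 0 < Num.min d1 d2 by rewrite lt_min d10 d20.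
have s0 : 0 < s by rewrite /s lt_min ltr01/=; do 2 apply: divr_gt0 => //.
have sM : s * M < Num.min d1 d2.
  rewrite (@le_lt_trans _ _ (Num.min d1 d2 / 2))//.
    by rewrite -ler_pdivlMr// /s ge_min lexx orbT.
  by rewrite ltr_pdivrMr// ltr_pMr ?ltr1n// lt_min d10 d20.
have sum_s : \sum_(v <- map ( *:%R s) us) `|v| <= s * M.
  rewrite big_map (eq_bigr (fun v => s * `|v|)); last first.
    by move=> v _; rewrite normrZ gtr0_norm.
  by rewrite -mulr_sumr ler_wpM2l ?(ltW s0)// lerDr.
have sus : (size (map ( *:%R s) us) <= l)%N by rewrite size_map size_rev.
have [xi xi1 E] := fdiff_nder sus df 0.
have := @fdiff_bound f (map ( *:%R s) us) (s * M) (e * (s * M) ^+ l) _ 0.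
rewrite normr0 add0r => /(_ _ sum_s) B.
have : s ^+ size vs * eta < s ^+ size vs * eta; last by rewrite ltxx.
apply: (@lt_le_trans _ _ (`|fdiff f (map ( *:%R s) us) 0|)).
  rewrite E -map_rev revK (nder_scale s df svs) normrM normrX gtr0_norm//.
  rewrite ltr_pM2l ?exprn_gt0//; apply: Hd1.
  rewrite -[xi]subr0 (le_lt_trans xi1)// (le_lt_trans sum_s)// (lt_le_trans sM)//.
  by rewrite ge_min lexx.
rewrite (le_trans (B _))//.
  move=> y yr; rewrite (le_trans (Hd2 y _))//.
    by rewrite (le_lt_trans yr)// (lt_le_trans sM)// ge_min lexx orbT.
  by rewrite ler_wpM2l ?(ltW e0)// lerXn2r ?nnegrE// mulr_ge0// ltW.
rewrite size_map size_rev /e exprMn.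
have -> : 2 ^+ size vs * (eta / 2 / (2 ^+ size vs * M ^+ l) * (s ^+ l * M ^+ l))
   = s ^+ l * (eta / 2).
  by field; rewrite ?expf_neq0 ?lt0r_neq0.
apply: ler_pM.
- by rewrite exprn_ge0// ltW.
- by rewrite ltW// divr_gt0.
- by rewrite ler_wiXn2l ?(ltW s0)// /s ge_min lexx.
- by rewrite ltW// ltr_pdivrMr// ltr_pMr// ltr1n.
Qed.

End Flat.
End Nder.

(** * Derivatives from difference quotients and from coordinates *)

Section Slope.
Context {R : realType}.

Lemma linear_cV_continuous p (W : normedModType R) (f : {linear 'cV[R]_p -> W}) :
  continuous f.
Proof.
move=> x.
have -> : (f : _ -> W) = (fun y => \sum_i y i 0 *: f (bvec i)).
  apply/funext => y; rewrite [in LHS](cV_sum_delta y) linear_sum.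
  by apply: eq_bigr => i _; rewrite linearZ.
apply: (@continuous_bigsum _ 'cV[R]_p) => i; apply: (@continuous_scale _ 'cV[R]_p).
exact: coord_continuous.
Qed.

Lemma diff_eps (V W : normedModType R) (f : V -> W) (L : {linear V -> W}) x :
  continuous L ->
  (forall e : R, 0 < e -> \forall h \near 0, `|f (h + x) - f x - L h| <= e * `|h|) ->
  differentiable f x /\ forall v, 'd f x v = L v.
Proof.
move=> cL H.
have E : f \o shift x = cst (f x) + L +o_ 0 id.
  apply/eqaddoP => e e0; near=> h.
  rewrite !fctE /= opprD addrA; near: h; exact: H.
have D := diff_unique cL E.
split=> [|v]; last by rewrite D.
by apply/diff_locallyP; rewrite D.
Unshelve. all: by end_near. Qed.

Lemma continuous_family_shift (V : normedModType R) (I : finType) (g : I -> V -> R)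
    (x : V) (e : R) :
  0 < e -> (forall i, {for x, continuous (g i)}) ->
  \forall h \near (0 : V), forall i, `|g i (h + x) - g i x| <= e.
Proof.
move=> e0 cg; apply: filter_forall => i.
have sh : (h + x) @[h --> (0 : V)] --> (0 + x).
  by apply: cvgD; [exact: cvg_id|exact: cvg_cst].
rewrite add0r in sh.
have := @cvg_comp _ _ _ _ _ _ _ _ sh (cg i) => /cvgrPdist_le /(_ _ e0).
by apply: filterS => h; rewrite distrC.
Qed.

(** Differentiability in the sense of Caratheodory: the slopes g_i
    from the base point x are continuous at x. *)
Lemma slope_diff p (f : 'cV[R]_p -> R) (g : 'I_p -> 'cV[R]_p -> R) x :
  (forall y, f y - f x = \sum_i g i y * (y i 0 - x i 0)) ->
  (forall i, {for x, continuous (g i)}) ->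
  differentiable f x /\ forall v, 'd f x v = \sum_i g i x * v i 0.
Proof.
move=> fE cg.
have lin : linear (fun v : 'cV[R]_p => \sum_i g i x * v i 0).
  move=> a u w; rewrite scaler_sumr -big_split; apply: eq_bigr => i _ /=.
  by rewrite !mxE mulrDr /GRing.scale/= mulrCA.
pose L : {linear 'cV[R]_p -> R} :=
  HB.pack (fun v : 'cV[R]_p => \sum_i g i x * v i 0) (GRing.isLinear.Build R _ _ _ _ lin).
apply: (@diff_eps _ _ f L x); first exact: linear_cV_continuous.
move=> e e0.
have e1 : 0 < e / p.+1%:R by rewrite divr_gt0.
have : \forall h \near (0 : 'cV[R]_p), forall i, `|g i (h + x) - g i x| <= e / p.+1%:R.
  exact: continuous_family_shift.
apply: filterS => h Hh.
have -> : f (h + x) - f x - L h = \sum_i (g i (h + x) - g i x) * h i 0.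
  rewrite fE /= -sumrB; apply: eq_bigr => i _.
  by rewrite mxE addrK mulrBl.
rewrite (le_trans (ler_norm_sum _ _ _))//.
apply: (@le_trans _ _ (\sum_(i < p) e / p.+1%:R * `|h|)).
  apply: ler_sum => i _; rewrite normrM ler_pM//; exact: normrV_ge.
rewrite sumr_const card_ord -mulrnAl ler_wpM2r//.
by rewrite -mulr_natr mulrAC ler_pdivrMr// ler_wpM2l ?(ltW e0)// ler_nat.
Qed.

Lemma nder_lin (V W U : normedModType R) (L : {linear W -> U}) (f : V -> W) l vs :
  continuous L ->
  (forall ws, (size ws < l)%N -> forall x, differentiable (nder f ws) x) ->
  (size vs <= l)%N ->
  nder (fun x => L (f x)) vs = (fun x => L (nder f vs x)).
Proof.
move=> cL df; elim: vs => [//|v vs IH] svs /=; rewrite IH ?(ltnW svs)//.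
apply/funext => x.
have dL := linear_differentiable (nder f vs x) cL.
apply: etrans ((diff_comp_fun (df vs svs x) dL).2 v) _.
by rewrite diff_lin.
Qed.

Lemma nder_col (V : normedModType R) q (g : 'I_q -> V -> R) l vs :
  (forall r ws, (size ws < l)%N -> forall x, differentiable (nder (g r) ws) x) ->
  (size vs <= l)%N ->
  nder (fun x => \col_r g r x : 'cV[R]_q) vs = (fun x => \col_r nder (g r) vs x).
Proof.
move=> dg; elim: vs => [//|v vs IH] svs /=; rewrite IH ?(ltnW svs)//.
apply/funext => x.
exact: (differentiable_col (fun r => dg r vs svs x)).2.
Qed.

Definition coordL p (r : 'I_p) : {linear 'cV[R]_p -> R} :=
  HB.pack (fun x : 'cV[R]_p => x r 0)
    (GRing.isLinear.Build R _ _ _ (fun x : 'cV[R]_p => x r 0)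
      (fun a u w => etrans (mxE _ _ _ _) (congr1 (fun z => z + w r 0) (mxE _ _ _ _)))).

Lemma nder_coord (V : normedModType R) q (f : V -> 'cV[R]_q) l vs r :
  (forall ws, (size ws < l)%N -> forall x, differentiable (nder f ws) x) ->
  (size vs <= l)%N ->
  nder (fun x => f x r 0) vs = (fun x => nder f vs x r 0).
Proof.
move=> df svs; apply: (@nder_lin _ _ _ (coordL r) f l vs) => //.
exact: coord_continuous.
Qed.

Lemma jet_bound_Cn T (S : set T) t p q l psi (g : T -> 'I_q -> 'cV[R]_p -> R) :
  S t -> (forall r, jet_bound S l psi (fun t => g t r)) ->
  (forall vs, (size vs < l)%N -> forall x,
     differentiable (nder (fun x => \col_r g t r x : 'cV[R]_q) vs) x) /\
  (forall vs, (size vs <= l)%N ->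
     continuous (nder (fun x => \col_r g t r x : 'cV[R]_q) vs)).
Proof.
move=> St Hg.
have dg r ws : (size ws < l)%N -> forall x, differentiable (nder (g t r) ws) x.
  by move=> s x; exact: (jet_bound_nder_diff x (Hg r) St s).
split=> vs svs.
  move=> x; rewrite (nder_col dg (ltnW svs)).
  by apply: (differentiable_col _).1 => r; exact: dg.
rewrite (nder_col dg svs) => x; apply: continuous_col => r.
exact: (jet_bound_nder_cont (Hg r) St svs).
Qed.

Lemma jet_bound_Cn_set T (S : set T) t p q l psi (g : T -> 'I_q -> 'cV[R]_p -> R) U :
  S t -> (forall r, jet_bound S l psi (fun t => g t r)) ->
  Cn l U (fun x => \col_r g t r x : 'cV[R]_q).
Proof.
move=> St Hg; have [H1 H2] := jet_bound_Cn St Hg.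
by split=> [x _ vs svs|vs svs x _]; [exact: H1|exact: H2].
Qed.

(** A smooth flat family has zero jet at the origin, whatever the bound psi by
    which its smoothness was established. *)
Lemma jet_bound_flat T (S : set T) p l psi (f : T -> 'cV[R]_p -> R) :
  jet_bound S l psi f -> (forall t, S t -> flat l (f t)) -> jet_bound S l (cst 0) f.
Proof.
move=> Hf fl; apply: nder_jet_bound => [t bs St sb x|t bs St sb|bs sb].
- by apply: (jet_bound_nder_diff x Hf St); rewrite size_map.
- by apply: (jet_bound_nder_cont Hf St); rewrite size_map.
- exists 0 => t St; rewrite (flat_nder (fl t St)) ?normr0 ?mul0r ?size_map//.
    by move=> ws s x; exact: (jet_bound_nder_diff x Hf St).
  by move=> ws s; exact: (jet_bound_nder_cont Hf St).
Qed.

Lemma jet_bound_sub_set T (S S' : set T) p l psi (f : T -> 'cV[R]_p -> R) :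
  S' `<=` S -> jet_bound S l psi f -> jet_bound S' l psi f.
Proof.
move=> SS; elim: l f => [|l IH] f [[C H0] H1]; (split; first by exists C => t /SS; exact: H0).
  by move=> t /SS; exact: H1.
by case: H1 => H1 H2; split=> [t /SS|i]; [exact: H1|exact: IH (H2 i)].
Qed.

End Slope.

(** * Lebesgue measurability and integrability *)

Section Lebesgue.
Context {R : realType}.
Notation LT := (lebesgueType R).
Notation mL := (@completed_lebesgue_measure R).
Implicit Types (f g h : R -> R) (a b c : R).

Lemma Lm_borel (D : set R) : measurable D -> measurable (D : set LT).
Proof. exact: sub_caratheodory. Qed.

Lemma Lm_itv (i : interval R) : measurable ([set` i] : set LT).
Proof. by apply: Lm_borel; exact: measurable_itv. Qed.

Lemma Lmeasurable_borel (D : set R) f :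
  measurable D -> measurable_fun D f -> Lmeasurable D f.
Proof. by move=> mD mf _ B mB; apply: Lm_borel; exact: mf. Qed.

Lemma Lmeasurable_continuous f : continuous f -> Lmeasurable setT f.
Proof.
by move=> cf; apply: Lmeasurable_borel => //; exact: continuous_measurable_fun.
Qed.

Lemma LmeasurableS (D E : set R) f :
  measurable (E : set LT) -> D `<=` E -> Lmeasurable E f -> Lmeasurable D f.
Proof. by move=> mE DE; apply: measurable_funS. Qed.

Lemma leb_itv a b : a <= b -> mL `[a, b]%classic = (b - a)%:E.
Proof.
move=> ab; have := @lebesgue_measure_itv R `[a, b].
rewrite /= lte_fin => E; apply: etrans E _.
case: ltP => //= ba; have -> : a = b by apply/le_anti/andP.
by rewrite subrr.
Qed.

Lemma leb_set1 a : mL [set a] = 0%E.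
Proof. exact: (@lebesgue_measure_set1 R a). Qed.

Lemma Lint_meas (D : set R) f : Lintegrable D f -> Lmeasurable D f.
Proof. by move=> /measurable_int /measurable_EFinP. Qed.

Lemma LintS (D E : set R) f : measurable (D : set LT) -> measurable (E : set LT) ->
  D `<=` E -> Lintegrable E f -> Lintegrable D f.
Proof. by move=> mD mE DE; apply: integrableS. Qed.

Lemma LintD (D : set R) f g : measurable (D : set LT) ->
  Lintegrable D f -> Lintegrable D g -> Lintegrable D (fun t => f t + g t).
Proof. by move=> mD If Ig; exact: (integrableD mD If Ig). Qed.

Lemma LintZ (D : set R) c f : measurable (D : set LT) ->
  Lintegrable D f -> Lintegrable D (fun t => c * f t).
Proof. by move=> mD If; exact: (integrableZl mD c If). Qed.

Lemma Lint_abs (D : set R) f : measurable (D : set LT) ->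
  Lintegrable D f -> Lintegrable D (fun t => `|f t|).
Proof. by move=> mD If; have := integrable_abse If. Qed.

Lemma Lint0 (D : set R) : measurable (D : set LT) -> Lintegrable D (fun=> 0).
Proof. by move=> mD; exact: integrable0. Qed.

Lemma Lint_sum (D : set R) (I : Type) (s : seq I) (P : pred I) (f : I -> R -> R) :
  measurable (D : set LT) -> (forall i, P i -> Lintegrable D (f i)) ->
  Lintegrable D (fun t => \sum_(i <- s | P i) f i t).
Proof.
move=> mD If; elim: s => [|i s IH].
  by under [X in Lintegrable _ X]eq_fun do rewrite big_nil; exact: Lint0.
under [X in Lintegrable _ X]eq_fun do rewrite big_cons.
by case Pi: (P i) => //; apply: LintD => //; exact: If.
Qed.

Lemma Lint_dom (D : set R) f g : measurable (D : set LT) -> Lmeasurable D f ->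
  (forall t, D t -> `|f t| <= g t) -> Lintegrable D g -> Lintegrable D f.
Proof.
move=> mD mf fg Ig; apply: (le_integrable mD _ _ Ig).
  exact/measurable_EFinP.
by move=> t Dt /=; rewrite lee_fin (le_trans (fg t Dt))// ler_norm.
Qed.

Lemma Lint_bdd (D : set R) h f M : measurable (D : set LT) -> Lmeasurable D h ->
  (forall t, D t -> `|h t| <= M) -> Lintegrable D f ->
  Lintegrable D (fun t => h t * f t).
Proof.
move=> mD mh hM If; apply: (@Lint_dom _ _ (fun t => M * `|f t|)) => //.
- by apply: measurable_funM => //; exact: Lint_meas.
- by move=> t Dt; rewrite normrM ler_wpM2r//; exact: hM.
- by apply: LintZ => //; exact: Lint_abs.
Qed.

Lemma Lint_eq (D : set R) f g : measurable (D : set LT) ->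
  (forall t, D t -> f t = g t) -> Lintegrable D f -> Lintegrable D g.
Proof. by move=> mD fg; apply: eq_integrable => // t /set_mem Dt; rewrite fg. Qed.

Lemma LRint_eq (D : set R) f g : (forall t, D t -> f t = g t) ->
  \int[leb]_(t in D) f t = \int[leb]_(t in D) g t.
Proof. by move=> fg; apply: eq_Rintegral => t /set_mem Dt; rewrite fg. Qed.

Lemma LRint_sum (D : set R) (I : Type) (s : seq I) (P : pred I) (f : I -> R -> R) :
  measurable (D : set LT) -> (forall i, P i -> Lintegrable D (f i)) ->
  \int[leb]_(t in D) (\sum_(i <- s | P i) f i t) =
  \sum_(i <- s | P i) \int[leb]_(t in D) f i t.
Proof.
move=> mD If; elim: s => [|i s IH].
  under eq_Rintegral do rewrite big_nil.
  by rewrite big_nil /Rintegral integral0.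
under eq_Rintegral do rewrite big_cons.
rewrite big_cons; case Pi: (P i) => //.
by rewrite RintegralD ?IH//; [exact: If|exact: Lint_sum].
Qed.

Lemma Rint_split_itv (x y : itv_bound R) b f :
  (x <= BLeft b)%O -> (BRight b <= y)%O -> Lintegrable [set` Interval x y] f ->
  \int[leb]_(t in [set` Interval x y]) f t =
  \int[leb]_(t in [set` Interval x (BRight b)]) f t +
  \int[leb]_(t in [set` Interval (BLeft b) y]) f t.
Proof.
move=> xb by_ If.
have bb : (BLeft b <= BRight b :> itv_bound R)%O by rewrite bnd_simp.
have E : [set` Interval x y] = [set` Interval x (BRight b)] `|` [set` Interval (BRight b) y].
  by rewrite -itv_bndbnd_setU// (le_trans xb).
have E2 : [set` Interval (BRight b) y] = [set` Interval (BLeft b) y] `\` [set b].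
  by rewrite setDitv1l.
have Ib : Lintegrable [set` Interval (BLeft b) y] f.
  apply: LintS If; [exact: Lm_itv|exact: Lm_itv|].
  by apply: subset_itv; rewrite // lexx.
rewrite [in LHS]E Rintegral_setU; [|exact: Lm_itv|exact: Lm_itv|by rewrite -E|].
  congr (_ + _); rewrite E2 /Rintegral; congr fine; apply/esym.
  by apply: negligible_integral => //; [exact: Lm_borel|exact: Lm_itv|exact: leb_set1].
apply/disj_setPS => t [] /=; rewrite !itv_boundlr => /andP[_ t1] /andP[t2 _].
by move: t1 t2; rewrite !bnd_simp => t1 t2; move: (lt_le_trans t2 t1); rewrite ltxx.
Qed.

Lemma Rint_split a b c f : a <= b -> b <= c -> Lintegrable `[a, c] f ->
  \int[leb]_(t in `[a, c]) f t =
  \int[leb]_(t in `[a, b]) f t + \int[leb]_(t in `[b, c]) f t.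
Proof. by move=> ab bc If; apply: Rint_split_itv => //; rewrite bnd_simp. Qed.

End Lebesgue.

(** * Cousin covers *)

Section AC.
Context {R : realType}.
Notation LT := (lebesgueType R).
Notation mL := (@completed_lebesgue_measure R).
Implicit Types (f g h u : R -> R) (a b c : R).

(** An additive interval property that holds on all small intervals around
    each point holds on the whole interval.  It replaces almost everywhere
    differentiation in the proofs below. *)
Lemma cousin a b (P : R -> R -> Prop) : a <= b ->
  (forall x y z, a <= x -> x <= y -> y <= z -> z <= b -> P x y -> P y z -> P x z) ->
  (forall r, a <= r -> r <= b -> exists2 dl : R, 0 < dl &
     forall x y, a <= x -> x <= r -> r <= y -> y <= b -> y - x < dl -> P x y) ->
  P a b.
Proof.
move=> ab add loc.
pose S := [set y | [/\ a <= y, y <= b & P a y]].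
have Sa : S a.
  have [dl dl0 H] := loc a (lexx a) ab.
  by split => //; apply: H => //; rewrite subrr.
have hS : has_sup S by split; [exists a|exists b => y []].
have as_ : a <= sup S by apply: sup_upper_bound.
have sb : sup S <= b by apply: ge_sup; [exists a|move=> y []].
have [dl dl0 H] := loc _ as_ sb.
have Ps : P a (sup S).
  have [y [ay yb Py] sy] := sup_adherent dl0 hS.
  have ys : y <= sup S by apply: sup_upper_bound.
  apply: (add a y) => //; apply: H => //.
  by rewrite ltrBlDr -ltrBlDl.
have [sb'|sb'] : sup S = b \/ sup S < b.
  by move: sb; rewrite le_eqVlt => /orP[/eqP|]; [left|right].
  by rewrite -sb'.
exfalso; pose z := Num.min b (sup S + dl / 2).
have sz : sup S < z by rewrite lt_min sb' ltrDl divr_gt0.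
have : S z.
  split; [exact: le_trans (ltW sz)|by rewrite ge_min lexx|].
  apply: (add a (sup S)) => //; [exact: ltW|by rewrite ge_min lexx|].
  apply: H => //; [exact: ltW|by rewrite ge_min lexx|].
  rewrite ltrBlDl (@le_lt_trans _ _ (sup S + dl / 2))//.
    by rewrite ge_min lexx orbT.
  by rewrite ltrD2l ltr_pdivrMr// ltr_pMr// ltr1n.
by move/(sup_upper_bound hS); rewrite leNgt sz.
Qed.

Lemma Rint_le a b f g : Lintegrable `[a, b] f -> Lintegrable `[a, b] g ->
  (forall t, a <= t -> t <= b -> f t <= g t) ->
  \int[leb]_(t in `[a, b]) f t <= \int[leb]_(t in `[a, b]) g t.
Proof.
move=> If Ig fg; apply: le_Rintegral => //; first exact: Lm_itv.
by move=> t /=; rewrite in_itv /= => /andP[]; exact: fg.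
Qed.

Lemma Rint_abs a b f : Lintegrable `[a, b] f ->
  `|\int[leb]_(t in `[a, b]) f t| <= \int[leb]_(t in `[a, b]) `|f t|.
Proof. by move=> If; apply: le_normr_Rintegral => //; exact: Lm_itv. Qed.

Lemma Rint_cst a b c : a <= b -> \int[leb]_(t in `[a, b]) c = c * (b - a).
Proof.
move=> ab; rewrite (@Rintegral_cst _ LT R mL _ (Lm_itv `[a, b])).
exact: (congr1 (fun z => c * fine z) (leb_itv ab)).
Qed.

Lemma Lint_cst a b c : Lintegrable `[a, b] (fun=> c).
Proof.
case: (leP a b) => [ab|ba]; last by rewrite /Lintegrable set_itv_ge ?bnd_simp -?ltNge//; exact: integrable_set0.
apply/integrableP; split; first exact/measurable_EFinP.
rewrite (@integral_cst _ LT R mL _ (Lm_itv `[a, b])).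
set X := (X in (_ * X < _)%E); have -> : X = (b - a)%:E by exact: leb_itv.
exact: ltry.
Qed.

(** Absolute continuity of the integral near one point, which is all that a
    Cousin cover asks for. *)
Lemma Rint_small a b f r (e : R) : Lintegrable `[a, b] f -> 0 < e ->
  exists2 dl : R, 0 < dl &
    forall x y, a <= x -> x <= r -> r <= y -> y <= b -> y - x < dl ->
      \int[leb]_(t in `[x, y]) `|f t| <= e.
Proof.
move=> If e0.
pose B n : set R := `[r - n.+1%:R^-1, r + n.+1%:R^-1]%classic.
pose F n t := (`|f t| * \1_(B n) t)%:E.
have mD : measurable (`[a, b]%classic : set LT) by exact: Lm_itv.
have mB n : measurable (B n : set LT) by exact: Lm_itv.
have mf : Lmeasurable `[a, b] (fun t => `|f t|) by apply: Lint_meas; exact: Lint_abs.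
have mF n : measurable_fun (`[a, b]%classic : set LT) (F n).
  by apply/measurable_EFinP; apply: measurable_funM => //; exact: measurable_indic.
have [] := @dominated_convergence _ LT R mL _ mD F (cst 0%E) (fun t => `|f t|%:E) mF.
- exact: measurable_cst.
- exists [set r]; split; [exact: Lm_borel|exact: leb_set1|].
  move=> t /= /not_implyP[_ nc]; apply: contrapT => tr; apply: nc.
  apply: cvg_near_cst.
  have d0 : 0 < `|t - r| by rewrite normr_gt0 subr_eq0; apply/eqP.
  near=> n; rewrite /F indicE memNset ?mulr0//.
  rewrite /B /= in_itv /= => /andP[t1 t2].
  suff : `|t - r| < `|t - r| by rewrite ltxx.
  rewrite (@le_lt_trans _ _ n.+1%:R^-1)//.
    by rewrite ler_distl t1 t2.
  by near: n; exact: near_infty_natSinv_lt (PosNum d0).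
- exact: Lint_abs.
- apply: aeW => t n _; rewrite /F /= lee_fin normrM normr_id ler_piMr//.
  by rewrite indicE; case: (_ \in _); rewrite ?normr1 ?normr0.
move=> _ _; rewrite integral0 => cF.
have : \forall n \near \oo, (\int[mL]_(t in `[a, b]) F n t < e%:E)%E.
  have U : nbhs (0%E : \bar R) [set y | (y < e%:E)%E].
    apply: open_nbhs_nbhs; split; first exact: open_ereal_lt_ereal.
    by rewrite /= lte_fin.
  exact: cF _ U.
case=> N _ /(_ N (leqnn N)) /= HN.
exists N.+1%:R^-1; first by rewrite invr_gt0.
move=> x y ax xr ry yb yx.
have Ixy : Lintegrable `[x, y] f.
  apply: LintS If; [exact: Lm_itv|exact: Lm_itv|].
  by apply: subset_itv; rewrite bnd_simp.
rewrite -lee_fin; apply: le_trans (ltW HN).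
rewrite /Rintegral fineK; last first.
  apply: integrable_fin_num; first exact: Lm_itv.
  by apply: (@Lint_abs _ `[x, y]) => //; exact: Lm_itv.
apply: (@le_trans _ _ (\int[mL]_(t in `[x, y]) F N t)%E).
  rewrite le_eqVlt; apply/orP; left; apply/eqP; apply: eq_integral => t /set_mem /=.
  rewrite in_itv /= => /andP[xt ty]; rewrite /F indicE mem_set ?mulr1//.
  rewrite /B /= in_itv /=; move: (N.+1%:R^-1) yx => w yx.
  by apply/andP; split; lra.
apply: ge0_subset_integral => //; [exact: Lm_itv| |].
- by move=> t _; rewrite /F lee_fin mulr_ge0.
- by apply: subset_itv; rewrite bnd_simp.
Unshelve. all: by end_near. Qed.

End AC.

(** * Absolutely continuous functions and the chain rule *)

Section AC2.
Context {R : realType}.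
Notation LT := (lebesgueType R).
Notation mL := (@completed_lebesgue_measure R).
Implicit Types (f u : R -> R) (a b c : R).

Definition sq a b : set (R * R) := [set p | (a <= p.1 <= b) && (a <= p.2 <= b)].

(** Continuity at the diagonal points only: slopes of the transformation
    along a solution are not continuous as functions of two independent times. *)
Definition diag_cont a b (g : R -> R -> R) : Prop :=
  forall r, a <= r <= b ->
    g p.1 p.2 @[p --> within (sq a b) (nbhs (r, r))] --> g r r.

Lemma diag_contP a b g : diag_cont a b g <-> forall r, a <= r <= b -> forall e, 0 < e ->
  exists2 dl : R, 0 < dl & forall x y, a <= x <= b -> a <= y <= b ->
    `|x - r| < dl -> `|y - r| < dl -> `|g x y - g r r| <= e.
Proof.
split=> H r ab.
  move=> e e0; have /cvgrPdist_le/(_ e e0) := H r ab.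
  rewrite near_withinE => /nbhs_ballP[dl /= dl0 K].
  exists dl => // x y xab yab xr yr; rewrite distrC.
  apply: (K (x, y)); last by rewrite /sq /= xab yab.
  by split; rewrite /ball /= distrC.
apply/cvgrPdist_le => e e0; have [dl dl0 K] := H r ab e e0.
rewrite near_withinE; apply/nbhs_ballP; exists dl => //= -[x y] [/= xr yr] /andP[/= xab yab].
by rewrite distrC; apply: K => //; rewrite distrC.
Qed.

Lemma diag_cont_cst a b c : diag_cont a b (fun _ _ => c).
Proof. by move=> r _; exact: cvg_cst. Qed.

Lemma diag_contD a b (g h : R -> R -> R) : diag_cont a b g -> diag_cont a b h -> diag_cont a b (fun x y => g x y + h x y).
Proof. by move=> Hg Hh r ab; apply: cvgD; [exact: Hg|exact: Hh]. Qed.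

Lemma diag_contM a b (g h : R -> R -> R) : diag_cont a b g -> diag_cont a b h -> diag_cont a b (fun x y => g x y * h x y).
Proof. by move=> Hg Hh r ab; apply: cvgM; [exact: Hg|exact: Hh]. Qed.

Lemma diag_contV a b g : (forall r, a <= r <= b -> g r r != 0) -> diag_cont a b g ->
  diag_cont a b (fun x y => (g x y)^-1).
Proof. by move=> g0 Hg r ab; apply: cvgV; [exact: g0|exact: Hg]. Qed.

Lemma diag_contN a b g : diag_cont a b g -> diag_cont a b (fun x y => - g x y).
Proof. by move=> Hg r ab; apply: cvgN; exact: Hg. Qed.

Lemma diag_cont_sum a b (I : Type) (s : seq I) (P : pred I) (g : I -> R -> R -> R) :
  (forall i, P i -> diag_cont a b (g i)) ->
  diag_cont a b (fun x y => \sum_(i <- s | P i) g i x y).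
Proof.
move=> H; elim: s => [|i s IH].
  rewrite (_ : (fun x y => _) = (fun _ _ => 0)); first exact: diag_cont_cst.
  by apply/funext => x; apply/funext => y; rewrite big_nil.
rewrite (_ : (fun x y => _) = (fun x y => if P i then g i x y + \sum_(j <- s | P j) g j x y else \sum_(j <- s | P j) g j x y)); last first.
  by apply/funext => x; apply/funext => y; rewrite big_cons.
by case Pi: (P i) => //; apply: diag_contD => //; exact: H.
Qed.

Lemma diag_cont_prod a b (I : Type) (s : seq I) (P : pred I) (g : I -> R -> R -> R) :
  (forall i, P i -> diag_cont a b (g i)) ->
  diag_cont a b (fun x y => \prod_(i <- s | P i) g i x y).
Proof.
move=> H; elim: s => [|i s IH].
  rewrite (_ : (fun x y => _) = (fun _ _ => 1)); first exact: diag_cont_cst.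
  by apply/funext => x; apply/funext => y; rewrite big_nil.
rewrite (_ : (fun x y => _) = (fun x y => if P i then g i x y * \prod_(j <- s | P j) g j x y else \prod_(j <- s | P j) g j x y)); last first.
  by apply/funext => x; apply/funext => y; rewrite big_cons.
by case Pi: (P i) => //; apply: diag_contM => //; exact: H.
Qed.

Lemma diag_cont_swap a b g : diag_cont a b g -> diag_cont a b (fun x y => g y x).
Proof.
move=> /diag_contP H; apply/diag_contP => r ab e e0; have [dl dl0 K] := H r ab e e0.
by exists dl => // x y xab yab xr yr; apply: K.
Qed.

Definition cont_on a b h := diag_cont a b (fun x _ => h x).

Lemma cont_on_diag a b g : diag_cont a b g -> cont_on a b (fun r => g r r).
Proof.
move=> /diag_contP H; apply/diag_contP => r ab e e0; have [dl dl0 K] := H r ab e e0.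
by exists dl => // x y xab _ xr _; apply: K.
Qed.

Lemma clamp_lip (a b x y : R) : a <= b ->
  `|Num.max a (Num.min b y) - Num.max a (Num.min b x)| <= `|y - x|.
Proof.
move=> ab; wlog xy : x y / x <= y.
  by move=> H; case: (leP x y) => [/H //|/ltW/H]; rewrite distrC (distrC x).
have m : Num.max a (Num.min b x) <= Num.max a (Num.min b y).
  by rewrite ge_max le_max lexx /= le_max !le_min !ge_min xy lexx !orbT.
rewrite !ger0_norm ?subr_ge0//.
by rewrite !minEle !maxEle; do ?case: (leP b _) => ?; do ?case: (leP a _) => ?; lra.
Qed.

Lemma cont_on_meas a b h : cont_on a b h -> Lmeasurable `[a, b] h.
Proof.
case: (leP a b) => [ab|ba] /diag_contP H; last first.
  rewrite /Lmeasurable set_itv_ge ?bnd_simp -?ltNge//; exact: measurable_fun_set0.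
pose k (x : R) := h (Num.max a (Num.min b x)).
have ck : continuous k.
  move=> x; apply/cvgrPdist_le => e e0.
  have cl (y : R) : a <= Num.max a (Num.min b y) <= b.
    by rewrite le_max lexx /= ge_max ab ge_min lexx.
  have [dl dl0 K] := H _ (cl x) e e0.
  apply/nbhs_ballP; exists dl => // y; rewrite /ball /= => xy.
  rewrite distrC; apply: (K _ (Num.max a (Num.min b x))) => //; last by rewrite subrr normr0.
  by apply: le_lt_trans xy; rewrite (distrC x); exact: clamp_lip.
have mk : Lmeasurable `[a, b] k.
  apply: (@LmeasurableS _ _ setT) => //; exact: Lmeasurable_continuous.
apply: eq_measurable_fun mk => t /set_mem /=; rewrite in_itv /= => /andP[ta tb].
by rewrite /k (min_idPr tb) (max_idPr ta).
Qed.

Lemma cont_on_bdd a b h : a <= b -> cont_on a b h ->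
  exists M, forall t, a <= t -> t <= b -> `|h t| <= M.
Proof.
move=> ab /diag_contP H.
pose P x y := exists M, forall t, x <= t -> t <= y -> `|h t| <= M.
apply: (@cousin R a b P) => // [x y z ax xy yz zb [M HM] [N HN]|r ar rb].
  exists (Num.max M N) => t xt tz; rewrite le_max.
  case: (leP t y) => ty; first by rewrite HM.
  by rewrite HN ?orbT// ltW.
have [|dl dl0 K] := H r _ 1 ltr01; first by rewrite ar rb.
exists dl => // x y ax xr ry yb yx; exists (`|h r| + 1) => t xt ty.
rewrite -lerBlDl (le_trans (lerB_dist _ _))//; apply: (K t r).
- by rewrite (le_trans ax xt) (le_trans ty yb).
- by rewrite ar rb.
- by rewrite (le_lt_trans _ yx)// ler_norml; lra.
- by rewrite subrr normr0.
Qed.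

(** u is absolutely continuous on [a, b] with density f. *)
Definition abs_cont a b u f : Prop :=
  Lintegrable `[a, b] f /\
  forall x y, a <= x -> x <= y -> y <= b -> u y - u x = \int[leb]_(t in `[x, y]) f t.

Lemma Lint_sub a b x y f : a <= x -> y <= b -> Lintegrable `[a, b] f -> Lintegrable `[x, y] f.
Proof.
move=> ax yb; apply: LintS; [exact: Lm_itv|exact: Lm_itv|].
by apply: subset_itv; rewrite bnd_simp.
Qed.

Lemma abs_cont_sub a b x y u f : a <= x -> y <= b -> abs_cont a b u f -> abs_cont x y u f.
Proof.
move=> ax yb [If H]; split; first exact: Lint_sub If.
move=> s t xs st ty; apply: H => //; [exact: le_trans xs|exact: le_trans yb].
Qed.

Lemma abs_cont_eq a b u v f g : (forall t, a <= t <= b -> u t = v t) ->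
  (forall t, a <= t <= b -> f t = g t) -> abs_cont a b u f -> abs_cont a b v g.
Proof.
move=> uv fg [If H]; split.
  by apply: Lint_eq If; [exact: Lm_itv|move=> t /=; rewrite in_itv /=; exact: fg].
move=> x y ax xy yb; rewrite -!uv ?ax ?yb ?(le_trans xy)// ?(le_trans ax)// H//.
apply: LRint_eq => t /=; rewrite in_itv /= => /andP[xt ty]; apply: fg.
by rewrite (le_trans ax) // (le_trans ty).
Qed.

Lemma abs_cont_con a b u f : abs_cont a b u f -> cont_on a b u.
Proof.
case=> If H; apply/diag_contP => r /andP[ar rb] e e0.
have [dl dl0 K] := Rint_small r If e0.
exists dl => // x _ /andP[ax xb] _ xr _.
case: (leP x r) => [xr'|rx].
  rewrite distrC H// (le_trans (Rint_abs _))//; first exact: Lint_sub If.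
  by apply: K => //; move: xr; rewrite distrC ger0_norm// subr_ge0.
rewrite H ?(ltW rx)// (le_trans (Rint_abs _))//; first exact: Lint_sub If.
by apply: K => //; [exact: ltW|move: xr; rewrite ger0_norm// subr_ge0 ltW].
Qed.

Lemma Lint_con a b h f : a <= b -> cont_on a b h -> Lintegrable `[a, b] f ->
  Lintegrable `[a, b] (fun t => h t * f t).
Proof.
move=> ab ch If; have [M HM] := cont_on_bdd ab ch.
apply: (@Lint_bdd _ _ _ _ M) If; [exact: Lm_itv|exact: cont_on_meas|].
by move=> t /=; rewrite in_itv /= => /andP[]; exact: HM.
Qed.

Lemma dist_itv (s t q r : R) : s <= q -> q <= t -> s <= r -> r <= t ->
  `|q - r| <= t - s.
Proof. by move=> *; rewrite ler_norml; lra. Qed.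

(** On a short interval around r the slopes differ little from their value at
    (r, r), so that the increment of z is close to the integral of
    sum_i g_i(r, r) f_i; these local errors add up over a Cousin cover. *)
Lemma abs_cont_chain a b (I : finType) (u f : I -> R -> R) (g : I -> R -> R -> R) z :
  a <= b -> (forall i, abs_cont a b (u i) (f i)) -> (forall i, diag_cont a b (g i)) ->
  (forall x y, a <= x -> x <= y -> y <= b ->
     z y - z x = \sum_i g i x y * (u i y - u i x)) ->
  abs_cont a b z (fun r => \sum_i g i r r * f i r).
Proof.
move=> ab Hu Hg zE.
have Iu i := (Hu i).1.
have Igf i : Lintegrable `[a, b] (fun r => g i r r * f i r).
  by apply: Lint_con => //; exact: cont_on_diag.
have Iphi : Lintegrable `[a, b] (fun r => \sum_i g i r r * f i r).
  by apply: Lint_sum => //; exact: Lm_itv.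
pose m t := \sum_i `|f i t|.
have Im : Lintegrable `[a, b] m.
  by apply: Lint_sum => [|i _]; [exact: Lm_itv|apply: Lint_abs => //; exact: Lm_itv].
split => // x y ax xy yb.
pose E s t := z t - z s - \int[leb]_(r in `[s, t]) (\sum_i g i r r * f i r).
apply/eqP; rewrite -subr_eq0 -/(E x y) -normr_le0.
pose M := \int[leb]_(r in `[x, y]) m r.
have M0 : 0 <= M by apply: Rintegral_ge0 => t _; exact: sumr_ge0.
(* an additive error bound, with a factor e as small as desired *)
suff K e : 0 < e -> `|E x y| <= e * M.
  apply/ler_addgt0Pr => e e0; rewrite add0r.
  have e1 : 0 < e / (M + 1) by rewrite divr_gt0// ltr_wpDl.
  apply: le_trans (K _ e1) _.
  by rewrite mulrAC ler_pdivrMr ?ltr_wpDl// ler_wpM2l ?(ltW e0)// lerDl.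
move=> e0; apply: (@cousin R x y (fun s t => `|E s t| <= e * \int[leb]_(r in `[s, t]) m r)) => //.
  move=> s r t xs sr rt ty Esr Ert.
  have Imst : Lintegrable `[s, t] m by apply: Lint_sub Im; [exact: le_trans xs|exact: le_trans yb].
  have Ipst : Lintegrable `[s, t] (fun r => \sum_i g i r r * f i r).
    by apply: Lint_sub Iphi; [exact: le_trans xs|exact: le_trans yb].
  rewrite (Rint_split sr rt Imst) mulrDr.
  have -> : E s t = E s r + E r t.
    by rewrite /E (Rint_split sr rt Ipst); ring.
  by rewrite (le_trans (ler_normD _ _))// lerD.
move=> r xr ry.
have rab : a <= r <= b by rewrite (le_trans ax) // (le_trans ry).
have : \forall dl \near 0^'+, forall i, forall x y, a <= x <= b -> a <= y <= b ->
    `|x - r| < dl -> `|y - r| < dl -> `|g i x y - g i r r| <= e / 2.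
  apply: filter_forall => i.
  have e2 : 0 < e / 2 by rewrite divr_gt0.
  have [dl dl0 K] := (diag_contP _ _ _).1 (Hg i) r rab _ e2.
  near=> dl1.
  have dl1l : dl1 < dl by near: dl1; exact: nbhs_right_lt.
  by move=> x' y' ? ? x1 y1; apply: K => //; exact: lt_trans dl1l.
move=> near1.
have [dl [dl0 K]] : exists dl : R, 0 < dl /\ forall i, forall x y, a <= x <= b -> a <= y <= b ->
    `|x - r| < dl -> `|y - r| < dl -> `|g i x y - g i r r| <= e / 2.
  near (0:R)^'+ => dl; exists dl; split; first by near: dl; exact: nbhs_right_gt.
  by near: dl.
exists dl => // s t xs sr rt ty ts.
have as_ : a <= s by exact: le_trans xs.
have tb : t <= b by exact: le_trans yb.
have st : s <= t by exact: le_trans rt.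
have If' i : Lintegrable `[s, t] (f i) by exact: Lint_sub (Iu i).
have Igf' i : Lintegrable `[s, t] (fun r => g i r r * f i r) by exact: Lint_sub (Igf i).
have -> : E s t = \int[leb]_(q in `[s, t]) (\sum_i (g i s t - g i q q) * f i q).
  rewrite /E zE//.
  have -> : \sum_i g i s t * (u i t - u i s) = \int[leb]_(q in `[s, t]) (\sum_i g i s t * f i q).
    rewrite LRint_sum; [|exact: Lm_itv|by move=> i _; apply: LintZ => //; exact: Lm_itv].
    apply: eq_bigr => i _; rewrite (Hu i).2//; apply/esym.
    exact: (RintegralZl (g i s t) (Lm_itv `[s, t]) (If' i)).
  rewrite -RintegralB; [|exact: Lm_itv| |exact: Lint_sub Iphi].
    by apply: LRint_eq => q _; rewrite -sumrB; apply: eq_bigr => i _; rewrite mulrBl.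
  by apply: Lint_sum => [|i _]; [exact: Lm_itv|apply: LintZ => //; exact: Lm_itv].
have I3 : Lintegrable `[s, t] (fun q => \sum_i (g i s t - g i q q) * f i q).
  apply: Lint_sum => [|i _]; first exact: Lm_itv.
  apply: (@Lint_eq _ _ (fun q => g i s t * f i q + (-1) * (g i q q * f i q))).
  - exact: Lm_itv.
  - by move=> q _; ring.
  - by apply: LintD; [exact: Lm_itv|apply: LintZ => //; exact: Lm_itv|apply: LintZ => //; exact: Lm_itv].
rewrite (le_trans (Rint_abs I3))// -RintegralZl; [|exact: Lm_itv|exact: Lint_sub Im].
apply: Rint_le; [exact: Lint_abs (Lm_itv _) I3|apply: LintZ; [exact: Lm_itv|exact: Lint_sub Im]|].
move=> q sq qt; rewrite (le_trans (ler_norm_sum _ _ _))// mulr_sumr ler_sum// => i _.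
rewrite normrM ler_wpM2r//.
have qab : a <= q <= b by rewrite (le_trans as_ sq) (le_trans qt tb).
have K1 : `|g i s t - g i r r| <= e / 2.
  apply: K; rewrite ?as_ ?tb ?(le_trans st)// ?(le_trans as_)//.
    by rewrite (le_lt_trans _ ts)// dist_itv.
  by rewrite (le_lt_trans _ ts)// dist_itv.
have K2 : `|g i q q - g i r r| <= e / 2.
  by apply: K => //; rewrite (le_lt_trans _ ts)// dist_itv.
by rewrite (le_trans (ler_distD (g i r r) _ _))// (splitr e) lerD// distrC.
Unshelve. all: by end_near. Qed.

End AC2.

(** * Matrix inverses, products, and uniqueness for linear equations *)

Section MatrixClass.
Context {R : realType} {X : Type} (Pc : (X -> R) -> Prop).
Hypothesis Pcst : forall c, Pc (fun=> c).
Hypothesis Padd : forall f g, Pc f -> Pc g -> Pc (fun x => f x + g x).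
Hypothesis Pmul : forall f g, Pc f -> Pc g -> Pc (fun x => f x * g x).

Lemma class_sum (I : Type) (s : seq I) (P : pred I) (f : I -> X -> R) :
  (forall i, P i -> Pc (f i)) -> Pc (fun x => \sum_(i <- s | P i) f i x).
Proof.
move=> H; elim: s => [|i s IH].
  by under eq_fun do rewrite big_nil; exact: Pcst.
under eq_fun do rewrite big_cons.
by case Pi: (P i) => //; apply: Padd => //; exact: H.
Qed.

Lemma class_prod (I : Type) (s : seq I) (P : pred I) (f : I -> X -> R) :
  (forall i, P i -> Pc (f i)) -> Pc (fun x => \prod_(i <- s | P i) f i x).
Proof.
move=> H; elim: s => [|i s IH].
  by under eq_fun do rewrite big_nil; exact: Pcst.
under eq_fun do rewrite big_cons.
by case Pi: (P i) => //; apply: Pmul => //; exact: H.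
Qed.

Lemma class_det n (M : X -> 'M[R]_n) :
  (forall i j, Pc (fun x => M x i j)) -> Pc (fun x => \det (M x)).
Proof.
move=> H; apply: class_sum => s _; apply: Pmul => //.
exact: class_prod.
Qed.

(** Cramer's rule: a class of functions closed under sums, products and the
    inverse of the determinant is closed under matrix inversion.  It is applied to
    jets, to diagonal continuity and to measurability. *)
Lemma class_invmx n (M : X -> 'M[R]_n) :
  (forall x, M x \in unitmx) ->
  (forall i j, Pc (fun x => M x i j)) -> Pc (fun x => (\det (M x))^-1) ->
  forall i j, Pc (fun x => invmx (M x) i j).
Proof.
move=> uM H Hd i j.
have E x : invmx (M x) i j = (\det (M x))^-1 *
    ((-1) ^+ (j + i) * \det (row' j (col' i (M x)))).
  by rewrite /invmx uM !mxE.
under eq_fun do rewrite E.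
apply: Pmul => //; apply: Pmul => //; apply: class_det => i' j'.
by under eq_fun do rewrite !mxE; exact: H.
Qed.

End MatrixClass.

Section ODE.
Context {R : realType}.
Implicit Types (a b c : R).

Lemma diag_cont_invmx a b n (M : R -> R -> 'M[R]_n) :
  (forall x y, M x y \in unitmx) ->
  (forall i j, diag_cont a b (fun x y => M x y i j)) ->
  forall i j, diag_cont a b (fun x y => invmx (M x y) i j).
Proof.
move=> uM HM i j.
apply: (@class_invmx R (R * R)%type (fun f => diag_cont a b (fun x y => f (x, y)))
  _ _ _ n (fun p => M p.1 p.2)) => //.
- by move=> c; exact: diag_cont_cst.
- by move=> f g; exact: diag_contD.
- by move=> f g; exact: diag_contM.
apply: diag_contV => [r _|].
  by have := uM r r; rewrite unitmxE unitfE.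
apply: (@class_det R (R * R)%type (fun f => diag_cont a b (fun x y => f (x, y)))
  _ _ _ n (fun p => M p.1 p.2)) => //.
- by move=> c; exact: diag_cont_cst.
- by move=> f g; exact: diag_contD.
- by move=> f g; exact: diag_contM.
Qed.

Lemma Rint_mono u v y z (f : R -> R) : u <= y -> y <= z -> z <= v ->
  Lintegrable `[u, v] f -> (forall t, 0 <= f t) ->
  \int[leb]_(t in `[y, z]) f t <= \int[leb]_(t in `[u, v]) f t.
Proof.
move=> uy yz zv If f0.
have uz := le_trans uy yz.
rewrite (Rint_split uz zv If) (Rint_split uy yz (Lint_sub (lexx _) zv If)).
by rewrite addrAC lerDr addr_ge0// Rintegral_ge0.
Qed.

Lemma abs_cont_cst a b c : abs_cont a b (fun=> c) (fun=> 0).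
Proof.
split; first exact: Lint_cst.
by move=> x y _ _ _; rewrite subrr /Rintegral integral0.
Qed.

Lemma abs_cont_sum a b (I : finType) (u f : I -> R -> R) (k : I -> R) : a <= b ->
  (forall i, abs_cont a b (u i) (f i)) ->
  abs_cont a b (fun t => \sum_i k i * u i t) (fun t => \sum_i k i * f i t).
Proof.
move=> ab Hu; apply: (@abs_cont_chain R a b I u f (fun i _ _ => k i)) => //.
  by move=> i; exact: diag_cont_cst.
move=> x y ax xy yb; rewrite -sumrB; apply: eq_bigr => i _; by rewrite mulrBr.
Qed.

Lemma abs_contM a b (u v f g : R -> R) : a <= b ->
  abs_cont a b u f -> abs_cont a b v g -> abs_cont a b (fun t => u t * v t) (fun t => f t * v t + u t * g t).
Proof.
move=> ab Hu Hv.
pose w (i : bool) := if i then u else v.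
pose h (i : bool) := if i then f else g.
pose k (i : bool) (x y : R) := if i then v y else u x.
have H1 i : abs_cont a b (w i) (h i) by case: i.
have H2 i : diag_cont a b (k i).
  by case: i; [apply: diag_cont_swap; exact: (abs_cont_con Hv)|exact: (abs_cont_con Hu)].
have H3 x y : a <= x -> x <= y -> y <= b ->
    u y * v y - u x * v x = \sum_i k i x y * (w i y - w i x).
  by move=> _ _ _; rewrite big_bool /=; ring.
apply: abs_cont_eq (abs_cont_chain ab H1 H2 H3) => t _ //.
by rewrite big_bool /=; ring.
Qed.

Lemma abs_cont_prod a b (n : nat) (u f : 'I_n -> R -> R) : a <= b ->
  (forall q, abs_cont a b (u q) (f q)) ->
  abs_cont a b (fun t => \prod_q u q t)
    (fun t => \sum_q f q t * \prod_(q' | q' != q) u q' t).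
Proof.
elim: n u f => [|n IH] u f ab Hu.
  apply: abs_cont_eq (abs_cont_cst a b 1) => t _; by rewrite big_ord0.
have := abs_contM ab (Hu ord0) (IH (fun q => u (lift ord0 q)) (fun q => f (lift ord0 q)) ab (fun q => Hu _)).
apply: abs_cont_eq => t _; first by rewrite big_ord_recl.
rewrite big_ord_recl; congr (_ + _).
  congr (_ * _); rewrite [RHS]big_mkcond big_ord_recl /= mul1r.
  by apply: eq_bigr.
rewrite mulr_sumr; apply: eq_bigr => q _; rewrite mulrCA; congr (_ * _).
rewrite [RHS]big_mkcond big_ord_recl /=; congr (_ * _).
rewrite [LHS]big_mkcond; apply: eq_bigr => q' _.
by rewrite (inj_eq lift_inj).
Qed.

(** On an interval where the integral of |A| is less than 1/2 the sup norm of
    a solution vanishing somewhere is at most half of itself; a Cousin cover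
    propagates this to the whole interval. *)
Lemma linear_unique a b p (A : R -> 'M[R]_p) (x : R -> 'cV[R]_p) s :
  (forall i j, Lintegrable `[a, b] (fun t => A t i j)) ->
  (forall c : 'I_p, abs_cont a b (fun t => x t c 0) (fun t => (A t *m x t) c 0)) ->
  a <= s <= b -> x s = 0 -> forall t, a <= t <= b -> x t = 0.
Proof.
move=> IA Hx sab xs t tab.
have ab : a <= b by case/andP: sab => /le_trans; apply.
pose P (al be : R) := forall s, al <= s <= be -> x s = 0 ->
   forall t, al <= t <= be -> x t = 0.
suff : P a b by move=> /(_ s sab xs t tab).
clear s sab xs t tab.
pose m t := \sum_i \sum_j `|A t i j|.
have m0 t : 0 <= m t by apply: sumr_ge0 => i _; apply: sumr_ge0.
have Im : Lintegrable `[a, b] m.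
  apply: Lint_sum => [|i _]; first exact: Lm_itv.
  by apply: Lint_sum => [|j _]; [exact: Lm_itv|apply: Lint_abs => //; exact: Lm_itv].
apply: cousin => // [u v w au uv vw wb Puv Pvw s|r ar rb].
  case/andP=> us sw xs.
  (* a zero in one half reaches the other half through the common endpoint *)
  have xv : x v = 0.
    case: (leP s v) => sv; first by apply: (Puv s) => //; rewrite ?us ?uv ?lexx.
    by apply: (Pvw s) => //; rewrite ?lexx ?vw ?(ltW sv).
  move=> t /andP[ut tw]; case: (leP t v) => tv.
    by apply: (Puv v) => //; rewrite ?ut ?uv ?lexx.
  by apply: (Pvw v) => //; rewrite ?lexx ?vw ?tw ?(ltW tv).
have [dl dl0 K] := @Rint_small R a b m r (1/2) Im ltac:(by rewrite divr_gt0).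
exists dl => // u v au ur rv vb vu s /andP[us sv] xs.
have {K} K := K u v au ur rv vb vu.
have uv : u <= v by exact: le_trans rv.
have Hc (c : 'I_p) := abs_cont_sub au vb (Hx c).
have Imu := Lint_sub au vb Im.
have bd : has_sup [set `|x t| | t in `[u, v]%classic].
  split; first by exists `|x u|, u => //; rewrite /= in_itv /= lexx uv.
  have /choice[M HM] : forall c : 'I_p, exists M, forall t, u <= t -> t <= v -> `|x t c 0| <= M.
    by move=> c; exact: cont_on_bdd uv (abs_cont_con (Hc c)).
  exists (\sum_(c < p) `|M c|) => y [t /=]; rewrite in_itv /= => /andP[ut tv] <-.
  have sM : 0 <= \sum_(c < p) `|M c| by apply: sumr_ge0 => c _.
  apply: (normrM_le sM) => i j; rewrite ord1 (bigD1 i)//= (le_trans (HM i t ut tv))//.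
  by rewrite (le_trans (ler_norm _))// lerDl sumr_ge0.
pose U := sup [set `|x t| | t in `[u, v]%classic].
have xU t : u <= t -> t <= v -> `|x t| <= U.
  by move=> ut tv; apply: sup_upper_bound => //; exists t => //; rewrite /= in_itv /= ut tv.
have U0 : 0 <= U by rewrite (le_trans _ (xU u _ _)).
have half t : u <= t -> t <= v -> `|x t| <= U / 2.
  have base y z : u <= y -> y <= z -> z <= v -> forall c : 'I_p, `|x z c 0 - x y c 0| <= U / 2.
    move=> uy yz zv c; have [If E] := abs_cont_sub uy zv (Hc c).
    rewrite E//; have Imyz := Lint_sub uy zv Imu.
    rewrite (le_trans (Rint_abs If))//.
    apply: (@le_trans _ _ (\int[leb]_(q in `[y, z]) (U * m q))).
      apply: Rint_le; [apply: Lint_abs => //; exact: Lm_itv|apply: LintZ => //; exact: Lm_itv|].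
      move=> q yq qz; rewrite mxE (le_trans (ler_norm_sum _ _ _))//.
      apply: (@le_trans _ _ (\sum_j `|A q c j| * U)).
        apply: ler_sum => j _; rewrite normrM ler_wpM2l//.
        by rewrite (le_trans (normrV_ge _ _))// xU//; [exact: le_trans uy _|exact: le_trans zv].
      rewrite -mulr_suml mulrC ler_wpM2l// /m [leRHS](bigD1 c)//= lerDl sumr_ge0// => i _.
      exact: sumr_ge0.
    rewrite (RintegralZl U (Lm_itv `[y, z]) Imyz) ler_wpM2l//.
    rewrite -[2^-1]mul1r; apply: le_trans K.
    rewrite (@LRint_eq _ _ (fun t => `|m t|) m) => [|q _]; last exact: ger0_norm.
    exact: Rint_mono.
  move=> ut tv; apply: normrM_le => [|i j]; first by rewrite divr_ge0.
  rewrite ord1; case: (leP s t) => st.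
    by have := base s t us st tv i; rewrite xs mxE subr0.
  by have := base t s ut (ltW st) sv i; rewrite xs mxE sub0r normrN.
have : U <= U / 2.
  apply: ge_sup; first by case: bd.
  move=> y [t /=]; rewrite in_itv /= => /andP[ut tv] <-; exact: half.
rewrite ler_pdivlMr// mulrDr mulr1 gerDl => U0'.
move=> t /andP[ut tv]; apply/eqP; rewrite -normr_le0.
by rewrite (le_trans (xU t ut tv)).
Qed.

End ODE.

(** * Primitives of monotone differentiable functions *)

Section FTC.
Context {R : realType}.
Notation LT := (lebesgueType R).
Notation mL := (@completed_lebesgue_measure R).
Implicit Types (a b c : R) (f g : R -> R).

Lemma slope_le_near f c r : derivable f r 1 -> derive1 f r < c ->
  exists2 dl : R, 0 < dl & forall x y, x <= r -> r <= y -> y - x < dl ->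
    f y - f x <= c * (y - x).
Proof.
move=> df fc.
have /cvgrPdist_lt H : h^-1 *: (f (h *: 1 + r) - f r) @[h --> 0^'] --> 'D_1 f r by exact: df.
have e0 : 0 < c - derive1 f r by rewrite subr_gt0.
have := H _ e0; rewrite near_withinE /= => /nbhs_ballP[dl /= dl0 K].
exists dl => // x y xr ry yx.
have S h : h != 0 -> `|h| < dl -> h^-1 * (f (h + r) - f r) < c.
  move=> h0 hd; have := K h; rewrite /ball /= sub0r normrN => /(_ hd h0).
  rewrite /GRing.scale /= mulr1 distrC -derive1E => /(le_lt_trans (ler_norm _)).
  by rewrite ltrBlDr subrK.
have S1 : f y - f r <= c * (y - r).
  move: ry; rewrite le_eqVlt => /orP[/eqP ->|ry]; first by rewrite !subrr mulr0.
  have yr0 : 0 < y - r by rewrite subr_gt0.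
  have := S (y - r); rewrite subrK gt_eqF// gtr0_norm// => /(_ isT).
  have yd : y - r < dl by rewrite (le_lt_trans _ yx)// lerD2l lerN2.
  by move=> /(_ yd); rewrite ltr_pdivrMl// mulrC => /ltW.
have S2 : f r - f x <= c * (r - x).
  move: xr; rewrite le_eqVlt => /orP[/eqP ->|xr]; first by rewrite !subrr mulr0.
  have xr0 : x - r < 0 by rewrite subr_lt0.
  have := S (x - r); rewrite subrK lt_eqF// ltr0_norm// opprB => /(_ isT).
  have xd : r - x < dl by rewrite (le_lt_trans _ yx)// lerD2r.
  move=> /(_ xd); rewrite ltr_ndivrMl// => H2; apply: ltW.
  by rewrite -ltrN2 opprB -mulrN opprB mulrC.
have -> : f y - f x = (f y - f r) + (f r - f x) by ring.
have -> : c * (y - x) = c * (y - r) + c * (r - x) by ring.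
exact: lerD.
Qed.

(** The derivative of f may be discontinuous, so neighbourhoods of the level
    sets of g from outer regularity are used to find, around every point, an
    interval where the increment of f is at most a weighted measure of
    open sets; a Cousin cover adds these estimates. *)
Lemma diff_le_integral a b f g : a <= b ->
  (forall x, derivable f x 1) -> (forall x, derive1 f x <= g x) -> (forall x, 0 <= g x) ->
  measurable_fun setT g -> Lintegrable `[a, b] g ->
  f b - f a <= \int[leb]_(t in `[a, b]) g t.
Proof.
move=> ab df fg g0 mg Ig.
apply/ler_addgt0Pr => e0 e00.
pose e := e0 / (b - a + 1).
have ba0 : 0 < b - a + 1 by rewrite ltr_wpDl// subr_ge0.
have e_gt0 : 0 < e by rewrite divr_gt0.
have -> : e0 = e * (b - a) + e by rewrite /e; field; rewrite gt_eqF.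
pose c n : R := n.+1%:R * e.
have c0 n : 0 < c n by rewrite mulr_gt0.
(* level sets of g, on which g is constant up to e *)
pose E n : set R := `[a, b]%classic `&` g @^-1` `[n%:R * e, n.+1%:R * e[%classic.
have mE n : measurable (E n).
  apply: measurableI; first exact: measurable_itv.
  by rewrite -[X in measurable X]setTI; apply: mg => //; exact: measurable_itv.
have mEL n : measurable (E n : set LT) by exact: Lm_borel.
have lab : (@lebesgue_measure R `[a, b]%classic < +oo)%E.
  have -> : @lebesgue_measure R `[a, b]%classic = (b - a)%:E by exact: leb_itv.
  exact: ltry.
have Efin n : (@lebesgue_measure R (E n) < +oo)%E.
  apply: le_lt_trans lab; apply: le_measure.
  - by apply/mem_set; exact: mE.
  - by apply/mem_set; exact: (measurable_itv `[a, b]).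
  - by move=> x [].
(* weighted by the heights c n, the excess measures have total at most e *)
have /choice[UU HO] : forall n, exists V : set R, [/\ open V, E n `<=` V &
   (@lebesgue_measure R (V `\` E n) < (e / (2 ^ n.+1)%:R / c n)%:E)%E].
  move=> n; have en : 0 < e / (2 ^ n.+1)%:R / c n.
    by rewrite divr_gt0// divr_gt0// ltr0n expn_gt0.
  by have [U [? ? ?]] := lebesgue_regularity_outer (mE n) (Efin n) en; exists U.
have mO n : measurable (UU n) by apply: open_measurable; case: (HO n).
pose Oxy n x y : set LT := UU n `&` `[x, y[%classic.
have mOxy n x y : measurable (Oxy n x y).
  by apply: Lm_borel; apply: measurableI => //; exact: measurable_itv.
pose P x y := ((f y - f x)%:E <= \sum_(0 <= n <oo) ((c n)%:E * mL (Oxy n x y)))%E.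
have terms0 x y n : (0 <= (c n)%:E * mL (Oxy n x y))%E.
  by rewrite mule_ge0// lee_fin ltW.
have Pab : P a b.
  apply: (@cousin R a b P) => // [x y z ax xy yz zb Pxy Pyz|r ar rb].
    rewrite /P; have -> : f z - f x = (f y - f x) + (f z - f y) by ring.
    rewrite EFinD.
    have -> : (\sum_(0 <= n <oo) ((c n)%:E * mL (Oxy n x z)) =
       \sum_(0 <= n <oo) ((c n)%:E * mL (Oxy n x y) + (c n)%:E * mL (Oxy n y z)))%E.
      apply: eq_eseriesr => n _; rewrite -muleDr//; last by rewrite ge0_adde_def// inE measure_ge0.
      have -> : Oxy n x z = Oxy n x y `|` Oxy n y z.
        rewrite /Oxy -setIUr; congr (_ `&` _).
        by rewrite (@itv_bndbnd_setU _ _ _ (BLeft y))// bnd_simp.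
      rewrite measureU//.
      apply/seteqP; split => // t [[_ /=]]; rewrite in_itv /= => /andP[_ ty] [_ /=].
      by rewrite in_itv /= leNgt ty.
    have -> := @nneseriesD R (fun n => (c n)%:E * mL (Oxy n x y))%E
      (fun n => (c n)%:E * mL (Oxy n y z))%E xpredT 0
      (fun n _ _ => terms0 x y n) (fun n _ _ => terms0 y z n).
    exact: leeD.
  pose n := Num.trunc (g r / e).
  have gre : 0 <= g r / e by rewrite divr_ge0// ltW.
  have /andP[n1 n2] := truncn_itv gre.
  rewrite -/n ler_pdivlMr// in n1; rewrite -/n ltr_pdivrMr// in n2.
  have Er : E n r by split; rewrite /= in_itv /= ?ar ?rb ?n1 ?n2.
  have [oO EO _] := HO n.
  have [d1 /= d10 D1] : exists2 d : R, 0 < d & ball r d `<=` UU n.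
    by have /nbhs_ballP := open_nbhs_nbhs (conj oO (EO r Er)).
  have [d2 d20 D2] := slope_le_near (df r) (le_lt_trans (fg r) n2).
  exists (Num.min d1 d2); first by rewrite lt_min d10 d20.
  move=> x y ax xr ry yb; rewrite lt_min => /andP[y1 y2].
  have xy := le_trans xr ry.
  have fyx := D2 x y xr ry y2.
  rewrite /P; apply: (@le_trans _ _ ((c n)%:E * mL (Oxy n x y))%E).
    have -> : Oxy n x y = `[x, y[%classic.
      apply/seteqP; split => [t []//|t /= txy]; split => //; apply: D1.
      move: txy; rewrite in_itv /= => /andP[xt ty]; rewrite /ball /=.
      by rewrite ltr_norml; apply/andP; split; lra.
    have -> : mL `[x, y[%classic = (y - x)%:E.
      have := @lebesgue_measure_itv R `[x, y[; rewrite /= lte_fin => H; apply: etrans H _.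
      case: ltP => //= yx; have -> : x = y by apply/le_anti/andP.
      by rewrite subrr.
    by rewrite -EFinM lee_fin.
  have := @nneseries_lim_ge R (fun n => (c n)%:E * mL (Oxy n x y))%E xpredT 0 n.+1
     (fun n _ _ => terms0 x y n).
  apply: le_trans; rewrite big_nat_recr//= leeDr// sume_ge0//.
rewrite -lee_fin; apply: le_trans Pab _.
apply: (@le_trans _ _ (\sum_(0 <= n <oo) ((c n)%:E * mL (E n) + (e / (2 ^ n.+1)%:R)%:E))%E).
  apply: lee_nneseries => // n _.
  have [oO EO lO] := HO n.
  have -> : (e / (2 ^ n.+1)%:R)%:E = ((c n)%:E * (e / (2 ^ n.+1)%:R / c n)%:E)%E.
    rewrite -EFinM; congr EFin; apply/esym; rewrite mulrC.
    by apply: divfK; rewrite gt_eqF.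
  rewrite -muleDr//; last first.
    rewrite ge0_adde_def// inE ?measure_ge0// lee_fin.
    by apply: divr_ge0; [apply: divr_ge0|]; rewrite ltW.
  rewrite lee_pmul2l ?lte_fin//.
  apply: (@le_trans _ _ (mL (E n `|` (UU n `\` E n)))).
    apply: le_measure.
    - by apply/mem_set; exact: mOxy.
    - by apply/mem_set; apply: measurableU => //; apply: measurableD => //; exact: Lm_borel.
    by move=> t [Ot _]; case: (pselect (E n t)) => Et; [left|right].
  apply: le_trans (measureU2 _ _ _) _ => //.
    by apply: measurableD => //; exact: Lm_borel.
  by rewrite leeD2l// ltW.
apply: le_trans (epsilon_trick _ _ _) _.
- by move=> n; rewrite mule_ge0// lee_fin ltW.
- exact: ltW.
rewrite addrA EFinD leeD2r//.
have Ige : Lintegrable `[a, b] (fun t => g t + e).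
  by apply: LintD => //; [exact: Lm_itv|exact: Lint_cst].
apply: (@le_trans _ _ (\int[mL]_(t in `[a, b]) (g t + e)%:E)%E); last first.
  rewrite -(Rint_cst e ab) -(RintegralD (Lm_itv `[a, b]) Ig (Lint_cst _ _ _)).
  rewrite /Rintegral fineK//; apply: integrable_fin_num => //; exact: Lm_itv.
have UE : `[a, b]%classic = \bigcup_n E n.
  apply/seteqP; split => [t tab|t [n _ []]//].
  exists (Num.trunc (g t / e)) => //; split => //=.
  have gre : 0 <= g t / e by rewrite divr_ge0// ltW.
  have /andP[n1 n2] := truncn_itv gre.
  by rewrite in_itv /= -ler_pdivlMr// n1 -ltr_pdivrMr.
rewrite UE (@ge0_integral_bigcup _ LT R mL E _ mEL).
- apply: lee_nneseries => [n _ _|n _]; first by rewrite mule_ge0// lee_fin ltW.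
  rewrite -(@integral_cst _ LT R mL _ (mEL n)).
  apply: (@ge0_le_integral _ LT R mL _ (mEL n)).
  + by move=> t _; rewrite lee_fin ltW.
  + exact: measurable_cst.
  + apply/measurable_EFinP; apply: (@LmeasurableS R (E n) `[a, b]).
    * exact: Lm_itv.
    * by move=> t [].
    * exact: Lint_meas.
  + move=> t [_]; rewrite /= in_itv /= => /andP[n1 _]; rewrite lee_fin /c.
    by rewrite -natr1 mulrDl mul1r lerD2r.
- rewrite -UE; exact: (measurable_int _ Ige).
- by move=> t _; rewrite lee_fin addr_ge0// ltW.
- move=> i j _ _ [t [[_ /=]]]; rewrite !in_itv /= => /andP[i1 i2] [_ /=]; rewrite in_itv /=.
  move=> /andP[j1 j2].
  have ij : (i < j.+1)%N by rewrite -(ltr_nat R) -(ltr_pM2r e_gt0) (le_lt_trans i1).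
  have ji : (j < i.+1)%N by rewrite -(ltr_nat R) -(ltr_pM2r e_gt0) (le_lt_trans j1).
  by apply/eqP; rewrite eqn_leq -ltnS ij -ltnS ji.
Qed.

End FTC.

Section FTC2.
Context {R : realType}.
Notation LT := (lebesgueType R).
Notation mL := (@completed_lebesgue_measure R).
Implicit Types (a b c : R) (f g : R -> R).

Lemma derive1_seq f x : derivable f x 1 ->
  (fun m : nat => (f (x + m.+1%:R^-1) - f x) * m.+1%:R) @ \oo --> derive1 f x.
Proof.
move=> df.
have /cvgrPdist_lt H : h^-1 *: (f (h *: 1 + x) - f x) @[h --> 0^'] --> 'D_1 f x by exact: df.
apply/cvgrPdist_lt => e e0; have := H e e0.
rewrite near_withinE /= => /nbhs_ballP[dl /= dl0 K].
near=> m; rewrite derive1E.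
have m0 : (m.+1%:R^-1 : R) != 0 by rewrite invr_eq0 pnatr_eq0.
have E : (m.+1%:R^-1)^-1 *: (f (m.+1%:R^-1 *: 1 + x) - f x) = (f (x + m.+1%:R^-1) - f x) * m.+1%:R.
  by rewrite invrK /GRing.scale /= mulr1 [_^-1 + x]addrC [LHS]mulrC.
rewrite -E; apply: K => //; rewrite /ball /= sub0r normrN ger0_norm//.
by near: m; exact: near_infty_natSinv_lt (PosNum dl0).
Unshelve. all: by end_near. Qed.

Lemma derive1_measurable f : (forall x, derivable f x 1) ->
  measurable_fun setT (derive1 f).
Proof.
move=> df.
have cf : continuous f by move=> x; apply: differentiable_continuous; exact/derivable1_diffP.
refine (@measurable_fun_cvg _ _ R setT (fun m (x : R) => (f (x + m.+1%:R^-1) - f x) * m.+1%:R) (derive1 f) _ _).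
  move=> m; apply: measurable_funM => //; apply: measurable_funB.
    apply: continuous_measurable_fun => x; apply: continuous_comp; last exact: cf.
    by apply: cvgD; [exact: cvg_id|exact: cvg_cst].
  exact: continuous_measurable_fun.
by move=> x _; exact: derive1_seq.
Qed.

Lemma derive1_scale_sub (c : R) (f : R -> R) t : derivable f t 1 ->
  derivable (fun x => c * x - f x) t 1 /\
  derive1 (fun x => c * x - f x) t = c - derive1 f t.
Proof.
move=> df.
have dl : is_derive t 1 (c *: (@id R)) (c *: 1) :=
  @is_deriveZ _ _ _ (@id R) c t 1 1 (is_derive_id t 1).
have d : is_derive t (1 : R) (c *: (@id R) - f) (c *: 1 - 'D_1 f t).
  exact: (@is_deriveB _ _ _ _ _ _ _ _ _ dl (derivableP df)).
split; first exact: (@ex_derive _ _ _ _ _ _ _ d).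
by rewrite !derive1E (@derive_val _ _ _ _ _ _ _ d) /GRing.scale /= mulr1.
Qed.

(** The inequality above for k x - f(x), whose derivative is at most
    k - min(f', k), bounds the integral of min(f', k) by the increment of f.
    Monotone convergence makes f' integrable and gives one inequality; the other
    one is the inequality above for f itself. *)
Lemma nondecreasing_abs_cont f a b : (forall x, derivable f x 1) ->
  {homo f : x y / x <= y} -> abs_cont a b f (derive1 f).
Proof.
move=> df nf.
have f'0 x : 0 <= derive1 f x.
  apply: (cvgr_to_ge (derive1_seq (df x))); apply: nearW => m.
  by rewrite mulr_ge0// subr_ge0 nf// lerDl invr_ge0.
have mf' := derive1_measurable df.
have mLf' x y : Lmeasurable `[x, y] (derive1 f).
  apply: (@LmeasurableS _ _ setT) => //; exact: Lmeasurable_borel.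
have main x y : x <= y -> Lintegrable `[x, y] (derive1 f) /\
    \int[leb]_(t in `[x, y]) derive1 f t <= f y - f x.
  move=> xy.
  have mf0 : {homo f : x y / x <= y} := nf.
  pose M k t := Num.min (derive1 f t) k%:R : R.
  have IM k : Lintegrable `[x, y] (M k).
    apply: (@Lint_dom _ _ _ (fun=> k%:R)); [exact: Lm_itv| | |exact: Lint_cst].
    - apply: measurable_minr => //; exact: mLf'.
    - move=> t _; rewrite ger0_norm; first by rewrite ge_min lexx orbT.
      by rewrite le_min f'0 ler0n.
  have bM k : \int[leb]_(t in `[x, y]) M k t <= f y - f x.
    pose phi t := k%:R * t - f t.
    have dphi t := derive1_scale_sub k%:R (df t).
    have := @diff_le_integral R x y phi (fun t => k%:R - M k t) xy (fun t => (dphi t).1).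
    have H1 t : derive1 phi t <= k%:R - M k t.
      by rewrite (dphi t).2 lerD2l lerN2 ge_min lexx.
    have H2 t : 0 <= k%:R - M k t by rewrite subr_ge0 ge_min lexx orbT.
    have H3 : measurable_fun setT (fun t => k%:R - M k t).
      apply: measurable_funB => //; exact: measurable_minr.
    have H4 : Lintegrable `[x, y] (fun t => k%:R - M k t).
      apply: (@Lint_eq _ _ (fun t => k%:R + (-1) * M k t)); [exact: Lm_itv| |].
        by move=> t _; rewrite mulN1r.
      apply: LintD; [exact: Lm_itv|exact: Lint_cst|apply: LintZ => //; exact: Lm_itv].
    move=> /(_ H1 H2 H3 H4).
    rewrite (RintegralB (Lm_itv `[x, y]) (Lint_cst x y k%:R) (IM k)) Rint_cst//.
    rewrite /phi; lra.
  have lim_le : (\int[mL]_(t in `[x, y]) (derive1 f t)%:E <= (f y - f x)%:E)%E.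
    have cv := @cvg_monotone_convergence _ LT R mL _ (Lm_itv `[x, y])
       (fun k t => (M k t)%:E) _ _ _.
    have -> : (\int[mL]_(t in `[x, y]) (derive1 f t)%:E =
       \int[mL]_(t in `[x, y]) limn (fun k => (M k t)%:E))%E.
      apply: eq_integral => t _; apply/esym/cvg_lim => //.
      apply: cvg_near_cst; near=> k; rewrite /M min_l//.
      by near: k; exact: nbhs_infty_ger.
    apply: (cvge_to_le (cv _ _ _)).
    - by move=> k; exact: (measurable_int _ (IM k)).
    - by move=> k t _; rewrite lee_fin le_min f'0 ler0n.
    - move=> t _ k k' kk'; rewrite lee_fin le_min ge_min lexx /= ge_min ler_nat kk' orbT//.
    - apply: nearW => k; have := bM k; rewrite -lee_fin /Rintegral fineK//.
      apply: integrable_fin_num (IM k); exact: Lm_itv.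
  have If : Lintegrable `[x, y] (derive1 f).
    apply/integrableP; split; first exact/measurable_EFinP/mLf'.
    apply: le_lt_trans (ltry (f y - f x)).
    under eq_integral do rewrite gee0_abs ?lee_fin//.
    exact: lim_le.
  split => //; rewrite -lee_fin /Rintegral fineK//.
  by apply: integrable_fin_num If; exact: Lm_itv.
split.
  case: (leP a b) => ab; first exact: (main a b ab).1.
  by rewrite /Lintegrable set_itv_ge ?bnd_simp -?ltNge//; exact: integrable_set0.
move=> x y _ xy _; have [I1 I2] := main x y xy.
apply/le_anti; rewrite I2 andbT.
exact: diff_le_integral.
Unshelve. all: by end_near. Qed.

End FTC2.

(** * Evolution operators *)

Section Evolution.
Context {R : realType}.
Implicit Types (a b : R).

Lemma solution_abs_cont p (f : R -> 'cV[R]_p -> 'cV[R]_p) J x a b : a <= b ->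
  (forall t, a <= t <= b -> J t) -> solution f J x ->
  forall c : 'I_p, abs_cont a b (fun t => x t c 0) (fun t => f t (x t) c 0).
Proof.
move=> ab HJ sol c; split.
  by apply: (sol a b _ _ _ c).1 => //; apply: HJ; rewrite ?lexx ?ab.
move=> s t as_ st tb; have [] := sol s t _ _ st c.
- by apply: HJ; rewrite as_ (le_trans st).
- by apply: HJ; rewrite tb (le_trans as_).
- by move=> _ ->; rewrite addrC addKr.
Qed.

Lemma abs_cont_solution p (f : R -> 'cV[R]_p -> 'cV[R]_p) (J : set R) (x : R -> 'cV[R]_p) :
  (forall a b, J a -> J b -> a <= b -> forall c : 'I_p,
     abs_cont a b (fun t => x t c 0) (fun t => f t (x t) c 0)) -> solution f J x.
Proof.
move=> H s t Js Jt st c; have [If E] := H s t Js Jt st c; split => //.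
by rewrite -(E s t)// addrC subrK.
Qed.

Lemma mulmx_bvec m p (M : 'M[R]_(m, p)) i j : (M *m bvec j : 'cV[R]_m) i 0 = M i j.
Proof.
rewrite mxE (bigD1 j)//= mxE !eqxx mulr1 big1 ?addr0// => k kj.
by rewrite mxE (negbTE kj) mulr0.
Qed.

Context (p : nat) (A : R -> 'M[R]_p) (Phi : R -> R -> 'M[R]_p).
Hypothesis HA : loc_integrable A.
Hypothesis HPhi : evolution A Phi.

Lemma evol_abs_cont s a b : a <= b -> forall i j,
  abs_cont a b (fun t => Phi t s i j) (fun t => (A t *m Phi t s) i j).
Proof.
move=> ab i j; have [_ /(_ (bvec j)) sol] := HPhi s.
have := solution_abs_cont ab (fun _ _ => Logic.I) sol i.
by apply: abs_cont_eq => t _; rewrite ?mulmxA mulmx_bvec.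
Qed.

(** Uniqueness for linear equations, in the form in which the evolution
    operator is used: every solution is transported by it. *)
Lemma evol_unique (x : R -> 'cV[R]_p) :
  (forall a b, a <= b -> forall c : 'I_p, abs_cont a b (fun t => x t c 0) (fun t => (A t *m x t) c 0)) ->
  forall t s, x t = Phi t s *m x s.
Proof.
move=> Hx t s; apply/eqP; rewrite -subr_eq0; apply/eqP.
pose a := Num.min s t; pose b := Num.max s t.
have ab : a <= b by rewrite /a /b le_max !ge_min !lexx.
pose z r := x r - Phi r s *m x s.
apply: (@linear_unique R a b p A z s) => //.
- move=> c; have [_ /(_ (x s)) sol] := HPhi s.
  have H := solution_abs_cont ab (fun _ _ => Logic.I) sol c.
  pose u (i : bool) r := if i then x r c 0 else (Phi r s *m x s) c 0.
  pose f (i : bool) r := if i then (A r *m x r) c 0 else (A r *m (Phi r s *m x s)) c 0.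
  have Hu i : abs_cont a b (u i) (f i) by case: i; [exact: Hx|exact: H].
  have := abs_cont_sum (fun i : bool => if i then 1 else -1) ab Hu.
  apply: abs_cont_eq => r _; rewrite big_bool /z /= mul1r mulN1r.
    by rewrite !mxE.
  by rewrite mulmxBr !mxE.
- by rewrite /a /b le_max ge_min !lexx.
- by rewrite /z (HPhi s).1 mul1mx subrr.
- by rewrite /a /b le_max ge_min !lexx !orbT.
Qed.

Lemma evol_cocycle t s r : Phi t s *m Phi s r = Phi t r.
Proof.
apply/matrixP => i j; rewrite -[LHS]mulmx_bvec -[RHS]mulmx_bvec -mulmxA.
have H a b : a <= b -> forall c : 'I_p, abs_cont a b
    (fun t => (Phi t r *m bvec j : 'cV[R]_p) c 0) (fun t => (A t *m (Phi t r *m bvec j)) c 0).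
  move=> ab c; have [_ /(_ (bvec j)) sol] := HPhi r.
  exact: solution_abs_cont ab (fun _ _ => Logic.I) sol c.
by have := evol_unique H t s => /= ->.
Qed.

Lemma evol_id s : Phi s s = 1%:M.
Proof. exact: (HPhi s).1. Qed.

Lemma evol_unit t s : Phi t s \in unitmx.
Proof.
have := evol_cocycle t s t; rewrite evol_id => /mulmx1_unit[]//.
Qed.

Lemma evol_inv t s : Phi s t = invmx (Phi t s).
Proof.
rewrite -[RHS]mul1mx -(evol_id s) -(evol_cocycle s t s) -mulmxA.
by rewrite mulmxV ?mulmx1// evol_unit.
Qed.

Lemma evol_con s a b : a <= b -> forall i j, cont_on a b (fun t => Phi t s i j).
Proof. by move=> ab i j; exact: (abs_cont_con (evol_abs_cont s ab i j)). Qed.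

Lemma evol_con_inv s a b : a <= b -> forall i j, cont_on a b (fun t => Phi s t i j).
Proof.
move=> ab i j; rewrite /cont_on.
have -> : (fun x _ : R => Phi s x i j) = (fun x _ => invmx (Phi x s) i j).
  by apply/funext => x; apply/funext => _; rewrite -evol_inv.
apply: (@diag_cont_invmx R a b p (fun x _ => Phi x s)) => [x y|i' j']; first exact: evol_unit.
exact: evol_con.
Qed.

(** Difference of inverses: Phi(s, y) - Phi(s, x) is
    - Phi(s, y) (Phi(y, s) - Phi(x, s)) Phi(s, x), which is a slope
    representation. *)
Lemma evol_abs_cont_inv s a b : a <= b -> forall i j,
  abs_cont a b (fun t => Phi s t i j) (fun t => - (Phi s t *m A t) i j).
Proof.
move=> ab i j.
pose u (k : 'I_p * 'I_p) t := Phi t s k.1 k.2.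
pose f (k : 'I_p * 'I_p) t := (A t *m Phi t s) k.1 k.2.
pose g (k : 'I_p * 'I_p) (x y : R) := - Phi s y i k.1 * Phi s x k.2 j.
have Hu k : abs_cont a b (u k) (f k) by exact: evol_abs_cont.
have Hg k : diag_cont a b (g k).
  apply: diag_contM; last exact: evol_con_inv.
  by apply: diag_contN; apply: diag_cont_swap; exact: evol_con_inv.
have E3 (M N L : 'M[R]_p) : - (M *m N *m L) i j = \sum_k - M i k.1 * L k.2 j * N k.1 k.2.
  rewrite mxE -sumrN; under eq_bigr do rewrite mxE mulr_suml -sumrN.
  rewrite exchange_big pair_bigA /=; apply: eq_bigr => -[k k'] _ /=; ring.
apply: abs_cont_eq (abs_cont_chain ab Hu Hg _) => [t _ //|t _|x y ax xy yb].
  rewrite -E3 -mulmxA -mulmxA; congr (- _).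
  by rewrite evol_cocycle evol_id mulmx1.
have := E3 (Phi s y) (Phi y s - Phi x s) (Phi s x).
rewrite mulmxBr mulmxBl evol_cocycle evol_id mul1mx -mulmxA evol_cocycle evol_id mulmx1.
rewrite !mxE opprB => ->; apply: eq_bigr => k _; congr (_ * _).
by rewrite !mxE.
Qed.

End Evolution.

(** * Growth of the evolution operator outside the spectrum *)

Section Rates.
Context {R : realType}.

Lemma normM_mul m n p (M : 'M[R]_(m, n)) (N : 'M[R]_(n, p)) :
  `|M *m N| <= n%:R * (`|M| * `|N|).
Proof.
apply: normrM_le => [|i j]; first by rewrite mulr_ge0// mulr_ge0.
rewrite mxE (le_trans (ler_norm_sum _ _ _))//.
apply: (@le_trans _ _ (\sum_(k < n) `|M| * `|N|)).
  by apply: ler_sum => k _; rewrite normrM ler_pM// normrM_ge.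
by rewrite sumr_const card_ord mulr_natl.
Qed.

Section Abstract.
Context (p : nat) (Phi : R -> R -> 'M[R]_p) (le : R -> R -> Prop) (m : R -> R).
Hypothesis cocycle : forall t s r, Phi t s *m Phi s r = Phi t r.
Hypothesis Phi1 : forall s, Phi s s = 1%:M.
Hypothesis m_gt0 : forall t, 0 < m t.
Hypothesis le_m : forall s t, le s t -> m s <= m t.
Hypothesis m_oo : forall s N, exists2 t, le s t & N <= m t.

(** The order le and the rate m are abstract because both time directions are
    needed: (<=, mu) gives the upper rates, (>=, 1/mu) the lower ones. *)
Definition rate_bound (g : R) : Prop :=
  exists K, forall s t, le s t -> `|Phi t s| <= K * (m t / m s) `^ g.

Definition rate_dichotomy (g : R) : Prop :=
  exists2 P : R -> 'M[R]_p, (forall t s, P t *m Phi t s = Phi t s *m P s) &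
  exists K al be : R, [/\ 0 <= K, al < 0, 0 < be,
    forall t s, le s t -> `|Phi t s *m P s| <= K * (m t / m s) `^ (g + al) &
    forall t s, le t s -> `|Phi t s *m (1%:M - P s)| <= K * (m t / m s) `^ (g + be)].

Lemma ratio_gt0 s t : 0 < m t / m s.
Proof. by rewrite divr_gt0. Qed.

Lemma ratio_ge1 s t : le s t -> 1 <= m t / m s.
Proof. by move=> st; rewrite ler_pdivlMr// mul1r; exact: le_m. Qed.

Lemma rate_bound_le g g' : g <= g' -> rate_bound g -> rate_bound g'.
Proof.
move=> gg' [K HK]; exists `|K| => s t st.
rewrite (le_trans (HK s t st))// (le_trans (ler_wpM2r (powR_ge0 _ _) (ler_norm K)))//.
by rewrite ler_wpM2l// ler_powR// ratio_ge1.
Qed.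

Lemma ratio_inv s t g : (m s / m t) `^ g = (m t / m s) `^ (- g).
Proof.
have E : (m t / m s)^-1 = (m t / m s) `^ (-1) by rewrite powR_inv1// ltW// ratio_gt0.
by rewrite -[m s / m t]invf_div E -powRrM mulN1r.
Qed.

(** If all rates above g bound the evolution, the complementary projector of a
    dichotomy at g must vanish: it grows at rate g + be forwards, against the bound
    g + be/2.  So the dichotomy gives a rate strictly below g. *)
Lemma rate_collapse g : rate_dichotomy g ->
  (forall g', g < g' -> rate_bound g') -> exists2 g', g' < g & rate_bound g'.
Proof.
move=> [P PP [K [al [be [K0 al0 be0 H1 H2]]]]] Hg.
have [|K' HK'] := Hg (g + be / 2); first by rewrite ltrDl divr_gt0.
have P1 s : P s = 1%:M.
  apply/eqP; rewrite eq_sym -subr_eq0 -normr_le0.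
  set Q := 1%:M - P s.
  have key t : le s t -> `|Q| <= p%:R * (K * `|K'|) * (m t / m s) `^ (- (be / 2)).
    move=> st.
    (* Q, carried forward to time t and back by the complementary projector *)
    have -> : Q = (Phi s t *m (1%:M - P t)) *m Phi t s.
      by rewrite -mulmxA mulmxBl PP mul1mx -{1}[Phi t s]mulmx1 -mulmxBr mulmxA cocycle Phi1 mul1mx.
    rewrite (le_trans (normM_mul _ _))// -mulrA ler_wpM2l//.
    have A1 := H2 s t st.
    have A2 : `|Phi t s| <= `|K'| * (m t / m s) `^ (g + be / 2).
      by rewrite (le_trans (HK' s t st))// ler_wpM2r ?powR_ge0// ler_norm.
    rewrite (le_trans (ler_pM _ _ A1 A2))// ratio_inv mulrACA ler_wpM2l ?mulr_ge0//.
    rewrite -powRD; last by apply/implyP => _; rewrite gt_eqF// ratio_gt0.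
    by rewrite le_eqVlt; apply/orP; left; apply/eqP; congr (_ `^ _); field.
  rewrite leNgt; apply/negP => Q0.
  set C := p%:R * _ in key.
  have C0 : 0 <= C by rewrite mulr_ge0// mulr_ge0.
  have C1 : 0 < C + 1 by rewrite ltr_wpDl.
  (* ratio m t / m s beyond which the decay contradicts Q <> 0 *)
  pose X := ((C + 1) / `|Q|) `^ (2 / be).
  have X0 : 0 <= X by exact: powR_ge0.
  have [t st Xt] := m_oo s (X * m s).
  have := key t st; rewrite powRN leNgt => /negP; apply.
  have XE : X `^ (be / 2) = (C + 1) / `|Q|.
    rewrite /X -powRrM (_ : 2 / be * (be / 2) = 1); last by field; rewrite gt_eqF.
    by rewrite powRr1// divr_ge0// ltW.
  have r1 : (C + 1) / `|Q| <= (m t / m s) `^ (be / 2).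
    rewrite -XE; apply: ge0_ler_powR; rewrite ?nnegrE//.
    - by rewrite divr_ge0// ltW.
    - by rewrite ltW// ratio_gt0.
    - by rewrite ler_pdivlMr.
  have r0 : 0 < (m t / m s) `^ (be / 2) by rewrite powR_gt0// ratio_gt0.
  rewrite ltr_pdivrMr//; apply: (@lt_le_trans _ _ (C + 1)); first by rewrite ltrDl.
  by rewrite mulrC -ler_pdivrMr.
exists (g + al); first by rewrite gtrDl.
by exists K => s t st; have := H1 t s st; rewrite P1 mulmx1.
Qed.

(** The infimum of the bounding rates cannot exceed b: otherwise a dichotomy
    there would produce a smaller bounding rate. *)
Lemma rate_bound_all b : (exists g, rate_bound g) ->
  (forall g, b < g -> rate_dichotomy g) -> forall g, b < g -> rate_bound g.
Proof.
move=> [a Ea] HD g bg; apply: contrapT => nE.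
pose S := [set g | rate_bound g].
have lbS : lbound S g.
  by move=> g' Eg'; rewrite leNgt; apply/negP => gg'; apply: nE; apply: rate_bound_le Eg'; exact: ltW.
have iS : has_inf S by split; [exists a|exists g].
have gi : g <= inf S by apply: lb_le_inf => //; exists a.
have [|g' g'i Eg'] := rate_collapse (HD (inf S) (lt_le_trans bg gi)).
  move=> g' ig'; have d0 : 0 < g' - inf S by rewrite subr_gt0.
  have [g'' Sg''] := inf_adherent d0 iS; rewrite addrC subrK => lt.
  by apply: rate_bound_le Sg''; exact: ltW.
by have := ge_inf iS.2 Eg'; rewrite leNgt g'i.
Qed.

End Abstract.

Section Growth.
Context (mu : R -> R) (hmu : differentiable_growth_rate mu).

Lemma mu_gt0 t : 0 < mu t.
Proof. by case: hmu => -[]. Qed.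

Lemma mu_lt s t : s < t -> mu s < mu t.
Proof. by case: hmu => -[_ H _ _ _] _; exact: H. Qed.

Lemma mu_le s t : s <= t -> mu s <= mu t.
Proof. by rewrite le_eqVlt => /orP[/eqP ->//|/mu_lt/ltW]. Qed.

Lemma powmu_is_derive (g t : R) :
  is_derive t (1 : R) (fun t => mu t `^ g) (g * (derive1 mu t / mu t) * mu t `^ g).
Proof.
have dmu : is_derive t (1 : R) mu (derive1 mu t).
  by apply: DeriveDef; [case: hmu|rewrite derive1E].
have := @is_derive1_comp _ (fun x => x `^ g) mu t _ _ (is_derive1_powR g (mu_gt0 t)) dmu.
move=> /is_derive_eq; apply.
have -> : mu t `^ g = mu t `^ (g - 1) * mu t.
  rewrite -{3}[mu t]powRr1 ?(ltW (mu_gt0 _))// -powRD ?subrK//.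
  by rewrite (gt_eqF (mu_gt0 t)) implybT.
by rewrite /GRing.scale /=; field; rewrite gt_eqF// mu_gt0.
Qed.

(** Absolute continuity of powers of mu, which is what relates the evolution
    operators of A and of A - g (mu'/mu). *)
Lemma powmu_abs_cont g a b : a <= b ->
  abs_cont a b (fun t => mu t `^ g) (fun t => g * (derive1 mu t / mu t) * mu t `^ g).
Proof.
move=> ab.
have dE t : derive1 (fun t => mu t `^ g) t = g * (derive1 mu t / mu t) * mu t `^ g.
  by rewrite derive1E; apply: (@derive_val _ _ _ _ _ _ _ (powmu_is_derive g t)).
case: (leP 0 g) => g0.
  have := @nondecreasing_abs_cont R (fun t => mu t `^ g) a b
    (fun t => @ex_derive _ _ _ _ _ _ _ (powmu_is_derive g t)) _.
  move=> H; apply: abs_cont_eq (H _) => [//|t _|x y xy]; first exact: dE.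
  by apply: ge0_ler_powR; rewrite ?nnegrE ?(ltW (mu_gt0 _))// mu_le.
have dN t : is_derive t (1 : R) (fun t => - mu t `^ g) (- (g * (derive1 mu t / mu t) * mu t `^ g)).
  exact: is_deriveN (powmu_is_derive g t).
have H := @nondecreasing_abs_cont R (fun t => - mu t `^ g) a b
    (fun t => @ex_derive _ _ _ _ _ _ _ (dN t)) _.
have {}H : abs_cont a b (fun t => - mu t `^ g) (derive1 (fun t => - mu t `^ g)).
  have nE z : mu z `^ g = (mu z `^ (- g))^-1 by rewrite -powRN opprK.
  apply: H => x y xy; rewrite lerN2 !nE lef_pV2 ?posrE ?powR_gt0 ?mu_gt0//.
  by apply: ge0_ler_powR; rewrite ?nnegrE ?(ltW (mu_gt0 _)) ?oppr_ge0 ?(ltW g0)// mu_le.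
have := abs_cont_sum (fun _ : unit => -1) ab (fun _ : unit => H).
apply: abs_cont_eq => t _; rewrite big_const card_unit /= addr0 mulN1r ?opprK//.
rewrite derive1E; apply/eqP; rewrite eqr_oppLR; apply/eqP.
exact: (@derive_val _ _ _ _ _ _ _ (dN t)).
Qed.

Context (p : nat) (A : R -> 'M[R]_p) (Phi : R -> R -> 'M[R]_p).
Hypothesis HA : loc_integrable A.
Hypothesis HPhi : evolution A Phi.

(** Multiplying a solution by a power of mu shifts the equation by a multiple
    of mu'/mu. *)
Lemma shift_evol g Psi :
  evolution (fun t => A t - (g * (derive1 mu t / mu t)) *: 1%:M) Psi ->
  forall t s, Phi t s = (mu t / mu s) `^ g *: Psi t s.
Proof.
move=> HPsi t s; apply/matrixP => i j.
pose x r := ((mu r / mu s) `^ g *: Psi r s) *m bvec j.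
have powE r : (mu r / mu s) `^ g = (mu s)^-1 `^ g * mu r `^ g.
  by rewrite powRM ?invr_ge0 ?(ltW (mu_gt0 _))// mulrC.
have Hx a b : a <= b -> forall c : 'I_p, abs_cont a b (fun t => x t c 0) (fun t => (A t *m x t) c 0).
  move=> ab c; have [_ /(_ (bvec j)) sol] := HPsi s.
  have H := solution_abs_cont ab (fun _ _ => Logic.I) sol c.
  have := abs_cont_sum (fun _ : unit => (mu s)^-1 `^ g) ab (fun _ : unit => abs_contM ab (powmu_abs_cont g ab) H).
  apply: abs_cont_eq => r _; rewrite big_const card_unit /= addr0.
    by rewrite /x -scalemxAl [RHS]mxE powE mulrA.
  rewrite /x mulmxBl -!scalemxAl -!scalemxAr mul1mx [in RHS]mxE powE !mxE.
  by ring.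
rewrite -[LHS]mulmx_bvec -[RHS]mulmx_bvec -/(x t).
rewrite (evol_unique HA HPhi Hx t s) /x divff ?gt_eqF ?mu_gt0// powR1 scale1r.
by rewrite (evol_id HPsi) mul1mx.
Qed.

Hypothesis Hbg : exists K a : R, [/\ 1 <= K, 0 <= a &
    forall t s, `|Phi t s| <= K * (mu t / mu s) `^ (Num.sg (t - s) * a)].

Lemma dichotomy_projector g :
  uniform_dichotomy mu (fun t => A t - (g * (derive1 mu t / mu t)) *: 1%:M) ->
  exists2 P : R -> 'M[R]_p, (forall t s, P t *m Phi t s = Phi t s *m P s) &
  exists K al be : R, [/\ 0 <= K, al < 0, 0 < be,
    forall t s, s <= t -> `|Phi t s *m P s| <= K * (mu t / mu s) `^ (g + al) &
    forall t s, t <= s -> `|Phi t s *m (1%:M - P s)| <= K * (mu t / mu s) `^ (g + be)].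
Proof.
move=> [Psi HPsi [P [_ PP] [K [al [be [K1 al0 be0 H1 H2]]]]]].
have E := shift_evol HPsi.
have nE t s M : `|Phi t s *m M| = (mu t / mu s) `^ g * `|Psi t s *m M|.
  by rewrite E -scalemxAl normrZ ger0_norm// powR_ge0.
have r0 t s x y : (mu t / mu s) `^ (x + y) = (mu t / mu s) `^ x * (mu t / mu s) `^ y.
  rewrite powRD//; have -> : (mu t / mu s == 0) = false by rewrite gt_eqF// divr_gt0// mu_gt0.
  by rewrite implybT.
exists P; first by move=> t s; rewrite E -scalemxAr PP scalemxAl.
exists K, al, be; split => // [|t s st|t s ts]; first exact: le_trans K1.
  by rewrite nE r0 mulrCA ler_wpM2l ?powR_ge0// H1.
by rewrite nE r0 mulrCA ler_wpM2l ?powR_ge0// H2.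
Qed.

Lemma mu_pinfty s N : exists2 t, s <= t & N <= mu t.
Proof.
case: hmu => -[_ _ _ + _] _ => /cvgryPge /(_ N) H.
near (+oo : set_system R)%R => t; exists t; first by near: t; apply: nbhs_pinfty_ge; rewrite num_real.
by near: t.
Unshelve. all: by end_near. Qed.

Lemma mu_ninfty s N : exists2 t, t <= s & N <= (mu t)^-1.
Proof.
case: hmu => -[mu0 _ _ _ H] _.
have N0 : 0 < (`|N| + 1)^-1 by rewrite invr_gt0 ltr_wpDl.
have {}H := (@cvgrPdist_lt _ _ _ _ _ _ _).1 H _ N0.
near (-oo : set_system R)%R => t; exists t; first by near: t; apply: nbhs_ninfty_le; rewrite num_real.
have : `|0 - mu t| < (`|N| + 1)^-1 by near: t; exact: H.
rewrite sub0r normrN (gtr0_norm (mu0 t)) => Ht.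
rewrite (@le_trans _ _ (`|N| + 1))//; first by rewrite (le_trans (ler_norm N))// lerDl.
by rewrite -[leLHS]invrK lef_pV2 ?posrE// ltW.
Unshelve. all: by end_near. Qed.

(** No spectrum above b means a dichotomy at every g > b, and bounded growth
    provides one bounding rate to start from. *)
Lemma upper_rate b : (forall g, b < g -> ~ dichotomy_spectrum mu A g) ->
  forall g, b < g -> exists K, forall s t, s <= t -> `|Phi t s| <= K * (mu t / mu s) `^ g.
Proof.
move=> Hb g bg.
apply: (@rate_bound_all p Phi (fun s t => s <= t) mu _ _ _ _ _ b) => //.
- exact: evol_cocycle.
- exact: evol_id.
- exact: mu_gt0.
- exact: mu_le.
- exact: mu_pinfty.
- have [K [a [K1 a0 H]]] := Hbg; exists a, K => s t st.
  move: st; rewrite le_eqVlt => /orP[/eqP ->|st].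
    by rewrite (le_trans (H t t))// subrr sgr0 mul0r divff ?gt_eqF ?mu_gt0// !powR1.
  by rewrite (le_trans (H t s))// gtr0_sg ?subr_gt0// mul1r.
- move=> g' bg'; apply: dichotomy_projector.
  by apply: contrapT; exact: Hb.
Qed.

(** The upper rate in reversed time. *)
Lemma lower_rate a : (forall g, g < a -> ~ dichotomy_spectrum mu A g) ->
  forall g, g < a -> exists K, forall s t, t <= s -> `|Phi t s| <= K * (mu t / mu s) `^ g.
Proof.
move=> Ha g ga.
have rE s t x : ((mu t)^-1 / (mu s)^-1) `^ x = (mu t / mu s) `^ (- x).
  have E : (mu t)^-1 / (mu s)^-1 = mu s / mu t by rewrite invrK mulrC.
  by rewrite E (@ratio_inv mu mu_gt0).
suff H0 : forall g', - a < g' -> rate_bound Phi (fun s t => t <= s) (fun t => (mu t)^-1) g'.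
  have [|K HK] := H0 (- g); first by rewrite ltrN2.
  by exists K => s t ts; have := HK s t ts; rewrite rE opprK.
apply: rate_bound_all.
- exact: evol_cocycle.
- exact: evol_id.
- by move=> t; rewrite invr_gt0 mu_gt0.
- by move=> s t ts; rewrite lef_pV2 ?posrE ?mu_gt0// mu_le.
- exact: mu_ninfty.
- have [K [b [K1 b0 H]]] := Hbg; exists b, K => s t ts; rewrite rE.
  move: ts; rewrite le_eqVlt => /orP[/eqP ->|ts].
    by rewrite (le_trans (H s s))// subrr sgr0 mul0r divff ?gt_eqF ?mu_gt0// !powR1.
  by rewrite (le_trans (H t s))// ltr0_sg ?subr_lt0// mulN1r.
- move=> g' ag'; have : uniform_dichotomy mu (fun t => A t - ((- g') * (derive1 mu t / mu t)) *: 1%:M).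
    by apply: contrapT; apply: Ha; rewrite ltrNl.
  move=> /dichotomy_projector[P PP [K [al [be [K0 al0 be0 H1 H2]]]]].
  exists (fun t => 1%:M - P t).
    by move=> t s; rewrite mulmxBl mulmxBr PP mul1mx mulmx1.
  exists K, (- be), (- al); split; rewrite ?oppr_lt0 ?oppr_gt0//.
    by move=> t s ts; rewrite rE opprD !opprK; exact: H2.
  by move=> t s ts; rewrite subKr rE opprD !opprK; exact: H1.
Qed.

End Growth.
End Rates.

(** * Saturation of the variables *)

Section Saturation.
Context {R : realType}.
Context (M : nat) (ep : R).
Hypothesis ep_gt0 : 0 < ep.
Hypothesis M_even : ~~ odd M.
Hypothesis M_gt1 : (1 < M)%N.

Let M_gt0 : (0 < M)%N. Proof. exact: ltnW. Qed.
Let ME : M = M.-1.+1. Proof. by rewrite prednK. Qed.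
Let MR : M%:R = 1 + M.-1%:R :> R. Proof. by rewrite {1}ME -natr1 addrC. Qed.

Definition satq (u : R) : R := 1 + (u / ep) ^+ M.
(** Bounded, smooth, and tangent to the identity at 0 to order M, with slopes
    bounded independently of ep. *)
Definition sat (u : R) : R := u * (satq u)^-1.
Definition satn (u v : R) : R :=
  1 - \sum_(i < M.-1) (u / ep) ^+ (M.-1 - i) * (v / ep) ^+ i.+1.
(** The divided difference of sat, in closed form; M even keeps the denominators
    at least 1. *)
Definition sats (u v : R) : R := satn u v * (satq u)^-1 * (satq v)^-1.

Lemma pow_even_ge0 (u : R) : 0 <= u ^+ M.
Proof. exact: exprn_even_ge0. Qed.

Lemma satq_ge1 u : 1 <= satq u.
Proof. by rewrite /satq lerDl pow_even_ge0. Qed.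

Lemma satq_gt0 u : 0 < satq u.
Proof. exact: lt_le_trans (satq_ge1 u). Qed.

Lemma satq_neq0 u : satq u != 0.
Proof. by rewrite gt_eqF// satq_gt0. Qed.

Lemma sat_slope u v : sat u - sat v = sats u v * (u - v).
Proof.
pose U := u / ep; pose V := v / ep.
have uE : u = ep * U by rewrite /U mulrC divfK// gt_eqF.
have vE : v = ep * V by rewrite /V mulrC divfK// gt_eqF.
have key : u * satq v - v * satq u = satn u v * (u - v).
  rewrite /satn /satq -/U -/V uE vE.
  have -> : \sum_(i < M.-1) U ^+ (M.-1 - i) * V ^+ i.+1 =
      U * V * \sum_(i < M.-1) U ^+ (M.-2 - i) * V ^+ i.
    rewrite mulr_sumr; apply: eq_bigr => i _.
    have -> : (M.-1 - i = (M.-2 - i).+1)%N by have := ltn_ord i; lia.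
    by rewrite !exprS; ring.
  have X := subrXX U V M.-1.
  rewrite [in LHS]ME !exprS.
  have -> : (1 - U * V * \sum_(i < M.-1) U ^+ (M.-2 - i) * V ^+ i) * (ep * U - ep * V)
     = ep * ((U - V) - U * V * ((U - V) * \sum_(i < M.-1) U ^+ (M.-2 - i) * V ^+ i)) by ring.
  by rewrite -X; ring.
rewrite /sat /sats; apply: (mulIf (satq_neq0 u)); apply: (mulIf (satq_neq0 v)).
transitivity (u * satq v - v * satq u).
  by field; rewrite !satq_neq0.
by rewrite key; field; rewrite !satq_neq0.
Qed.

Lemma sat0 : sat 0 = 0.
Proof. by rewrite /sat mul0r. Qed.

Lemma pow_le (u : R) n : (n <= M)%N -> `|u| ^+ n <= 1 + u ^+ M.
Proof.
move=> nM; have E : `|u| ^+ M = u ^+ M by rewrite -normrX ger0_norm// pow_even_ge0.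
case: (leP `|u| 1) => u1.
  by rewrite (le_trans (exprn_ile1 n (normr_ge0 u) u1))// lerDl pow_even_ge0.
by rewrite -E (le_trans (ler_weXn2l (ltW u1) nM))// lerDr.
Qed.

Lemma sat_le_ep u : `|sat u| <= ep.
Proof.
rewrite /sat normrM (gtr0_norm (x := _^-1)) ?invr_gt0 ?satq_gt0//.
rewrite ler_pdivrMr ?satq_gt0//.
have -> : `|u| = ep * `|u / ep|.
  by rewrite normrM (gtr0_norm (x := _^-1)) ?invr_gt0// mulrCA divff ?mulr1// gt_eqF.
by rewrite ler_wpM2l ?(ltW ep_gt0)// -[`|u / ep|]expr1 pow_le.
Qed.

Lemma sat_le u : `|sat u| <= `|u|.
Proof.
rewrite /sat normrM (gtr0_norm (x := _^-1)) ?invr_gt0 ?satq_gt0//.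
by rewrite ler_pdivrMr ?satq_gt0// ler_peMr// satq_ge1.
Qed.

Lemma sats_bound u v : `|sats u v| <= M%:R.
Proof.
rewrite /sats !normrM !(gtr0_norm (x := _^-1)) ?invr_gt0 ?satq_gt0//.
rewrite ler_pdivrMr ?satq_gt0// ler_pdivrMr ?satq_gt0//.
set U := u / ep; set V := v / ep.
have U0 := pow_even_ge0 U; have V0 := pow_even_ge0 V.
rewrite (le_trans (ler_normB _ _))// normr1.
have H : `|\sum_(i < M.-1) U ^+ (M.-1 - i) * V ^+ i.+1| <= \sum_(i < M.-1) (U ^+ M + V ^+ M).
  rewrite (le_trans (ler_norm_sum _ _ _))//; apply: ler_sum => i _.
  rewrite normrM !normrX.
  have iM : ((M.-1 - i) + i.+1 = M)%N by have := ltn_ord i; lia.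
  have EU : `|U| ^+ M = U ^+ M by rewrite -normrX ger0_norm.
  have EV : `|V| ^+ M = V ^+ M by rewrite -normrX ger0_norm.
  rewrite -EU -EV; case: (leP `|U| `|V|) => UV.
    rewrite (@le_trans _ _ (`|V| ^+ (M.-1 - i + i.+1)))//.
      by rewrite exprD ler_wpM2r// ?exprn_ge0// lerXn2r ?nnegrE.
    by rewrite iM lerDr exprn_ge0.
  rewrite (@le_trans _ _ (`|U| ^+ (M.-1 - i + i.+1)))//.
    by rewrite exprD ler_wpM2l// ?exprn_ge0// lerXn2r ?nnegrE// ltW.
  by rewrite iM lerDl exprn_ge0.
rewrite (le_trans (lerD (lexx _) H))// sumr_const card_ord -[(_ + _) *+ _]mulr_natr /satq -/U -/V.
have M0 : 0 <= M.-1%:R :> R by [].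
move: (U ^+ M) (V ^+ M) U0 V0 => x y x0 y0; rewrite MR.
move: (M.-1%:R : R) M0 => m m0; rewrite -subr_ge0.
set Z := (X in 0 <= X); have -> : Z = m + x + y + x * y + m * (x * y).
  by rewrite /Z; ring.
by rewrite !addr_ge0 ?mulr_ge0.
Qed.

Lemma sat_flat u : `|sat u - u| <= `|u| * `|u / ep| ^+ M.
Proof.
have E : sat u - u = - (u * (u / ep) ^+ M) * (satq u)^-1.
  rewrite /sat /satq; move: (pow_even_ge0 (u / ep)); move: ((u / ep) ^+ M) => W W0.
  by field; rewrite gt_eqF// ltr_wpDr.
rewrite E normrM normrN (gtr0_norm (x := _^-1)) ?invr_gt0 ?satq_gt0//.
by rewrite ler_pdivrMr ?satq_gt0// normrM normrX ler_peMr ?satq_ge1.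
Qed.

Lemma sats_flat u : `|sats u u - 1| <= (M.+1)%:R * `|u / ep| ^+ M.
Proof.
set W := (u / ep) ^+ M.
have W0 : 0 <= W by exact: pow_even_ge0.
have nE : satn u u = 1 - M.-1%:R * W.
  rewrite /satn; congr (_ - _).
  rewrite (eq_bigr (fun=> W)); last first.
    by move=> i _; rewrite -exprD addnS subnK ?prednK// ltnW.
  by rewrite sumr_const card_ord mulr_natl.
have MP : M.-1%:R = M%:R - 1 :> R by rewrite MR addrC addKr.
have E : sats u u - 1 = - (M.+1%:R + W) * W * (1 + W)^-1 * (1 + W)^-1.
  rewrite /sats nE /satq -/W MP -natr1; field.
  by rewrite gt_eqF// ltr_wpDr.
have E2 : `|u / ep| ^+ M = W by rewrite -normrX ger0_norm.
rewrite E E2 {nE E E2}; clearbody W.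
rewrite !normrM normrN (ger0_norm W0).
have p1 : 0 < 1 + W by rewrite ltr_wpDr.
rewrite !(gtr0_norm (x := (1 + W)^-1)) ?invr_gt0// !ler_pdivrMr//.
rewrite ger0_norm ?addr_ge0//.
have : 1 <= M.+1%:R :> R by rewrite ler1n.
move: (M.+1%:R : R) => m m1; rewrite -subr_ge0.
set Z := (X in 0 <= X); have -> : Z = (2 * m - 1) * (W * W) + m * (W * (W * W)).
  by rewrite /Z; ring.
have m0 : 0 <= m by exact: le_trans m1.
apply: addr_ge0; apply: mulr_ge0 => //; last by rewrite !mulr_ge0.
  by lra.
by rewrite mulr_ge0.
Qed.

End Saturation.

Section Telescope.
Context {R : realType}.

(** The q-th coefficient in the telescoping of a difference of two products. *)
Definition tele n (a b : 'I_n -> R) (q : 'I_n) : R :=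
  \prod_(q' < n) (if (q' < q)%N then a q' else if (q < q')%N then b q' else 1).

Lemma prod_telescope n (a b : 'I_n -> R) :
  \prod_q a q - \prod_q b q = \sum_q tele a b q * (a q - b q).
Proof.
elim: n a b => [|n IH] a b; first by rewrite !big_ord0 subrr.
rewrite !big_ord_recl /= /tele.
rewrite [in RHS]big_ord_recl /= mul1r.
under [X in _ = _ + X]eq_bigr do rewrite big_ord_recl /= -mulrA.
rewrite -mulr_sumr -(IH (fun q => a (lift ord0 q)) (fun q => b (lift ord0 q))).
have -> : \prod_(i < n) b (lift ord0 i) = \prod_i b (lift ord0 i) by [].
ring.
Qed.

Lemma tele_bound n (a b : 'I_n -> R) q e : 0 <= e ->
  (forall q, `|a q| <= e) -> (forall q, `|b q| <= e) ->
  `|tele a b q| <= e ^+ n.-1.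
Proof.
move=> e0 Ha Hb; rewrite /tele normr_prod (bigD1 q)//= !ltnn normr1 mul1r.
have -> : (n.-1 = #|[pred q' : 'I_n | q' != q]|)%N.
  by rewrite cardC1 card_ord.
rewrite -prodr_const; apply: ler_prod => q' q'q; rewrite normr_ge0 /=.
case: (ltngtP q' q) => [_|_|E]; [exact: Ha|exact: Hb|].
by move: q'q; rewrite (val_inj E) eqxx.
Qed.

End Telescope.

(** * The near-identity transformation *)

HB.instance Definition _ (R : realType) (m n : nat) := Complete.on 'M[R]_(m, n).

Section UnitMx.
Context {R : realType}.

Lemma sum_le_const (I : finType) (f : I -> R) c :
  (forall i, f i <= c) -> \sum_i f i <= #|I|%:R * c.
Proof.
move=> H; rewrite (le_trans (ler_sum _ (fun i _ => H i)))//.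
by rewrite sumr_const mulr_natl.
Qed.

Lemma unitmx_inj p (M : 'M[R]_p) :
  (forall v : 'cV[R]_p, M *m v = 0 -> v = 0) -> M \in unitmx.
Proof.
move=> H; rewrite -unitmx_tr -row_free_unit -kermx_eq0.
apply/eqP/row_matrixP => i; rewrite row0; apply: trmx_inj; rewrite trmx0.
apply: H; rewrite -{1}[M]trmxK -trmx_mul -row_mul mulmx_ker row0.
by rewrite trmx0.
Qed.

Section Contract.
Context (p : nat) (W : 'M[R]_p).
Hypothesis Wrow : forall r, \sum_i `|W r i| <= 2^-1.

Lemma contract_le (v : 'cV[R]_p) : `|W *m v| <= 2^-1 * `|v|.
Proof.
apply: normrM_le => [|r j]; first by rewrite mulr_ge0.
rewrite ord1 mxE (le_trans (ler_norm_sum _ _ _))//.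
apply: (@le_trans _ _ (\sum_i `|W r i| * `|v|)).
  by apply: ler_sum => i _; rewrite normrM ler_wpM2l// normrV_ge.
by rewrite -mulr_suml ler_wpM2r.
Qed.

Lemma one_sub_le (v : 'cV[R]_p) : `|v| <= 2 * `|(1%:M - W) *m v|.
Proof.
rewrite mulmxBl mul1mx.
have := lerB_dist v (W *m v); have := contract_le v.
set a := `|v|; set b := `|W *m v|; set c := `|v - _|; lra.
Qed.

Lemma one_sub_unit : 1%:M - W \in unitmx.
Proof.
apply: unitmx_inj => v Hv; apply/eqP; rewrite -normr_le0.
by rewrite (le_trans (one_sub_le v))// Hv normr0 mulr0.
Qed.

End Contract.
End UnitMx.

Section Shear.
Context {R : realType} (p kap M : nat) (ep B : R).
Notation V := 'cV[R]_p.
Notation midx := {ffun 'I_kap -> 'I_p}.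
Notation coef := ('I_p -> midx -> R).
Hypothesis ep_gt0 : 0 < ep.
Hypothesis M_even : ~~ odd M.
Hypothesis M_gt1 : (1 < M)%N.
Hypothesis kap_gt1 : (1 < kap)%N.
Hypothesis ep_small :
  p%:R * (#|{: midx}|%:R * (B * (kap%:R * (ep ^+ kap.-1 * M%:R)))) <= 2^-1.

(** The homogeneous polynomial map with coefficients C; multi-indices are maps
    from positions to coordinates, so coefficients need not be symmetric. *)
Definition hpoly (C : coef) (z : V) : V := \col_r \sum_c C r c * \prod_q z (c q) 0.

Definition satv (y : V) : V := \col_i sat M ep (y i 0).

Definition sat_hpoly (C : coef) (y : V) : V := hpoly C (satv y).

(** Divided differences of the polynomial map. *)
Definition hslope (C : coef) (z z' : V) : 'M[R]_p :=
  \matrix_(r, i) \sum_c C r c *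
     \sum_(q | c q == i) tele (fun q => z (c q) 0) (fun q => z' (c q) 0) q.

Definition wslope (C : coef) (y y' : V) : 'M[R]_p :=
  \matrix_(r, i) (hslope C (satv y) (satv y') r i * sats M ep (y i 0) (y' i 0)).

Lemma hpoly_slope C z z' : hpoly C z - hpoly C z' = hslope C z z' *m (z - z').
Proof.
apply/matrixP => r j; rewrite ord1 !mxE -sumrB.
under eq_bigr do rewrite -mulrBr prod_telescope.
under [RHS]eq_bigr do rewrite !mxE mulr_suml.
rewrite exchange_big; apply: eq_bigr => c _ /=.
under [RHS]eq_bigr do rewrite -mulrA.
rewrite -mulr_sumr; congr (_ * _).
under [RHS]eq_bigr do rewrite mulr_suml.
rewrite (partition_big (fun q => c q) xpredT)//=.
by apply: eq_bigr => i _; apply: eq_bigr => q /eqP <-.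
Qed.

Lemma satv_slope y y' i : (satv y - satv y') i 0 = sats M ep (y i 0) (y' i 0) * (y - y') i 0.
Proof. by rewrite !mxE sat_slope. Qed.

Lemma sat_hpoly_slope C y y' : sat_hpoly C y - sat_hpoly C y' = wslope C y y' *m (y - y').
Proof.
rewrite /sat_hpoly hpoly_slope; apply/matrixP => r j; rewrite ord1 !mxE.
apply: eq_bigr => i _; rewrite satv_slope !mxE; by rewrite mulrA.
Qed.

Definition bounded_coef (C : coef) := forall r c, `|C r c| <= B.

(** ep_small is exactly what this bound needs; every monomial keeps
    kap - 1 >= 1 saturated factors, hence the power of ep. *)
Lemma wslope_row C y y' r : bounded_coef C -> \sum_i `|wslope C y y' r i| <= 2^-1.
Proof.
move=> HC; apply: le_trans ep_small.
suff H i : `|wslope C y y' r i| <= #|{: midx}|%:R * (B * (kap%:R * (ep ^+ kap.-1 * M%:R))).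
  by have := sum_le_const H; rewrite card_ord.
rewrite mxE mxE normrM mulrA mulrA mulrA ler_pM//; last exact: sats_bound.
rewrite -!mulrA (le_trans (ler_norm_sum _ _ _))//.
apply: sum_le_const => c.
rewrite normrM ler_pM// (le_trans (ler_norm_sum _ _ _))//.
apply: (@le_trans _ _ (\sum_(q < kap) ep ^+ kap.-1)); last first.
  by rewrite sumr_const card_ord mulr_natl.
rewrite big_mkcond; apply: ler_sum => q _; case: ifP => _.
  by apply: tele_bound => [|q'|q']; rewrite ?(ltW ep_gt0)// mxE sat_le_ep.
by rewrite exprn_ge0// ltW.
Qed.

Lemma sat_hpoly_lip C y y' : bounded_coef C -> `|sat_hpoly C y - sat_hpoly C y'| <= 2^-1 * `|y - y'|.
Proof.
by move=> HC; rewrite sat_hpoly_slope; apply: contract_le => r; exact: wslope_row.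
Qed.

Lemma satv0 : satv 0 = 0.
Proof. by apply/matrixP => i j; rewrite ord1 !mxE sat0. Qed.

Lemma hpoly0 C : hpoly C 0 = 0.
Proof.
apply/matrixP => i j; rewrite ord1 !mxE big1// => c _.
rewrite (bigD1 (Ordinal (ltnW kap_gt1)))//= mxE mul0r mulr0//.
Qed.

Lemma sat_hpoly0 C : sat_hpoly C 0 = 0.
Proof. by rewrite /sat_hpoly satv0 hpoly0. Qed.

(** On the diagonal this is the Jacobian matrix of the transformation below. *)
Definition jac (C : coef) (y y' : V) : 'M[R]_p := 1%:M - wslope C y y'.

Lemma jac_unit C y y' : bounded_coef C -> jac C y y' \in unitmx.
Proof. by move=> HC; apply: one_sub_unit => r; exact: wslope_row. Qed.

Definition shear (C : coef) (y : V) : V := y - sat_hpoly C y.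

Lemma shear_slope C y y' : shear C y - shear C y' = jac C y y' *m (y - y').
Proof. by rewrite /shear /jac mulmxBl mul1mx -sat_hpoly_slope; apply/matrixP => i j; rewrite !mxE; ring. Qed.

Lemma shear0 C : shear C 0 = 0.
Proof. by rewrite /shear sat_hpoly0 subr0. Qed.

Lemma shear_expand C y y' : bounded_coef C -> `|y - y'| <= 2 * `|shear C y - shear C y'|.
Proof.
by move=> HC; rewrite shear_slope; apply: one_sub_le => r; exact: wslope_row.
Qed.

Lemma shear_lip C y y' : bounded_coef C -> `|shear C y - shear C y'| <= 2 * `|y - y'|.
Proof.
move=> HC; have -> : shear C y - shear C y' = (y - y') - (sat_hpoly C y - sat_hpoly C y').
  by rewrite /shear; apply/matrixP => i j; rewrite !mxE; ring.
have := ler_normB (y - y') (sat_hpoly C y - sat_hpoly C y'); have := sat_hpoly_lip y y' HC.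
have := normr_ge0 (y - y').
by set a := `|y - y'|; set b := `|sat_hpoly C y - _|; set c := `|_ - (sat_hpoly C y - _)|; lra.
Qed.

(** y solves shear C y = x iff it is a fixed point of y -> x + sat_hpoly C y, a
    contraction with constant 1/2. *)
Lemma shear_surj C x : bounded_coef C -> exists y, shear C y = x.
Proof.
move=> HC; pose f (y : V) : V := x + sat_hpoly C y.
have h2 : 0 <= 2^-1 :> R by rewrite invr_ge0.
have fS : set_fun setT setT f by [].
pose L := isFun.Build _ _ setT setT f fS.
pose F : {fun setT >-> setT} := HB.pack f L.
have cF : is_contraction F.
  exists (NngNum h2); split => /=.
    by rewrite invf_lt1 ?ltr1n.
  move=> [y y'] _ /=; rewrite /f opprD addrACA subrr add0r.
  exact: sat_hpoly_lip.
have [||y _ yE] := banach_fixed_point cF; [exact: closedT|by exists 0|].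
exists y; rewrite /shear {1}yE /= /f addrK//.
Qed.

(** The inverse of shear, extended by 0 to unbounded coefficients to make it
    total. *)
Definition unshear (C : coef) (x : V) : V :=
  if pselect (bounded_coef C) is left HC then projT1 (cid (shear_surj x HC)) else 0.

Lemma unshearK C : bounded_coef C -> cancel (unshear C) (shear C).
Proof. by move=> HC x; rewrite /unshear; case: pselect => // HC'; case: cid. Qed.

Lemma shear_inj C : bounded_coef C -> injective (shear C).
Proof.
move=> HC y y' E; apply/eqP; rewrite -subr_eq0 -normr_le0.
by rewrite (le_trans (shear_expand _ _ HC))// E subrr normr0 mulr0.
Qed.

Lemma shear_cancel C : bounded_coef C -> cancel (shear C) (unshear C).
Proof. by move=> HC y; apply: (shear_inj HC); rewrite unshearK. Qed.

Lemma unshear0 C : bounded_coef C -> unshear C 0 = 0.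
Proof. by move=> HC; rewrite -[X in unshear C X](shear0 C) shear_cancel. Qed.

Lemma unshear_lip C x x' : bounded_coef C -> `|unshear C x - unshear C x'| <= 2 * `|x - x'|.
Proof. by move=> HC; rewrite (le_trans (shear_expand _ _ HC))// !unshearK. Qed.

Lemma unshear_slope C x x' : bounded_coef C ->
  unshear C x - unshear C x' = invmx (jac C (unshear C x) (unshear C x')) *m (x - x').
Proof.
move=> HC; have E := shear_slope C (unshear C x) (unshear C x').
by rewrite !unshearK// in E; rewrite E mulKmx// jac_unit.
Qed.

End Shear.

(** * Smoothness of the transformation and of its inverse *)

Lemma lipschitz_cont (R : realType) (V W : normedModType R) K (f : V -> W) x :
  0 < K -> (forall y, `|f x - f y| <= K * `|x - y|) -> {for x, continuous f}.
Proof.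
move=> K0 H; apply/cvgrPdist_le => e e0.
apply/nbhs_ballP; exists (e / K) => /=; first by rewrite divr_gt0.
move=> y; rewrite -ball_normE /= => xy.
by rewrite (le_trans (H y))// mulrC -ler_pdivlMr// ltW.
Qed.

Section Class.
Context {R : realType} {X : Type} (Pc : (X -> R) -> Prop).
Hypothesis Pcst : forall c, Pc (fun=> c).
Hypothesis Padd : forall f g, Pc f -> Pc g -> Pc (fun x => f x + g x).
Hypothesis Pmul : forall f g, Pc f -> Pc g -> Pc (fun x => f x * g x).
Hypothesis Pinv : forall f, (forall x, 1 <= f x) -> Pc f -> Pc (fun x => (f x)^-1).
Context (p kap M : nat) (ep : R).
Hypothesis ep_gt0 : 0 < ep.
Hypothesis M_even : ~~ odd M.
Notation V := 'cV[R]_p.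
Notation midx := {ffun 'I_kap -> 'I_p}.
Notation coef := ('I_p -> midx -> R).

Lemma class_exp (f : X -> R) n : Pc f -> Pc (fun x => f x ^+ n).
Proof.
move=> Hf; elim: n => [|n IH].
  by under eq_fun do rewrite expr0; exact: Pcst.
by under eq_fun do rewrite exprS; exact: Pmul.
Qed.

Lemma class_satq f : Pc f -> Pc (fun x => satq M ep (f x)).
Proof.
by move=> Hf; apply: Padd => //; apply: class_exp; apply: Pmul.
Qed.

Lemma class_satqV f : Pc f -> Pc (fun x => (satq M ep (f x))^-1).
Proof.
by move=> Hf; apply: Pinv; [move=> x; exact: satq_ge1|exact: class_satq].
Qed.

Lemma class_sat f : Pc f -> Pc (fun x => sat M ep (f x)).
Proof. by move=> Hf; apply: Pmul => //; exact: class_satqV. Qed.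

Lemma class_sats f g : Pc f -> Pc g -> Pc (fun x => sats M ep (f x) (g x)).
Proof.
move=> Hf Hg; apply: Pmul; last exact: class_satqV.
apply: Pmul; last exact: class_satqV.
rewrite /satn; under eq_fun do rewrite -mulN1r.
apply: Padd => //; apply: Pmul => //; apply: (class_sum Pcst Padd) => i _.
by apply: Pmul; apply: class_exp; apply: Pmul.
Qed.

Lemma class_tele n (a b : 'I_n -> X -> R) q :
  (forall q, Pc (a q)) -> (forall q, Pc (b q)) ->
  Pc (fun x => tele (a ^~ x) (b ^~ x) q).
Proof.
move=> Ha Hb; apply: (class_prod Pcst Pmul) => q' _.
by case: (q' < q)%N => //; case: (q < q')%N.
Qed.

Context (C : X -> coef) (Y Z : X -> V).
Hypothesis HC : forall r c, Pc (fun x => C x r c).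
Hypothesis HY : forall i, Pc (fun x => Y x i 0).
Hypothesis HZ : forall i, Pc (fun x => Z x i 0).

Lemma class_hslope r i : Pc (fun x => hslope (C x) (satv M ep (Y x)) (satv M ep (Z x)) r i).
Proof.
under eq_fun do rewrite mxE; apply: (class_sum Pcst Padd) => c _.
apply: Pmul => //; apply: (class_sum Pcst Padd) => q _.
apply: (@class_tele kap (fun q x => satv M ep (Y x) (c q) 0) (fun q x => satv M ep (Z x) (c q) 0)) => q'.
  by under eq_fun do rewrite mxE; exact: class_sat.
by under eq_fun do rewrite mxE; exact: class_sat.
Qed.

(** One closure argument for the three uses of the slope matrix: smoothness in
    the space variable, diagonal continuity and measurability in time. *)
Lemma class_jac r i : Pc (fun x => jac M ep (C x) (Y x) (Z x) r i).
Proof.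
under eq_fun do rewrite mxE [in X in _ + X]mxE -mulN1r.
apply: Padd => //; apply: Pmul => //.
under eq_fun do rewrite mxE; apply: Pmul; first exact: class_hslope.
exact: class_sats.
Qed.

End Class.

Section Smooth.
Context {R : realType} (p kap M : nat) (ep B : R).
Notation V := 'cV[R]_p.
Notation midx := {ffun 'I_kap -> 'I_p}.
Notation coef := ('I_p -> midx -> R).
Hypothesis ep_gt0 : 0 < ep.
Hypothesis M_even : ~~ odd M.
Hypothesis M_gt1 : (1 < M)%N.
Hypothesis kap_gt1 : (1 < kap)%N.
Hypothesis ep_small :
  p%:R * (#|{: midx}|%:R * (B * (kap%:R * (ep ^+ kap.-1 * M%:R)))) <= 2^-1.

Section Family.
Context {T : Type} (S : set T) (C : T -> coef).
Hypothesis HB : forall t, S t -> bounded_coef B (C t).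

Let cls l (f : T * V -> R) := jet_bound S l (cst 1) (fun t y => f (t, y)).

Let cls_cst l c : cls l (fun=> c).
Proof. by apply: jet_bound_cst; exists `|c| => t _; rewrite mulr1. Qed.

Let cls_inv l f : (forall x, 1 <= f x) -> cls l f -> cls l (fun x => (f x)^-1).
Proof.
move=> f1; apply: jet_bound_inv => [t x _|].
  by rewrite gt_eqF// (lt_le_trans ltr01).
exists 1 => t _; have f0 : 0 < f (t, 0) by rewrite (lt_le_trans ltr01).
by rewrite ger0_norm ?invr_ge0 ?(ltW f0)// invf_le1.
Qed.

Let cls_add l f g : cls l f -> cls l g -> cls l (fun x => f x + g x).
Proof. exact: jet_bound_add. Qed.

Let cls_mul l f g : cls l f -> cls l g -> cls l (fun x => f x * g x).
Proof. exact: jet_bound_mul. Qed.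

Lemma jet_bound_coef l r c : jet_bound S l (cst 1) (fun t (_ : V) => C t r c).
Proof. by apply: jet_bound_cst; exists B => t St; rewrite mulr1; exact: HB. Qed.

Lemma jet_bound_sat l i : jet_bound S l (cst 1) (fun _ (y : V) => satv M ep y i 0).
Proof.
apply: (@jet_bound_eq _ _ _ _ _ _ (fun _ (y : V) => sat M ep (y i 0))).
  by move=> t _; apply/funext => y; rewrite mxE.
exact: (@class_sat R _ (cls l) (@cls_cst l) (@cls_add l) (@cls_mul l) (@cls_inv l)
  M ep M_even (fun x => x.2 i 0) (jet_bound_coord S l i)).
Qed.

Lemma jet_bound_sats l i : jet_bound S l (cst 1) (fun _ (y : V) => sats M ep (y i 0) (y i 0)).
Proof.
exact: (@class_sats R _ (cls l) (@cls_cst l) (@cls_add l) (@cls_mul l) (@cls_inv l)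
  M ep M_even (fun x => x.2 i 0) (fun x => x.2 i 0) (jet_bound_coord S l i) (jet_bound_coord S l i)).
Qed.

Lemma jet_bound_hslope l r i :
  jet_bound S l (cst 1) (fun t y => hslope (C t) (satv M ep y) (satv M ep y) r i).
Proof.
exact: (@class_hslope R _ (cls l) (@cls_cst l) (@cls_add l) (@cls_mul l) (@cls_inv l)
  p kap M ep M_even (fun x => C x.1) snd snd (@jet_bound_coef l) (jet_bound_coord S l) (jet_bound_coord S l)).
Qed.

Lemma jet_bound_jac l (Z : T -> V -> V) r i :
  (forall i, jet_bound S l (cst 1) (fun t y => Z t y i 0)) ->
  jet_bound S l (cst 1) (fun t y => jac M ep (C t) y (Z t y) r i).
Proof.
move=> HZ.
exact: (@class_jac R _ (cls l) (@cls_cst l) (@cls_add l) (@cls_mul l) (@cls_inv l)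
  p kap M ep M_even (fun x => C x.1) snd (fun x => Z x.1 x.2) (@jet_bound_coef l) (jet_bound_coord S l) HZ).
Qed.

Lemma jet_bound_jacV l (Z : T -> V -> V) r i :
  (forall i, jet_bound S l (cst 1) (fun t y => Z t y i 0)) ->
  (exists K, forall t, S t -> `|(\det (jac M ep (C t) 0 (Z t 0)))^-1| <= K) ->
  jet_bound S l (cst 1) (fun t y => invmx (jac M ep (C t) y (Z t y)) r i).
Proof.
move=> HZ HK.
have H1 : cls l (fun x => (\det (jac M ep (C x.1) x.2 (Z x.1 x.2)))^-1).
  apply: jet_bound_inv => // [t y St|].
    by have := jac_unit ep_gt0 M_even M_gt1 ep_small y (Z t y) (HB St); rewrite unitmxE unitfE.
  exact: (@class_det R _ (cls l) (@cls_cst l) (@cls_add l) (@cls_mul l) p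
    (fun x => jac M ep (C x.1) x.2 (Z x.1 x.2)) (fun i' j' => jet_bound_jac i' j' HZ)).
pose Mx (x : T * V) := if pselect (S x.1) then jac M ep (C x.1) x.2 (Z x.1 x.2) else 1%:M.
have ME t y : S t -> Mx (t, y) = jac M ep (C t) y (Z t y).
  by move=> St; rewrite /Mx /=; case: pselect.
have H2 : cls l (fun x => invmx (Mx x) r i).
  apply: (@class_invmx R _ (cls l) (@cls_cst l) (@cls_add l) (@cls_mul l) p Mx).
  - move=> x; rewrite /Mx; case: pselect => St; last exact: unitmx1.
    exact: (jac_unit ep_gt0 M_even M_gt1 ep_small _ _ (HB St)).
  - move=> i' j'; apply: jet_bound_eq (jet_bound_jac i' j' HZ) => t St.
    by apply/funext => y; rewrite ME.
  - by apply: jet_bound_eq H1 => t St; apply/funext => y; rewrite ME.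
by apply: jet_bound_eq H2 => t St; apply/funext => y; rewrite ME.
Qed.

Lemma hslope0 (c : coef) : hslope c 0 0 = 0.
Proof.
apply/matrixP => r i; rewrite !mxE big1// => d _.
rewrite big1 ?mulr0// => q _.
have [q' qq'] : exists q' : 'I_kap, q' != q.
  case: (eqVneq q (Ordinal (ltnW kap_gt1))) => [->|]; last by exists (Ordinal (ltnW kap_gt1)); rewrite eq_sym.
  by exists (Ordinal kap_gt1).
rewrite /tele (bigD1 q')//= !mxE.
by case: ltngtP qq' => [_ _|_ _|E]; rewrite ?mul0r// (val_inj E) eqxx.
Qed.

Lemma jac0 (c : coef) : jac M ep c 0 0 = 1%:M.
Proof.
suff W0 : wslope M ep c (0 : V) 0 = 0 by rewrite /jac W0 subr0.
apply/matrixP => r i; have Z : (0 : 'M[R]_p) r i = 0 by rewrite mxE.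
by rewrite [LHS]mxE satv0 hslope0 Z mul0r.
Qed.

Lemma jet_bound_jacV_diag l r i :
  jet_bound S l (cst 1) (fun t y => invmx (jac M ep (C t) y y) r i).
Proof.
apply: (jet_bound_jacV (Z := fun _ y => y)) => [i'|]; first exact: jet_bound_coord.
by exists 1 => t _; rewrite jac0 det1 invr1 normr1.
Qed.

Lemma jet_bound_hpoly l psi (a : T -> coef) r :
  (forall r c, exists K, forall t, S t -> `|a t r c| <= K * psi t) ->
  jet_bound S l psi (fun t y => hpoly (a t) (satv M ep y) r 0).
Proof.
move=> Ha; apply: (@jet_bound_eq _ _ _ _ _ _ (fun t (y : V) =>
    \sum_c a t r c * \prod_q satv M ep y (c q) 0)).
  by move=> t _; apply/funext => y; rewrite mxE.
apply: jet_bound_sum => c _; apply: jet_bound_mulc; first exact: Ha.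
by apply: jet_bound_prod => q _; exact: jet_bound_sat.
Qed.

Lemma jet_bound_shear l r : jet_bound S l (cst 1) (fun t y => shear M ep (C t) y r 0).
Proof.
apply: (@jet_bound_eq _ _ _ _ _ _ (fun t (y : V) => y r 0 - hpoly (C t) (satv M ep y) r 0)).
  by move=> t _; apply/funext => y; rewrite !mxE.
apply: jet_bound_sub; first exact: jet_bound_coord.
apply: jet_bound_hpoly => r' c; exists B => t St; rewrite mulr1; exact: HB.
Qed.

End Family.

(** The slopes of the inverse are the inverse matrix of the slopes of the
    transformation, so the inverse is differentiable, with partial derivatives
    that are smooth functions of the inverse itself; induction on l. *)
Lemma jet_bound_unshear (C : coef) l r : bounded_coef B C ->
  jet_bound [set: unit] l (cst 1) (fun _ x => unshear ep_gt0 M_even M_gt1 ep_small C x r 0).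
Proof.
move=> HC; set u := unshear _ _ _ _ _.
have u0 : u 0 = 0 by exact: unshear0.
have b0 r' : exists K, forall t, [set: unit] t -> `|u 0 r' 0| <= K * (cst 1 t : R).
  by exists 0 => t Ut; rewrite u0 mxE normr0 mul0r.
have cu (x : V) i : {for x, continuous (fun x => u x i 0)}.
  apply: (@lipschitz_cont _ _ _ 2) => // y.
  have -> : u x i 0 - u y i 0 = (u x - u y) i 0 by rewrite !mxE.
  by rewrite (le_trans (normrV_ge _ _))// (le_trans (unshear_lip _ _ _ _ _ _ HC)).
have HB1 : forall t : unit, [set: unit] t -> bounded_coef B C by [].
elim: l r => [|l IH] r.
  by split => // t Ut x; exact: cu.
have slope x : differentiable (fun x => u x r 0) x /\
    forall v, 'd (fun x => u x r 0) x v = \sum_i invmx (jac M ep C (u x) (u x)) r i * v i 0.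
  apply: (@slope_diff R p (fun x => u x r 0) (fun i y => invmx (jac M ep C (u y) (u x)) r i)).
    move=> y; have := unshear_slope ep_gt0 M_even M_gt1 ep_small y x HC.
    rewrite -/u => /matrixP/(_ r 0); rewrite !mxE => ->.
    by apply: eq_bigr => i _; rewrite !mxE.
  move=> i.
  have J : jet_bound [set: unit] 0 (cst 1) (fun _ y => invmx (jac M ep C y (u x)) r i).
    apply: (@jet_bound_jacV unit setT (fun=> C) HB1 0 (fun _ _ => u x)).
      by move=> i'; apply: jet_bound_cst; exists `|u x i' 0| => t Ut; rewrite mulr1.
    by exists `|(\det (jac M ep C 0 (u x)))^-1| => t Ut; rewrite lexx.
  have cJ := jet_bound_cont (t := tt) J Logic.I.
  apply: (@continuous_comp _ _ _ u (fun y => invmx (jac M ep C y (u x)) r i)); last exact: cJ.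
  have -> : u = (fun x => \col_i u x i 0).
    by apply/funext => y; apply/matrixP => i' j'; rewrite ord1 mxE.
  by apply: continuous_col => i'; exact: cu.
split => //; split=> [_ _ x|i]; first exact: (slope x).1.
have J : jet_bound [set: unit] l (cst 1) (fun _ y => invmx (jac M ep C y y) r i).
  exact: (@jet_bound_jacV_diag unit setT (fun=> C) HB1).
have JC : jet_bound [set: unit] l (cst 1) (fun _ x => invmx (jac M ep C (\col_i u x i 0) (\col_i u x i 0)) r i).
  apply: (@jet_bound_comp R unit setT p p l (cst 1) _ (fun _ i x => u x i 0) _ J) => // t i' Ut.
  by rewrite u0 mxE.
apply: jet_bound_eq JC => t Ut; apply/funext => x.
have -> : \col_i u x i 0 = u x by apply/matrixP => i' j'; rewrite ord1 mxE.
apply/esym; apply: etrans ((slope x).2 _) _.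
rewrite (bigD1 i)//= mxE !eqxx mulr1 big1 ?addr0// => i' i'i.
by rewrite mxE (negbTE i'i) mulr0.
Qed.

End Smooth.

(** * Variation of constants over a ray *)

Section Green.
Context {R : realType} {I : finType}.
(** The times over which the source is integrated; low selects the past. *)
Definition ray (low : bool) (t : R) : set R :=
  if low then `]-oo, t]%classic else `[t, +oo[%classic.
(** The sign that makes the integral over the past, resp. the future, a
    primitive of minus the source; it is also the sign of the decay exponent. *)
Definition raysg (low : bool) : R := if low then -1 else 1.
Context (low : bool) (T : R -> R -> I -> I -> R) (a : R -> I -> R).
Hypothesis Tcoc : forall t u s x z, \sum_y T t u x y * T u s y z = T t s x z.
Hypothesis Tid : forall t x y, T t t x y = (x == y)%:R.
Hypothesis Tint : forall t x y, Lintegrable (ray low t) (fun s => T t s x y * a s y).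

Lemma mray t : measurable (ray low t : set (lebesgueType R)).
Proof. by rewrite /ray; case: low; exact: Lm_itv. Qed.

Definition gsource s x := \sum_y T 0 s x y * a s y.

(** Reducing the source to time 0 makes the integrand independent of t, so that
    this is a primitive. *)
Definition gpot t x := raysg low * \int[leb]_(s in ray low t) gsource s x.

Definition green t x := \sum_y T t 0 x y * gpot t y.

Lemma gsource_int t x : Lintegrable (ray low t) (gsource^~ x).
Proof.
have H : Lintegrable (ray low t) (fun s => \sum_z T 0 t x z * \sum_y T t s z y * a s y).
  apply: Lint_sum => [|z _]; first exact: mray.
  by apply: LintZ; [exact: mray|apply: Lint_sum => [|y _]; [exact: mray|exact: Tint]].
apply: Lint_eq H => [|s _]; first exact: mray.
rewrite /gsource; under eq_bigr do rewrite mulr_sumr.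
rewrite exchange_big /=; apply: eq_bigr => y _.
by under eq_bigr do rewrite mulrA; rewrite -mulr_suml Tcoc.
Qed.

(** Transporting the integral from time 0 to t turns it into the convolution of
    the source with T(t, s), the only form in which it can be estimated. *)
Lemma greenE t x :
  green t x = raysg low * \sum_y \int[leb]_(s in ray low t) (T t s x y * a s y).
Proof.
rewrite /green /gpot; under eq_bigr do rewrite mulrCA.
rewrite -mulr_sumr; congr (_ * _).
transitivity (\sum_y \int[leb]_(s in ray low t) (T t 0 x y * gsource s y)).
  by apply: eq_bigr => y _; rewrite RintegralZl//; [exact: mray|exact: gsource_int].
rewrite -LRint_sum; [|exact: mray|by move=> y _; apply: LintZ; [exact: mray|exact: gsource_int]].
rewrite -LRint_sum; [|exact: mray|by move=> y _; exact: Tint].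
apply: LRint_eq => s _; under eq_bigr do rewrite mulr_sumr.
rewrite exchange_big /=; apply: eq_bigr => y _.
by under eq_bigr do rewrite mulrA; rewrite -mulr_suml Tcoc.
Qed.

Lemma gpot_abs_cont t0 t1 x : t0 <= t1 -> abs_cont t0 t1 (gpot^~ x) (fun s => - gsource s x).
Proof.
move=> t01.
have I01 : Lintegrable `[t0, t1] (gsource^~ x).
  rewrite /Lintegrable; apply: (LintS (E := ray low (if low then t1 else t0))).
  - exact: Lm_itv.
  - exact: mray.
  - by rewrite /ray; case: low => s /=; rewrite !in_itv /= => /andP[h1 h2]; rewrite ?h2 ?h1.
  - exact: gsource_int.
split.
  have mI := Lm_itv `[t0, t1].
  by apply: (Lint_eq mI _ (LintZ (-1) mI I01)) => s _; rewrite mulN1r.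
move=> u v t0u uv vt1.
have Iuv : Lintegrable `[u, v] (gsource^~ x) by exact: Lint_sub I01.
have -> : \int[leb]_(s in `[u, v]) (- gsource s x) = - \int[leb]_(s in `[u, v]) gsource s x.
  under eq_Rintegral do rewrite -mulN1r.
  by rewrite RintegralZl ?mulN1r//; exact: Lm_itv.
rewrite /gpot /raysg; have := gsource_int^~ x; rewrite /ray; case: low => Hx.
  rewrite (@Rint_split_itv _ -oo%O (BRight v) u)//; by ring.
rewrite [X in _ - _ * X](@Rint_split_itv _ (BLeft u) +oo%O v)//; by ring.
Qed.

(** Product rule: the derivative of the potential reproduces minus the source,
    because T(t, 0) T(0, t) is the identity. *)
Lemma green_abs_cont t0 t1 (dT : R -> I -> I -> R) x : t0 <= t1 ->
  (forall y, abs_cont t0 t1 (fun t => T t 0 x y) (fun t => dT t x y)) ->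
  abs_cont t0 t1 (green^~ x) (fun t => \sum_y dT t x y * gpot t y - a t x).
Proof.
move=> t01 HT.
have H y : abs_cont t0 t1 (fun t => T t 0 x y * gpot t y)
    (fun t => dT t x y * gpot t y + T t 0 x y * - gsource t y).
  by apply: abs_contM => //; exact: gpot_abs_cont.
apply: abs_cont_eq (abs_cont_sum (fun=> 1) t01 H) => t _.
  by rewrite /green; apply: eq_bigr => y _; rewrite mul1r.
under eq_bigr do rewrite mul1r mulrN.
rewrite big_split /= sumrN; congr (_ - _).
rewrite /gsource; under eq_bigr do rewrite mulr_sumr.
rewrite exchange_big /=.
under eq_bigr do [under eq_bigr do rewrite mulrA; rewrite -mulr_suml Tcoc Tid].
rewrite (bigD1 x)//= eqxx mul1r big1 ?addr0// => y yx.
by rewrite eq_sym (negbTE yx) mul0r.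
Qed.

End Green.

(** * Transport of the coefficients of a polynomial map *)

Section Rays.
Context {R : realType} (mu psi : R -> R).
Hypothesis hmu : differentiable_growth_rate mu.
Hypothesis hpsi : uniformly_admissible mu psi.
Notation raysg := (@raysg R).

Lemma psi_ge0 t : 0 <= psi t.
Proof. by case: hpsi => -[]. Qed.

Lemma Lmeasurable_weight t g : Lmeasurable setT (fun s => psi s * (mu t / mu s) `^ g).
Proof.
apply: measurable_funM; first by case: hpsi => -[].
have -> : (fun s => (mu t / mu s) `^ g) = (fun s => mu t `^ g * mu s `^ (- g)).
  apply/funext => s; have ms := ltW (mu_gt0 hmu s); have mt := ltW (mu_gt0 hmu t).
  have ims : 0 <= (mu s)^-1 by rewrite invr_ge0.
  by rewrite (powRM g mt ims) -(powR_inv1 ms) -powRrM mulN1r.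
apply: Lmeasurable_continuous => s.
apply: cvgM; first exact: cvg_cst.
have := powmu_is_derive hmu (- g) s => -[D _].
by move/derivable1_diffP/differentiable_continuous: D.
Qed.

(** This is the content of uniform admissibility. *)
Lemma ray_weight low (delta : R) : 0 < delta ->
  exists S, forall t,
    Lintegrable (ray low t) (fun s => psi s * (mu t / mu s) `^ (raysg low * delta)) /\
    \int[leb]_(s in ray low t) (psi s * (mu t / mu s) `^ (raysg low * delta)) <= S.
Proof.
move=> d0; have [_ /(_ _ d0)] := hpsi; set E := (X in ereal_sup X) => supE.
have w0 t s g : 0 <= psi s * (mu t / mu s) `^ g by rewrite mulr_ge0 ?psi_ge0 ?powR_ge0.
have i0 (D : set R) t g : (0 <= \int[leb]_(s in D) (psi s * (mu t / mu s) `^ g)%:E)%E.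
  by apply: integral_ge0 => s _; rewrite lee_fin.
have le t : (\int[leb]_(s in ray low t) (psi s * (mu t / mu s) `^ (raysg low * delta))%:E
    <= ereal_sup E)%E.
  apply: (le_trans _ (ereal_sup_ubound _)); last by exists t.
  rewrite /ray /raysg; case: low; rewrite ?mulN1r ?mul1r.
    by rewrite leeDl// i0.
  by rewrite leeDr// i0.
have I t : Lintegrable (ray low t) (fun s => psi s * (mu t / mu s) `^ (raysg low * delta)).
  apply/integrableP; split.
    apply/measurable_EFinP; apply: (LmeasurableS (E := setT)) => //.
    exact: Lmeasurable_weight.
  under eq_integral do rewrite /= ger0_norm//.
  exact: le_lt_trans (le t) supE.
exists (fine (ereal_sup E)) => t; split; first exact: I.
rewrite /Rintegral fine_le//; first by rewrite ge0_fin_numE ?i0//; exact: le_lt_trans (le t) supE.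
by rewrite ge0_fin_numE//; exact: le_trans (i0 _ _ _) (le t).
Qed.

End Rays.

Section Tensor.
Context {R : realType} (p kap : nat).
Notation midx := {ffun 'I_kap -> 'I_p}.
Notation ix := ('I_p * midx)%type.
Context (A : R -> 'M[R]_p) (Phi : R -> R -> 'M[R]_p).
Hypothesis HA : loc_integrable A.
Hypothesis HPhi : evolution A Phi.

(** The action h -> Phi(t, s) h(Phi(s, t) y) on coefficients. *)
Definition tensor (t s : R) (x y : ix) : R :=
  Phi t s x.1 y.1 * \prod_q Phi s t (y.2 q) (x.2 q).

Lemma tensor_cocycle t u s x z : \sum_y tensor t u x y * tensor u s y z = tensor t s x z.
Proof.
rewrite /tensor -(pair_bigA _ (fun (r : 'I_p) (c : midx) => Phi t u x.1 r * \prod_q Phi u t (c q) (x.2 q) *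
  (Phi u s r z.1 * \prod_q Phi s u (z.2 q) (c q)))) /=.
under eq_bigr do [under eq_bigr do rewrite mulrACA -big_split /=; rewrite -mulr_sumr].
rewrite -mulr_suml; congr (_ * _); first by rewrite -(evol_cocycle HA HPhi t u s) mxE.
rewrite -(bigA_distr_bigA (fun q i => Phi u t i (x.2 q) * Phi s u (z.2 q) i)).
apply: eq_bigr => q _; rewrite -(evol_cocycle HA HPhi s u t) mxE.
by apply: eq_bigr => i _; rewrite mulrC.
Qed.

Lemma tensor_id t x y : tensor t t x y = (x == y)%:R.
Proof.
rewrite /tensor (evol_id HPhi) mxE; case: x y => [r c] [r' c'] /=.
rewrite xpair_eqE; case: (r == r'); last by rewrite mul0r.
rewrite mul1r /=; case: eqVneq => [->|cc'].
  by rewrite big1// => q _; rewrite mxE eqxx.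
have [q qq] : exists q, c q != c' q.
  apply/existsP; apply: contraNT cc' => /existsPn H.
  by apply/eqP/ffunP => q; apply/eqP; have := H q; rewrite negbK.
by rewrite (bigD1 q)//= mxE eq_sym (negbTE qq) mul0r.
Qed.

Definition dtensor t s (x y : ix) : R :=
  (A t *m Phi t s) x.1 y.1 * \prod_q Phi s t (y.2 q) (x.2 q) +
  Phi t s x.1 y.1 * \sum_q - (Phi s t *m A t) (y.2 q) (x.2 q) *
    \prod_(q' | q' != q) Phi s t (y.2 q') (x.2 q').

Lemma tensor_abs_cont t0 t1 s x y : t0 <= t1 ->
  abs_cont t0 t1 (fun t => tensor t s x y) (fun t => dtensor t s x y).
Proof.
move=> t01; apply: abs_contM => //; first exact: evol_abs_cont.
by apply: abs_cont_prod => // q; exact: evol_abs_cont_inv.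
Qed.

Definition upd (c : midx) q i : midx := [ffun q' => if q' == q then i else c q'].

Lemma dtensorE t s x y : dtensor t s x y =
  \sum_i A t x.1 i * tensor t s (i, x.2) y -
  \sum_q \sum_i A t i (x.2 q) * tensor t s (x.1, upd x.2 q i) y.
Proof.
rewrite /dtensor /tensor /=; congr (_ + _).
  by rewrite mxE mulr_suml; apply: eq_bigr => i _; rewrite mulrA.
rewrite mulr_sumr -sumrN; apply: eq_bigr => q _.
rewrite mulNr mulrN; congr (- _).
rewrite mxE mulr_suml mulr_sumr; apply: eq_bigr => i _.
rewrite (bigD1 q (P := xpredT))//= /upd ffunE eqxx.
have -> : \prod_(q' | q' != q) Phi s t (y.2 q') ([ffun q'0 => if q'0 == q then i else x.2 q'0] q') =
   \prod_(q' | q' != q) Phi s t (y.2 q') (x.2 q').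
  by apply: eq_bigr => q' /negbTE q'q; rewrite ffunE q'q.
by ring.
Qed.

(** The infinitesimal action of the linear flow on coefficients is
    h -> B h - (D h) B z on polynomial maps; exchanging the roles of the old and
    the new index in position q is an involution of the index set. *)
Lemma hpoly_transport (B : 'M[R]_p) (C : 'I_p -> midx -> R) (z : 'cV[R]_p) :
  hpoly (fun r c => \sum_i B r i * C i c - \sum_q \sum_i B i (c q) * C r (upd c q i)) z =
  B *m hpoly C z - hslope C z z *m (B *m z).
Proof.
apply/matrixP => r j; rewrite ord1 !mxE.
under eq_bigr do rewrite mulrBl.
rewrite sumrB; congr (_ - _).
  under eq_bigr do rewrite mulr_suml.
  rewrite exchange_big; apply: eq_bigr => i _ /=; rewrite mxE mulr_sumr.
  by apply: eq_bigr => c _; rewrite mulrA.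
have teleE (c : midx) q : tele (fun q => z (c q) 0) (fun q => z (c q) 0) q =
    \prod_(q' | q' != q) z (c q') 0.
  rewrite [RHS]big_mkcond; apply: eq_bigr => q' _.
  by case: ltngtP => [||/val_inj ->]; rewrite ?eqxx// => H; case: eqP => // E; rewrite E ltnn in H.
transitivity (\sum_c C r c * \sum_q (B *m z) (c q) 0 * \prod_(q' | q' != q) z (c q') 0); last first.
  under [RHS]eq_bigr do rewrite mxE mulr_suml.
  rewrite exchange_big; apply: eq_bigr => c _ /=.
  under [RHS]eq_bigr do rewrite -mulrA.
  rewrite -mulr_sumr; congr (_ * _).
  under [RHS]eq_bigr do rewrite mulr_suml.
  rewrite [LHS](partition_big (fun q => c q) xpredT)//=.
  by apply: eq_bigr => i _; apply: eq_bigr => q /eqP <-; rewrite teleE mulrC.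
under eq_bigr do rewrite mulr_suml; rewrite exchange_big /=.
under [RHS]eq_bigr do rewrite mulr_sumr; rewrite [RHS]exchange_big /=.
apply: eq_bigr => q _.
under eq_bigr do rewrite mulr_suml; rewrite pair_bigA /=.
under [RHS]eq_bigr do rewrite mxE mulr_suml mulr_sumr; rewrite [RHS]pair_bigA /=.
pose f (x : midx * 'I_p) := (upd x.1 q x.2, x.1 q).
have updE (c : midx) q' i : upd c q i q' = if q' == q then i else c q' by rewrite ffunE.
have fK : involutive f.
  case=> c i; rewrite /f /= updE eqxx; congr (_, _).
  by apply/ffunP => q'; rewrite !updE; case: eqP => [->|].
rewrite [RHS](reindex_inj (inv_inj fK)) /=; apply: eq_bigr => -[c i] _ /=.
rewrite updE eqxx (bigD1 q (P := xpredT))//=.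
have -> : \prod_(q' | q' != q) z (upd c q i q') 0 = \prod_(q' | q' != q) z (c q') 0.
  by apply: eq_bigr => q' /negbTE H; rewrite updE H.
by ring.
Qed.

End Tensor.

(** * Bounded solutions of the homological equation *)

Lemma Lmeasurable_cover (R : realType) (h : R -> R) :
  (forall m : nat, Lmeasurable `[- m%:R, m%:R] h) -> Lmeasurable setT h.
Proof.
move=> H.
have -> : [set: R] = \bigcup_m `[- m%:R, m%:R]%classic.
  apply/esym; rewrite -subTset => x _; exists (Num.truncn `|x|).+1 => //=.
  by rewrite in_itv /= -ler_norml ltW// truncnS_gt.
have E := @measurable_fun_bigcup _ _ (lebesgueType R) R
  (fun m => `[- m%:R, m%:R]%classic) h (fun m => Lm_itv _).
by apply/E => m; exact: H.
Qed.

Lemma cont_on_all_meas (R : realType) (h : R -> R) :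
  (forall a b, a <= b -> cont_on a b h) -> Lmeasurable setT h.
Proof.
move=> H; apply: Lmeasurable_cover => m.
by apply: cont_on_meas; apply: H; rewrite ge0_cp// ler0n.
Qed.

Lemma powR_sum (R : realType) (m : R) (I : Type) (s : seq I) (f : I -> R) : 0 < m ->
  \prod_(q <- s) m `^ f q = m `^ (\sum_(q <- s) f q).
Proof.
move=> m0; apply/esym; apply: (big_morph (fun x => m `^ x)); last by rewrite powRr0.
by move=> x y; rewrite powRD// (gt_eqF m0) implybT.
Qed.

Section Homological.
Context {R : realType} (p n kap : nat) (blk : 'I_p -> 'I_n).
Notation midx := {ffun 'I_kap -> 'I_p}.
Notation ix := ('I_p * midx)%type.

(** The position q of the monomial belongs to block blk (c q); the type counts
    the positions in each block. *)
Definition has_type (k : {ffun 'I_n -> nat}) (c : midx) :=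
  [forall i, #|[pred q | blk (c q) == i]| == k i].

Lemma has_type_sum k (c : midx) (g : 'I_n -> R) : has_type k c ->
  \sum_q g (blk (c q)) = \sum_i (k i)%:R * g i.
Proof.
move=> /forallP kc; rewrite (partition_big (fun q => blk (c q)) xpredT)//=.
apply: eq_bigr => i _; rewrite -(eqP (kc i)) mulr_natl -sumr_const.
by apply: eq_bigr => q /eqP ->.
Qed.

Context (A : R -> 'M[R]_p) (Phi : R -> R -> 'M[R]_p) (mu psi : R -> R).
Hypothesis HA : loc_integrable A.
Hypothesis HPhi : evolution A Phi.
Hypothesis hmu : differentiable_growth_rate mu.
Hypothesis hpsi : uniformly_admissible mu psi.
Context (low : bool) (j : 'I_n) (k : {ffun 'I_n -> nat}) (K g delta : R) (gi : 'I_n -> R).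
Hypothesis Phi_diag : forall t s r r', blk r != blk r' -> Phi t s r r' = 0.
Hypothesis K0 : 0 <= K.
Hypothesis d0 : 0 < delta.
Hypothesis Hj : forall t s r r', ray low t s -> blk r = j -> blk r' = j ->
  `|Phi t s r r'| <= K * (mu t / mu s) `^ g.
Hypothesis Hi : forall t s r r', ray low t s -> blk r = blk r' ->
  `|Phi s t r r'| <= K * (mu s / mu t) `^ gi (blk r).
Hypothesis gap : g - \sum_i (k i)%:R * gi i = raysg low * delta.
Context (a : R -> ix -> R).
Hypothesis a_meas : forall x, Lmeasurable setT (a^~ x).
Hypothesis a_le : forall s x, `|a s x| <= psi s.
Hypothesis a_type : forall s x, a s x != 0 -> blk x.1 = j /\ has_type k x.2.

Notation T := (@tensor R p kap Phi).

Let w t s : 0 < mu t / mu s.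
Proof. exact: ratio_gt0 (mu_gt0 hmu) _ _. Qed.

(** By block diagonality only entries within blocks contribute, and the
    exponents add up to g - sum_i k_i g_i. *)
Lemma tensor_le t s (x y : ix) : ray low t s -> blk y.1 = j -> has_type k y.2 ->
  `|T t s x y| <= K ^+ kap.+1 * (mu t / mu s) `^ (raysg low * delta).
Proof.
move=> ts yj yk; rewrite /tensor normrM normr_prod -gap exprS.
set S := \sum_i _.
have -> : K * K ^+ kap * (mu t / mu s) `^ (g - S) =
    (K * (mu t / mu s) `^ g) * (K ^+ kap * (mu t / mu s) `^ - S).
  by rewrite powRD ?(gt_eqF (w t s)) ?implybT//; ring.
rewrite ler_pM ?prodr_ge0// {}/S.
  case: (eqVneq (blk x.1) j) => [xj|xj]; first exact: Hj.
  by rewrite Phi_diag ?yj// normr0 mulr_ge0 ?powR_ge0.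
rewrite -(has_type_sum gi yk) -(ratio_inv (mu_gt0 hmu)) -powR_sum ?w//.
have -> : K ^+ kap = \prod_(q < kap) K by rewrite prodr_const card_ord.
rewrite -big_split /=.
apply: ler_prod => q _; rewrite normr_ge0 /=.
case: (eqVneq (blk (y.2 q)) (blk (x.2 q))) => [yx|yx]; first exact: Hi.
by rewrite Phi_diag// normr0 mulr_ge0 ?powR_ge0.
Qed.

Lemma tensor_meas t x y : Lmeasurable setT (fun s => T t s x y).
Proof.
have mPhi r r' : Lmeasurable setT (fun s => Phi t s r r').
  by apply: cont_on_all_meas => u v uv; exact: evol_con_inv.
have mPhi' r r' : Lmeasurable setT (fun s => Phi s t r r').
  by apply: cont_on_all_meas => u v uv; exact: evol_con.
apply: measurable_funM; first exact: mPhi.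
apply: (@class_prod R R (Lmeasurable setT)) => [c|f h mf mh|q _]; last exact: mPhi'.
- exact: measurable_cst.
- exact: measurable_funM.
Qed.

Let K' := K ^+ kap.+1.

Lemma tensor_source_le t s x y : ray low t s ->
  `|T t s x y * a s y| <= K' * (psi s * (mu t / mu s) `^ (raysg low * delta)).
Proof.
move=> ts; have K'0 : 0 <= K' by rewrite exprn_ge0.
have [->|a0] := eqVneq (a s y) 0.
  by rewrite mulr0 normr0 mulr_ge0// mulr_ge0 ?powR_ge0// (psi_ge0 hpsi).
have [yj yk] := a_type a0.
by rewrite normrM mulrC mulrCA ler_pM// tensor_le.
Qed.

Lemma tensor_source_int t x y : Lintegrable (ray low t) (fun s => T t s x y * a s y).
Proof.
have [S HS] := ray_weight hmu hpsi low d0.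
apply: (@Lint_dom _ _ _ (fun s => K' * (psi s * (mu t / mu s) `^ (raysg low * delta)))).
- exact: mray.
- apply: (LmeasurableS (E := setT)) => //.
  by apply: measurable_funM; [exact: tensor_meas|exact: a_meas].
- by move=> s ts; exact: tensor_source_le.
- by apply: LintZ; [exact: mray|exact: (HS t).1].
Qed.

Notation C := (green low T a).

Lemma green_bounded : exists B, forall t x, `|C t x| <= B.
Proof.
have [S HS] := ray_weight hmu hpsi low d0.
exists (#|{: ix}|%:R * (K' * S)) => t x.
have Tc := @tensor_cocycle _ p kap A Phi HA HPhi.
rewrite (greenE Tc tensor_source_int) normrM.
have -> : `|raysg low : R| = 1 by rewrite /raysg; case: low; rewrite ?normrN normr1.
rewrite mul1r (le_trans (ler_norm_sum _ _ _))//.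
apply: sum_le_const => y.
apply: (le_trans (le_normr_Rintegral (mray low t) (tensor_source_int t x y))).
apply: (@le_trans _ _ (\int[leb]_(s in ray low t) (K' * (psi s * (mu t / mu s) `^ (raysg low * delta))))).
  apply: le_Rintegral => /=; first exact: mray.
  - by apply: Lint_abs; [exact: mray|exact: tensor_source_int].
  - by apply: LintZ; [exact: mray|exact: (HS t).1].
  - by move=> s ts; exact: tensor_source_le.
rewrite RintegralZl; [|exact: mray|exact: (HS t).1].
by rewrite ler_wpM2l ?exprn_ge0//; exact: (HS t).2.
Qed.

Lemma homological_solution :
  exists (C Cd : R -> 'I_p -> midx -> R) (B : R),
    [/\ forall t, bounded_coef B (C t),
        forall t0 t1 r c, t0 <= t1 -> abs_cont t0 t1 (fun t => C t r c) (fun t => Cd t r c) &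
        forall t z, hpoly (Cd t) z =
          A t *m hpoly (C t) z - hslope (C t) z z *m (A t *m z) -
          hpoly (fun r c => a t (r, c)) z].
Proof.
have [B HB] := green_bounded.
have Tc := @tensor_cocycle _ p kap A Phi HA HPhi.
have Ti := @tensor_id _ p kap A Phi HPhi.
pose dC t x := \sum_y dtensor A Phi t 0 x y * gpot low T a t y.
exists (fun t r c => C t (r, c)), (fun t r c => dC t (r, c) - a t (r, c)), B; split.
- by move=> t r c; exact: HB.
- move=> t0 t1 r c t01; 
  apply: (@green_abs_cont _ _ low T a Tc Ti tensor_source_int t0 t1
    (fun t => dtensor A Phi t 0) (r, c) t01) => y.
  exact: tensor_abs_cont.
move=> t z; rewrite -hpoly_transport.
rewrite /hpoly; apply/matrixP => r i; rewrite ord1 !mxE -sumrB.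
apply: eq_bigr => c _; rewrite -mulrBl; congr ((_ - _) * _).
rewrite /dC; under eq_bigr do rewrite dtensorE mulrBl mulr_suml.
rewrite sumrB /=; congr (_ - _).
  rewrite exchange_big; apply: eq_bigr => i' _ /=.
  by rewrite /green mulr_sumr; apply: eq_bigr => y _; rewrite mulrA.
under eq_bigr do rewrite mulr_suml.
rewrite exchange_big; apply: eq_bigr => q _ /=.
under eq_bigr do rewrite mulr_suml.
rewrite exchange_big; apply: eq_bigr => i' _ /=.
by rewrite /green mulr_sumr; apply: eq_bigr => y _; rewrite mulrA.
Qed.

End Homological.

(** * Nonresonance in block diagonal systems *)

Section BlockSystem.
Context {R : realType} (mu : R -> R) (n : nat) (d_ : 'I_n -> nat).
Notation p := (\sum_i d_ i)%N.
Context (A : R -> 'M[R]_p) (A_ : forall i : 'I_n, R -> 'M[R]_(d_ i)) (Phi : R -> R -> 'M[R]_p).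
Notation blk := (@tagnat.sig1 n d_).
Hypothesis hdiag : forall t, A t = \mxdiag_i A_ i t.
Hypothesis HA : loc_integrable A.
Hypothesis HPhi : evolution A Phi.

Lemma A_offdiag t r r' : blk r != blk r' -> A t r r' = 0.
Proof. by move=> rr'; rewrite hdiag !mxE (negbTE rr') mxE. Qed.

Lemma A_diag t i x y : A t (tagnat.Rank i x) (tagnat.Rank i y) = A_ i t x y.
Proof. by rewrite -(submxblock_diag (fun i => A_ i t) i) [RHS]mxE hdiag. Qed.

(** The components of a column outside its own block solve a homogeneous
    equation with zero initial value. *)
Lemma evol_offdiag t s r r' : blk r != blk r' -> Phi t s r r' = 0.
Proof.
move=> rr'.
pose x t := \col_c (if blk c == blk r' then 0 else Phi t s c r') : 'cV[R]_p.
have := evol_unique HA HPhi (x := x) _ t s.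
have -> : x s = 0.
  apply/matrixP => c i; rewrite !mxE (evol_id HPhi) mxE.
  by case: eqVneq => // cr; case: eqVneq => // E; rewrite E eqxx in cr.
rewrite mulmx0 => /(_ _)/matrixP/(_ r 0); rewrite !mxE (negbTE rr'); apply.
move=> a b ab c; case: (eqVneq (blk c) (blk r')) => cr.
  apply: abs_cont_eq (abs_cont_cst a b 0) => u _; first by rewrite mxE cr eqxx.
  rewrite mxE big1// => i _; rewrite mxE; case: (eqVneq (blk i) (blk r')) => ir.
    by rewrite mulr0.
  by rewrite A_offdiag ?mul0r// cr eq_sym.
have H := evol_abs_cont HPhi s ab c r'.
apply: abs_cont_eq H => u _; first by rewrite mxE (negbTE cr).
rewrite !mxE; apply: eq_bigr => i _; rewrite mxE; case: (eqVneq (blk i) (blk r')) => // ir.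
by rewrite A_offdiag ?mul0r// ir.
Qed.

Let Phi_ i t s := submxblock (Phi t s) i i.

Lemma sum_block (i : 'I_n) (f : 'I_p -> R) : (forall r, blk r != i -> f r = 0) ->
  \sum_r f r = \sum_x f (tagnat.Rank i x).
Proof.
move=> f0; have inj : injective (@tagnat.Rank n d_ i).
  by move=> x y /(congr1 val)/eqP; rewrite tagnat.eq_Rank eqxx => /eqP/val_inj.
transitivity (\sum_(x in finset.setTfor 'I_(d_ i)) f (tagnat.Rank i x)); last first.
  by apply: eq_bigl => x; rewrite finset.in_setT.
rewrite -(big_imset (h := tagnat.Rank i) f) /=; last by move=> x y _ _; exact: inj.
rewrite [RHS]big_mkcond; apply: eq_bigr => r _; case: ifPn => // /negP rI.
apply: f0; apply/eqP => ri; apply: rI; apply/finset.imsetP; subst i.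
by exists (tagnat.sig2 r); rewrite ?finset.in_setT ?tagnat.sig2K.
Qed.

Lemma block_evolution i : evolution (A_ i) (Phi_ i).
Proof.
move=> s; split.
  apply/matrixP => x y; rewrite mxE (evol_id HPhi) !mxE.
  by rewrite -val_eqE /= tagnat.eq_Rank eqxx.
move=> v; apply: abs_cont_solution => a b _ _ ab c.
have H := abs_cont_sum (fun y => v y 0) ab
  (fun y => evol_abs_cont HPhi s ab (tagnat.Rank i c) (tagnat.Rank i y)).
apply: abs_cont_eq H => t _.
  by rewrite mxE; apply: eq_bigr => y _; rewrite mxE mulrC.
rewrite mulmxA !mxE; apply: eq_bigr => y _; rewrite mulrC; congr (_ * _).
rewrite !mxE (@sum_block i); last first.
  by move=> r ri; rewrite A_offdiag ?mul0r// tagnat.Rank1K eq_sym.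
apply: eq_bigr => x _; congr (_ * _); last by rewrite mxE.
exact: A_diag.
Qed.

Lemma block_loc_integrable i : loc_integrable (A_ i).
Proof.
move=> a b x y; have := HA a b (tagnat.Rank i x) (tagnat.Rank i y).
apply: Lint_eq => [|t _]; first exact: Lm_itv.
exact: A_diag.
Qed.

Lemma block_entry i r r' : blk r = i -> blk r' = i ->
  forall t s, `|Phi t s r r'| <= `|Phi_ i t s|.
Proof.
move=> ri r'i t s; subst i.
have [y ->] : exists y, r' = tagnat.Rank (blk r) y.
  by rewrite -r'i; exists (tagnat.sig2 r'); rewrite tagnat.sig2K.
rewrite -{1}(tagnat.sig2K r).
have -> : Phi t s (tagnat.Rank (blk r) (tagnat.sig2 r)) (tagnat.Rank (blk r) y) =
  Phi_ (blk r) t s (tagnat.sig2 r) y by rewrite mxE.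
exact: normrM_ge.
Qed.

Hypothesis hmu : differentiable_growth_rate mu.
Hypothesis Hbg : exists K a : R, [/\ 1 <= K, 0 <= a &
    forall t s, `|Phi t s| <= K * (mu t / mu s) `^ (Num.sg (t - s) * a)].
Context (lambda : 'I_n -> R * R).
Hypothesis hspec_i : forall i, dichotomy_spectrum mu (A_ i) = cint (lambda i).

Lemma block_growth i : exists K a : R, [/\ 1 <= K, 0 <= a &
    forall t s, `|Phi_ i t s| <= K * (mu t / mu s) `^ (Num.sg (t - s) * a)].
Proof.
have [K [a [K1 a0 HK]]] := Hbg; exists K, a; split=> // t s.
apply: le_trans (HK t s); apply: normrM_le => // x y; rewrite mxE; exact: normrM_ge.
Qed.

Lemma block_upper i g : (lambda i).2 < g -> exists K, forall s t, s <= t ->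
  `|Phi_ i t s| <= K * (mu t / mu s) `^ g.
Proof.
move=> Hg.
have H g' : (lambda i).2 < g' -> ~ dichotomy_spectrum mu (A_ i) g'.
  move=> Hg'; by rewrite hspec_i /cint /= in_itv /= => /andP[_]; rewrite leNgt Hg'.
exact: (upper_rate hmu (block_loc_integrable (i:=i)) (block_evolution i) (block_growth i) H Hg).
Qed.

Lemma block_lower i g : g < (lambda i).1 -> exists K, forall s t, t <= s ->
  `|Phi_ i t s| <= K * (mu t / mu s) `^ g.
Proof.
move=> Hg.
have H g' : g' < (lambda i).1 -> ~ dichotomy_spectrum mu (A_ i) g'.
  move=> Hg'; by rewrite hspec_i /cint /= in_itv /= => /andP[+ _]; rewrite leNgt Hg'.
exact: (lower_rate hmu (block_loc_integrable (i:=i)) (block_evolution i) (block_growth i) H Hg).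
Qed.

Context (psi : R -> R) (j : 'I_n) (k : {ffun 'I_n -> nat}).
Hypothesis hpsi : uniformly_admissible mu psi.
Hypothesis lam_le : forall i, (lambda i).1 <= (lambda i).2.
Hypothesis hres : cint (lambda j) `&` cint (\sum_i lambda i *+ k i) = set0.
Notation midx := {ffun 'I_(mdeg k) -> 'I_p}.
Notation ix := ('I_p * midx)%type.

(** Interval arithmetic acts separately on the two endpoints. *)
Lemma sum_endpoints : \sum_i lambda i *+ k i =
  (\sum_i (k i)%:R * (lambda i).1, \sum_i (k i)%:R * (lambda i).2).
Proof.
have fstn (x : R * R) m : x *+ m = (m%:R * x.1, m%:R * x.2).
  elim: m => [|m IH]; first by rewrite mulr0n !mul0r.
  rewrite mulrS IH -natr1 !mulrDl !mul1r [RHS]surjective_pairing /=.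
  by rewrite addrC.
apply: (big_ind3 (fun x y z => x = (y, z))) => //.
  by move=> x y z x' y' z' -> ->.
Qed.

(** Two disjoint compact intervals are separated. *)
Lemma resonance_cases : (lambda j).2 < \sum_i (k i)%:R * (lambda i).1 \/
  \sum_i (k i)%:R * (lambda i).2 < (lambda j).1.
Proof.
case: (ltP (lambda j).2 (\sum_i (k i)%:R * (lambda i).1)) => h1; first by left.
case: (ltP (\sum_i (k i)%:R * (lambda i).2) (lambda j).1) => h2; first by right.
have le12 : \sum_i (k i)%:R * (lambda i).1 <= \sum_i (k i)%:R * (lambda i).2.
  by apply: ler_sum => i _; rewrite ler_wpM2l.
move: hres; rewrite sum_endpoints => /seteqP[/(_ (Num.max (lambda j).1 (\sum_i (k i)%:R * (lambda i).1))) H _].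
exfalso; apply: H; split; rewrite /cint /= in_itv /= le_max lexx ?orbT /= ge_max.
  by rewrite lam_le.
by rewrite h2.
Qed.

(** The gap between the intervals, shared out among the 1 + |k| factors of the
    tensor, leaves half of it as the decay exponent.  The past is used if block j
    lies below the combination, the future if it lies above. *)
Lemma homological_block (a : R -> ix -> R) :
  (forall x, Lmeasurable setT (a^~ x)) -> (forall s x, `|a s x| <= psi s) ->
  (forall s x, a s x != 0 -> blk x.1 = j /\ has_type blk k x.2) ->
  exists (C Cd : R -> 'I_p -> midx -> R) (B : R),
    [/\ forall t, bounded_coef B (C t),
        forall t0 t1 r c, t0 <= t1 -> abs_cont t0 t1 (fun t => C t r c) (fun t => Cd t r c) &
        forall t z, hpoly (Cd t) z =
          A t *m hpoly (C t) z - hslope (C t) z z *m (A t *m z) -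
          hpoly (fun r c => a t (r, c)) z].
Proof.
move=> a_meas a_le a_type.
suff [low [g [gi [K [delta [K0 d0 Hj Hi gap]]]]]] : exists low g gi K delta,
  [/\ 0 <= K, 0 < delta,
    forall t s, ray low t s -> `|Phi_ j t s| <= K * (mu t / mu s) `^ g,
    forall i t s, ray low t s -> `|Phi_ i s t| <= K * (mu s / mu t) `^ gi i &
    g - \sum_i (k i)%:R * gi i = raysg low * delta].
  apply: (homological_solution HA HPhi hmu hpsi evol_offdiag K0 d0 _ _ gap a_meas a_le a_type).
    by move=> t s r r' ts rj r'j; rewrite (le_trans (block_entry rj r'j _ _))// Hj.
  by move=> t s r r' ts rr'; rewrite (le_trans (block_entry erefl (esym rr') _ _))// Hi.
(* one constant for the finitely many rates *)
have combine low g gi : (exists K, forall t s, ray low t s -> `|Phi_ j t s| <= K * (mu t / mu s) `^ g) ->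
    (forall i, exists K, forall t s, ray low t s -> `|Phi_ i s t| <= K * (mu s / mu t) `^ gi i) ->
    exists K, [/\ 0 <= K,
      forall t s, ray low t s -> `|Phi_ j t s| <= K * (mu t / mu s) `^ g &
      forall i t s, ray low t s -> `|Phi_ i s t| <= K * (mu s / mu t) `^ gi i].
  move=> [K1 H1] /choice[K2 H2]; exists (`|K1| + \sum_i `|K2 i|).
  have s0 : 0 <= \sum_i `|K2 i| by apply: sumr_ge0.
  split; first by rewrite addr_ge0.
    move=> t s ts; rewrite (le_trans (H1 _ _ ts))// ler_wpM2r ?powR_ge0//.
    by rewrite (le_trans (ler_norm _))// lerDl.
  move=> i t s ts; rewrite (le_trans (H2 i _ _ ts))// ler_wpM2r ?powR_ge0//.
  rewrite (le_trans (ler_norm _))// (bigD1 i)//= addrCA lerDl addr_ge0// sumr_ge0//.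
have kap0 : 0 < (1 + mdeg k)%:R * 2 :> R by rewrite mulr_gt0// ltr0n.
have sumk (x : 'I_n -> R) eta : \sum_i (k i)%:R * (x i + eta) = \sum_i (k i)%:R * x i + (mdeg k)%:R * eta.
  under eq_bigr do rewrite mulrDr; rewrite big_split /= -mulr_suml; congr (_ + _ * _).
  by rewrite /mdeg natr_sum.
have gapE (x y : R) : x - (mdeg k)%:R * y + - (y + x) = - ((1 + mdeg k)%:R * y).
  by rewrite natrD; ring.
case: resonance_cases; rewrite -subr_gt0; set D := _ - _ => D0.
  (* the loss of exponent allowed to each of the 1 + |k| factors *)
  pose eta := D / ((1 + mdeg k)%:R * 2).
  have e0 : 0 < eta by rewrite divr_gt0.
  have [||K [K0 H1 H2]] := @combine true ((lambda j).2 + eta) (fun i => (lambda i).1 + - eta).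
  - have [|K HK] := @block_upper j ((lambda j).2 + eta); first by rewrite ltrDl.
    by exists K => t s; rewrite /ray /= in_itv /= => st; exact: HK.
  - move=> i; have [|K HK] := @block_lower i ((lambda i).1 + - eta).
      by rewrite -subr_gt0 opprD opprK addrA subrr add0r.
    by exists K => t s; rewrite /ray /= in_itv /= => st; exact: HK.
  exists true, ((lambda j).2 + eta), (fun i => (lambda i).1 + - eta), K, (D / 2); split=> //.
    by rewrite divr_gt0.
  rewrite sumk /raysg /D.
  have : (1 + mdeg k)%:R * eta = D / 2 by rewrite /eta; field; rewrite addrC natr1 pnatr_eq0.
  by rewrite natrD /D; set S := \sum_i _; set m := (mdeg k)%:R; lra.
pose eta := D / ((1 + mdeg k)%:R * 2).
have e0 : 0 < eta by rewrite divr_gt0.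
have [||K [K0 H1 H2]] := @combine false ((lambda j).1 + - eta) (fun i => (lambda i).2 + eta).
- have [|K HK] := @block_lower j ((lambda j).1 + - eta).
    by rewrite -subr_gt0 opprD opprK addrA subrr add0r.
  by exists K => t s; rewrite /ray /= in_itv /= andbT => st; exact: HK.
- move=> i; have [|K HK] := @block_upper i ((lambda i).2 + eta); first by rewrite ltrDl.
  by exists K => t s; rewrite /ray /= in_itv /= andbT => st; exact: HK.
exists false, ((lambda j).1 + - eta), (fun i => (lambda i).2 + eta), K, (D / 2); split=> //.
  by rewrite divr_gt0.
rewrite sumk /raysg /D.
have : (1 + mdeg k)%:R * eta = D / 2 by rewrite /eta; field; rewrite addrC natr1 pnatr_eq0.
by rewrite natrD /D; set S := \sum_i _; set m := (mdeg k)%:R; lra.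
Qed.

End BlockSystem.

(** * The transformed system and its solutions *)

Section Diffeo.
Context {R : realType} (p : nat).
Notation V := 'cV[R]_p.

(** The image of an open set under a bijection is its preimage under the
    continuous inverse. *)
Lemma Cn_diffeo_cancel l (f g : V -> V) (U : set V) : open U ->
  Cn l setT f -> Cn l setT g -> continuous g -> cancel f g -> cancel g f ->
  Cn_diffeo l U f.
Proof.
move=> oU [f1 f2] [g1 g2] cg fK gK.
have imE : f @` U = g @^-1` U.
  by apply/seteqP; split => [x [y Uy <-]|x Ux]; [rewrite /preimage /= fK|exists (g x)].
split.
- by split=> [x _|vs svs x _]; [exact: f1|exact: f2].
- by rewrite imE; apply: open_comp => // x _; exact: cg.
- exists g; last by move=> x _; rewrite fK.
  by split=> [x _|vs svs x _]; [exact: g1|exact: g2].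
Qed.

End Diffeo.

Section NormalForm.
Context {R : realType} (p kap M : nat) (ep B : R).
Notation V := 'cV[R]_p.
Notation midx := {ffun 'I_kap -> 'I_p}.
Notation coef := ('I_p -> midx -> R).
Hypothesis ep_gt0 : 0 < ep.
Hypothesis M_even : ~~ odd M.
Hypothesis M_gt1 : (1 < M)%N.
Hypothesis kap_gt1 : (1 < kap)%N.
Hypothesis ep_small :
  p%:R * (#|{: midx}|%:R * (B * (kap%:R * (ep ^+ kap.-1 * M%:R)))) <= 2^-1.
Context (A : R -> 'M[R]_p) (F : R -> V -> V) (C Cd : R -> coef).
Hypothesis HB : forall t, bounded_coef B (C t).
Hypothesis HC : forall t0 t1 r c, t0 <= t1 ->
  abs_cont t0 t1 (fun t => C t r c) (fun t => Cd t r c).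
Hypothesis F0 : forall t, F t 0 = 0.

Notation down t := (shear M ep (C t)).
Notation up t := (unshear ep_gt0 M_even M_gt1 ep_small (C t)).
Notation J0 t y := (jac M ep (C t) y y).

(** Differentiating x = shear (C t) y in time and solving for y'. *)
Definition nform t (y : V) : V :=
  invmx (J0 t y) *m (A t *m down t y + F t (down t y) + hpoly (Cd t) (satv M ep y))
  - A t *m y.

Lemma jac_nform t y : J0 t y *m (A t *m y + nform t y) =
  A t *m down t y + F t (down t y) + hpoly (Cd t) (satv M ep y).
Proof.
have -> : A t *m y + nform t y = invmx (J0 t y) *m (A t *m down t y +
    F t (down t y) + hpoly (Cd t) (satv M ep y)).
  by rewrite /nform addrC subrK.
by rewrite mulKVmx// (jac_unit ep_gt0 M_even M_gt1 ep_small).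
Qed.

Lemma nform0 t : nform t 0 = 0.
Proof.
rewrite /nform (shear0 M ep kap_gt1) satv0 F0 (hpoly0 kap_gt1).
by rewrite !mulmx0 !addr0 mulmx0 subr0.
Qed.

Lemma diag_cont_jac a b (y : R -> V) : a <= b -> (forall i, cont_on a b (fun t => y t i 0)) ->
  forall r i, diag_cont a b (fun s t => jac M ep (C t) (y t) (y s) r i).
Proof.
move=> ab cy.
apply: (@class_jac R (R * R) (fun f => diag_cont a b (fun s t => f (s, t))) _ _ _ _ p kap M ep M_even
  (fun x => C x.2) (fun x => y x.2) (fun x => y x.1)).
- exact: diag_cont_cst.
- by move=> f g; exact: diag_contD.
- by move=> f g; exact: diag_contM.
- move=> f f1; apply: diag_contV => r _; rewrite gt_eqF// (lt_le_trans ltr01)//.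
- by move=> r c; apply: diag_cont_swap; exact: abs_cont_con (HC r c ab).
- by move=> i; apply: diag_cont_swap; exact: cy.
- by move=> i; exact: cy.
Qed.

Lemma diag_cont_mono a b (y : R -> V) (c : midx) : (forall i, cont_on a b (fun t => y t i 0)) ->
  diag_cont a b (fun s t => \prod_q satv M ep (y s) (c q) 0).
Proof.
move=> cy; apply: diag_cont_prod => q _.
under [X in diag_cont _ _ X]eq_fun do under eq_fun do rewrite mxE.
apply: (@class_sat R (R * R) (fun f => diag_cont a b (fun s t => f (s, t))) _ _ _ _ M ep M_even
  (fun x => y x.1 (c q) 0)).
- exact: diag_cont_cst.
- by move=> f g; exact: diag_contD.
- by move=> f g; exact: diag_contM.
- move=> f f1; apply: diag_contV => r _; rewrite gt_eqF// (lt_le_trans ltr01)//.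
- exact: cy.
Qed.

Lemma shear_increment s t (y y' : V) r :
  (down t y' - down s y) r 0 = (jac M ep (C t) y' y *m (y' - y)) r 0 -
    \sum_c (C t r c - C s r c) * \prod_q satv M ep y (c q) 0.
Proof.
rewrite -(shear_slope ep_gt0 M_even M_gt1).
have -> : down t y' - down s y = (down t y' - down t y) - (hpoly (C t) (satv M ep y) - hpoly (C s) (satv M ep y)).
  by rewrite /shear /sat_hpoly; apply/matrixP => i k; rewrite !mxE; ring.
rewrite mxE; congr (_ + _); rewrite !mxE -sumrB; congr (- _).
by apply: eq_bigr => c _; rewrite mulrBl.
Qed.

Lemma solution_shear (J : set R) (y : R -> V) : is_interval J ->
  solution (fun t x => A t *m x + nform t x) J y ->
  solution (fun t x => A t *m x + F t x) J (fun t => down t (y t)).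
Proof.
move=> iJ sol; apply: abs_cont_solution => a b Ja Jb ab r.
have Jab t : a <= t <= b -> J t by move=> tab; exact: (iJ _ _ Ja Jb).
have Hy := solution_abs_cont ab Jab sol.
have cy i : cont_on a b (fun t => y t i 0) by exact: abs_cont_con (Hy i).
pose u (k : 'I_p + midx) t := match k with inl i => y t i 0 | inr c => C t r c end.
pose f (k : 'I_p + midx) t :=
  match k with inl i => (A t *m y t + nform t (y t)) i 0 | inr c => Cd t r c end.
pose g (k : 'I_p + midx) s t :=
  match k with inl i => jac M ep (C t) (y t) (y s) r i
             | inr c => - \prod_q satv M ep (y s) (c q) 0 end.
have Hu k : abs_cont a b (u k) (f k) by case: k => [i|c]; [exact: Hy|exact: HC].
have Hg k : diag_cont a b (g k).
  by case: k => [i|c]; [exact: diag_cont_jac|apply: diag_contN; exact: diag_cont_mono].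
apply: abs_cont_eq (abs_cont_chain ab Hu Hg (z := fun t => down t (y t) r 0) _) => //.
- move=> t _; rewrite big_sumType /=.
  transitivity ((J0 t (y t) *m (A t *m y t + nform t (y t)) - hpoly (Cd t) (satv M ep (y t))) r 0).
    rewrite !mxE -sumrN; congr (_ + _).
    by apply: eq_bigr => c _; rewrite mulrC mulrN.
  by rewrite jac_nform addrK.
- move=> s t _ _ _; rewrite big_sumType /=.
  have -> : down t (y t) r 0 - down s (y s) r 0 = (down t (y t) - down s (y s)) r 0.
    by rewrite [RHS]mxE; congr (_ + _); rewrite [RHS]mxE.
  rewrite shear_increment mxE -sumrN; congr (_ + _).
    by apply: eq_bigr => i _; congr (_ * _); rewrite [LHS]mxE; congr (_ + _); rewrite [LHS]mxE.
  by apply: eq_bigr => c _; rewrite mulNr mulrC.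
Qed.

Lemma cont_on_le a b (I : finType) (K : R) (u : I -> R -> R) h : 0 <= K ->
  (forall i, cont_on a b (u i)) ->
  (forall s t, `|h t - h s| <= K * \sum_i `|u i t - u i s|) -> cont_on a b h.
Proof.
move=> K0 cu hu; apply/diag_contP => r rab e e0.
pose e' := e / (K * #|I|%:R + 1).
have d0 : 0 < K * #|I|%:R + 1 by rewrite ltr_wpDl ?mulr_ge0.
have e'0 : 0 < e' by rewrite divr_gt0.
have /choice[dl Hdl] : forall i, exists dl : R, 0 < dl /\ forall x, a <= x <= b -> `|x - r| < dl -> `|u i x - u i r| <= e'.
  move=> i; have /diag_contP/(_ _ rab _ e'0)[dl dl0 H] := cu i.
  by exists dl; split=> // x xab xr; apply: (H x x).
exists (\big[Num.min/1]_i dl i).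
  by apply: (big_ind (fun x => 0 < x)) => // [x y x0 y0|i _]; [rewrite lt_min x0|exact: (Hdl i).1].
move=> x y xab yab xr yr; rewrite (le_trans (hu r x))//.
apply: (@le_trans _ _ (K * (#|I|%:R * e'))).
  rewrite ler_wpM2l//; apply: sum_le_const => i; apply: (Hdl i).2 => //.
  by apply: (lt_le_trans xr); rewrite (bigD1 i)//= ge_min lexx.
have -> : K * (#|I|%:R * e') = e * (K * #|I|%:R / (K * #|I|%:R + 1)) by rewrite /e'; ring.
by rewrite ler_piMr ?(ltW e0)// ler_pdivrMr// mul1r lerDl.
Qed.

(** Solving the increment for that of y gives slopes with respect to x and C;
    their diagonal continuity needs the continuity of y, which comes from the
    Lipschitz bound of the inverse. *)
Lemma solution_unshear (J : set R) (x : R -> V) : is_interval J ->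
  solution (fun t x => A t *m x + F t x) J x ->
  solution (fun t x => A t *m x + nform t x) J (fun t => up t (x t)).
Proof.
move=> iJ sol; apply: abs_cont_solution => a b Ja Jb ab r.
have Jab t : a <= t <= b -> J t by move=> tab; exact: (iJ _ _ Ja Jb).
have Hx := solution_abs_cont ab Jab sol.
pose y t := up t (x t).
have yK t : down t (y t) = x t by rewrite unshearK//; exact: HB.
pose dx s t i := x t i 0 - x s i 0 +
  \sum_c (C t i c - C s i c) * \prod_q satv M ep (y s) (c q) 0.
have Dy s t : jac M ep (C t) (y t) (y s) *m (y t - y s) = \col_i dx s t i.
  apply/matrixP => i k; rewrite ord1 [RHS]mxE /dx.
  have := shear_increment s t (y s) (y t) i; rewrite !yK => /esym/eqP.
  by rewrite subr_eq => /eqP ->; congr (_ + _); rewrite mxE; congr (_ + _); rewrite mxE.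
have cy i : cont_on a b (fun t => y t i 0).
  pose I := ('I_p + ('I_p * midx))%type.
  pose u (k : I) t := match k with inl i => x t i 0 | inr h => C t h.1 h.2 end.
  apply: (@cont_on_le a b I (2 * (1 + ep ^+ kap)) u).
  - by rewrite mulr_ge0// addr_ge0// exprn_ge0// ltW.
  - by case=> [i'|[i' c]]; [exact: abs_cont_con (Hx i')|exact: abs_cont_con (HC i' c ab)].
  move=> s t.
  have -> : y t i 0 - y s i 0 = (y t - y s) i 0 by rewrite [RHS]mxE; congr (_ + _); rewrite [RHS]mxE.
  rewrite (le_trans (normrV_ge _ _))//.
  rewrite (le_trans (shear_expand ep_gt0 M_even M_gt1 ep_small _ _ (HB t)))//.
  rewrite -mulrA ler_wpM2l// (shear_slope ep_gt0 M_even M_gt1) Dy.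
  apply: normrM_le => [|i' k'].
    by rewrite mulr_ge0 ?sumr_ge0// addr_ge0// exprn_ge0// ltW.
  rewrite ord1 mxE /dx (le_trans (ler_normD _ _))// big_sumType /= -(pair_bigA _ (fun i c => `|C t i c - C s i c|)) /=.
  rewrite mulrDr lerD//.
    rewrite mulrDl mul1r (bigD1 i')//= -addrA lerDl addr_ge0 ?sumr_ge0// mulr_ge0 ?exprn_ge0 ?(ltW ep_gt0)//.
    by rewrite addr_ge0// sumr_ge0.
  apply: (@le_trans _ _ (ep ^+ kap * \sum_c `|C t i' c - C s i' c|)).
    rewrite mulr_sumr (le_trans (ler_norm_sum _ _ _))//; apply: ler_sum => c _.
    rewrite normrM mulrC ler_wpM2r// normr_prod.
    have -> : ep ^+ kap = \prod_(q < kap) ep by rewrite prodr_const card_ord.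
    by apply: ler_prod => q _; rewrite normr_ge0 mxE sat_le_ep.
  apply: ler_pM; rewrite ?exprn_ge0 ?sumr_ge0 ?(ltW ep_gt0)//.
    by rewrite lerDr.
  rewrite [leRHS](bigD1 i')//= lerDl sumr_ge0// => i'' _; exact: sumr_ge0.
pose Ji s t := invmx (jac M ep (C t) (y t) (y s)).
have cJi i i' : diag_cont a b (fun s t => Ji s t i i').
  apply: (@diag_cont_invmx R a b p (fun s t => jac M ep (C t) (y t) (y s))); last exact: diag_cont_jac.
  by move=> s t; apply: (jac_unit ep_gt0 M_even M_gt1 ep_small); exact: HB.
pose I := ('I_p + ('I_p * midx))%type.
pose u (k : I) t := match k with inl i => x t i 0 | inr h => C t h.1 h.2 end.
pose f (k : I) t := match k with inl i => (A t *m x t + F t (x t)) i 0 | inr h => Cd t h.1 h.2 end.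
pose g (k : I) s t := match k with inl i => Ji s t r i
  | inr h => Ji s t r h.1 * \prod_q satv M ep (y s) (h.2 q) 0 end.
have Hu k : abs_cont a b (u k) (f k) by case: k => [i|[i c]]; [exact: Hx|exact: HC].
have Hg k : diag_cont a b (g k).
  by case: k => [i|[i c]]; [exact: cJi|apply: diag_contM => //; exact: diag_cont_mono].
have gE s t (v : 'I_p -> R) (w : 'I_p -> midx -> R) :
    \sum_(i < p) Ji s t r i * v i + \sum_(k : 'I_p * midx) (Ji s t r k.1 * \prod_q satv M ep (y s) (k.2 q) 0) * w k.1 k.2
    = (Ji s t *m \col_i (v i + \sum_c w i c * \prod_q satv M ep (y s) (c q) 0)) r 0.
  rewrite [RHS]mxE.
  rewrite (eq_bigr (fun k : 'I_p * midx => Ji s t r k.1 * (w k.1 k.2 * \prod_q satv M ep (y s) (k.2 q) 0))); last first.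
    by move=> k' _; ring.
  rewrite -(pair_bigA _ (fun i c => Ji s t r i * (w i c * \prod_q satv M ep (y s) (c q) 0))) /=.
  rewrite -big_split; apply: eq_bigr => i _ /=; rewrite mxE mulrDr; congr (_ + _).
  by rewrite mulr_sumr.
apply: abs_cont_eq (abs_cont_chain ab Hu Hg (z := fun t => y t r 0) _) => //.
- move=> t _; rewrite big_sumType /=.
  have := gE t t (fun i => (A t *m x t + F t (x t)) i 0) (Cd t).
  set S := (X in X = _ -> _) => E.
  change (S = (A t *m y t + nform t (y t)) r 0); rewrite E.
  have -> : \col_i ((A t *m x t + F t (x t)) i 0 + \sum_c Cd t i c * \prod_q satv M ep (y t) (c q) 0)
    = A t *m x t + F t (x t) + hpoly (Cd t) (satv M ep (y t)).
    apply/matrixP => i k; rewrite ord1 [LHS]mxE [RHS]mxE; congr (_ + _); by rewrite [RHS]mxE.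
  by rewrite -(yK t) -jac_nform mulKmx// (jac_unit ep_gt0 M_even M_gt1 ep_small).
- move=> s t _ _ _; rewrite big_sumType /=.
  have := gE s t (fun i => x t i 0 - x s i 0) (fun i c => C t i c - C s i c).
  set S := (X in X = _ -> _) => E.
  change (y t r 0 - y s r 0 = S).
  have uJ : jac M ep (C t) (y t) (y s) \in unitmx.
    by apply: (jac_unit ep_gt0 M_even M_gt1 ep_small); exact: HB.
  rewrite E -/(\col_i dx s t i) -Dy mulKmx// [RHS]mxE; congr (_ + _); by rewrite [RHS]mxE.
Qed.

End NormalForm.

(** * Orders of vanishing at the origin *)

Section Orders.
Context {R : realType} {p : nat}.
Notation V := 'cV[R]_p.
Implicit Types (f g : V -> R).

(** f = O(|y|^m) at the origin. *)
Definition ordge m f := exists2 K : R, 0 <= K &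
  exists2 dl : R, 0 < dl & forall y, `|y| < dl -> `|f y| <= K * `|y| ^+ m.

Lemma ordge_flat m f : ordge m.+1 f -> flat m f.
Proof.
move=> [K K0 [dl dl0 H]] e e0.
exists (Num.min dl (e / (K + 1))).
  by rewrite lt_min dl0 divr_gt0// ltr_wpDl.
move=> y; rewrite lt_min => /andP[y1 y2]; rewrite (le_trans (H y y1))//.
rewrite exprS mulrA ler_wpM2r ?exprn_ge0//.
apply: (@le_trans _ _ ((K + 1) * `|y|)); first by rewrite ler_wpM2r// lerDl.
by rewrite mulrC -ler_pdivlMr ?ltr_wpDl// ltW.
Qed.

Lemma ordge_le m m' f : (m' <= m)%N -> ordge m f -> ordge m' f.
Proof.
move=> mm [K K0 [dl dl0 H]]; exists K => //.
exists (Num.min dl 1); first by rewrite lt_min dl0 ltr01.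
move=> y; rewrite lt_min => /andP[y1 y2]; rewrite (le_trans (H y y1))//.
by rewrite ler_wpM2l// ler_wiXn2l// ltW.
Qed.

Lemma ordge_cont f : continuous f -> ordge 0 f.
Proof.
move=> cf; exists (`|f 0| + 1); first by rewrite addr_ge0.
have /cvgrPdist_le/(_ _ ltr01)/nbhs_ballP[dl /= dl0 H] := cf 0.
exists dl => // y yd; rewrite expr0 mulr1.
have : ball (0 : V) dl y by rewrite -ball_normE /= sub0r normrN.
move=> /H; rewrite distrC -[X in _ -> `|X| <= _](subrK (f 0)) => {}H.
by rewrite (le_trans (ler_normD _ _))// addrC lerD2l.
Qed.

Lemma ordge_mul m m' f g : ordge m f -> ordge m' g -> ordge (m + m') (fun y => f y * g y).
Proof.
move=> [K K0 [dl dl0 H]] [K' K'0 [dl' dl'0 H']]; exists (K * K'); first exact: mulr_ge0.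
exists (Num.min dl dl'); first by rewrite lt_min dl0 dl'0.
move=> y; rewrite lt_min => /andP[y1 y2].
by rewrite normrM exprD mulrACA ler_pM//; [exact: H|exact: H'].
Qed.

Lemma ordge_scale m c f : ordge m f -> ordge m (fun y => c * f y).
Proof.
move=> [K K0 [dl dl0 H]]; exists (`|c| * K); first exact: mulr_ge0.
by exists dl => // y yd; rewrite normrM -mulrA ler_wpM2l// H.
Qed.

Lemma ordge_add m f g : ordge m f -> ordge m g -> ordge m (fun y => f y + g y).
Proof.
move=> [K K0 [dl dl0 H]] [K' K'0 [dl' dl'0 H']]; exists (K + K'); first exact: addr_ge0.
exists (Num.min dl dl'); first by rewrite lt_min dl0 dl'0.
move=> y; rewrite lt_min => /andP[y1 y2].
by rewrite (le_trans (ler_normD _ _))// mulrDl lerD//; [exact: H|exact: H'].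
Qed.

Lemma ordge_sum m (I : Type) (s : seq I) (P : pred I) (f : I -> V -> R) :
  (forall i, ordge m (f i)) -> ordge m (fun y => \sum_(i <- s | P i) f i y).
Proof.
move=> H; elim: s => [|i s IH].
  under eq_fun do rewrite big_nil; exists 0 => //; exists 1 => // y _.
  by rewrite normr0 mul0r.
by under eq_fun do rewrite big_cons; case: (P i) => //; exact: ordge_add.
Qed.

Lemma flat_add m f g : flat m f -> flat m g -> flat m (fun y => f y + g y).
Proof.
move=> Hf Hg e e0; have e2 : 0 < e / 2 by rewrite divr_gt0.
have [dl dl0 H] := Hf _ e2; have [dl' dl'0 H'] := Hg _ e2.
exists (Num.min dl dl'); first by rewrite lt_min dl0 dl'0.
move=> y; rewrite lt_min => /andP[y1 y2].
by rewrite (le_trans (ler_normD _ _))// [e]splitr mulrDl lerD//; [exact: H|exact: H'].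
Qed.

Lemma flat_mul k m m' f g : k = (m + m')%N -> ordge m f -> flat m' g ->
  flat k (fun y => f y * g y).
Proof.
move=> -> [K K0 [dl dl0 H]] Hg e e0.
have [|dl' dl'0 H'] := Hg (e / (K + 1)); first by rewrite divr_gt0// ltr_wpDl.
exists (Num.min dl dl'); first by rewrite lt_min dl0 dl'0.
move=> y; rewrite lt_min => /andP[y1 y2]; rewrite normrM.
apply: (@le_trans _ _ ((K * `|y| ^+ m) * (e / (K + 1) * `|y| ^+ m'))).
  by rewrite ler_pM//; [exact: H|exact: H'].
have -> : (K * `|y| ^+ m) * (e / (K + 1) * `|y| ^+ m') = e * (K / (K + 1)) * `|y| ^+ (m + m').
  by rewrite exprD; ring.
rewrite ler_wpM2r ?exprn_ge0// ler_piMr ?(ltW e0)//.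
by rewrite ler_pdivrMr ?ltr_wpDl// mul1r lerDl.
Qed.

Lemma flat0 m : flat m (fun _ : V => 0).
Proof. by move=> e e0; exists 1 => // y _; rewrite normr0 mulr_ge0 ?exprn_ge0 ?(ltW e0). Qed.

Lemma flat_sum m (I : Type) (s : seq I) (f : I -> V -> R) :
  (forall i, flat m (f i)) -> flat m (fun y => \sum_(i <- s) f i y).
Proof.
move=> H; elim: s => [|i s IH]; first by under eq_fun do rewrite big_nil; exact: flat0.
by under eq_fun do rewrite big_cons; exact: flat_add.
Qed.

Lemma flat_comp2 m f (g : V -> V) : (forall y, `|g y| <= 2 * `|y|) ->
  flat m f -> flat m (fun y => f (g y)).
Proof.
move=> g2 Hf e e0; have [|dl dl0 H] := Hf (e / 2 ^+ m); first by rewrite divr_gt0// exprn_gt0.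
exists (dl / 2) => [|y yd]; first by rewrite divr_gt0.
rewrite (le_trans (H _ _))//.
  by rewrite (le_lt_trans (g2 y))// mulrC -ltr_pdivlMr.
apply: (@le_trans _ _ (e / 2 ^+ m * (2 * `|y|) ^+ m)).
  by rewrite ler_wpM2l ?divr_ge0 ?(ltW e0) ?exprn_ge0// lerXn2r// ?nnegrE// mulr_ge0.
by rewrite exprMn mulrA divfK// expf_neq0.
Qed.

(** Mean value inequality; at a critical point the partial derivatives tend to 0. *)
Lemma small_lip f (g : 'I_p -> V -> R) : (forall x, differentiable f x) ->
  (forall x v, 'd f x v = \sum_i v i 0 * g i x) ->
  (forall i, {for 0, continuous (g i)}) -> (forall i, g i 0 = 0) ->
  forall e, 0 < e -> exists2 dl : R, 0 < dl & forall x y, `|x| < dl -> `|y| < dl ->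
    `|f x - f y| <= e * `|x - y|.
Proof.
move=> df fd cf d0 e e0; pose e' := e / (p%:R + 1).
have p1 : 0 < p%:R + 1 :> R by rewrite ltr_wpDl.
have e'0 : 0 < e' by rewrite divr_gt0.
have /choice[dl Hdl] : forall i, exists dl : R, 0 < dl /\ forall x, `|x| < dl -> `|g i x| <= e'.
  move=> i; have /cvgrPdist_le/(_ _ e'0)/nbhs_ballP[dl /= dl0 H] := cf i.
  exists dl; split=> // x xd; have /H : ball (0 : V) dl x by rewrite -ball_normE /= sub0r normrN.
  by rewrite d0 sub0r normrN.
exists (\big[Num.min/1]_i dl i).
  by apply: (big_ind (fun x => 0 < x)) => // [x y x0 y0|i _]; [rewrite lt_min x0|exact: (Hdl i).1].
move=> x y xd yd; have [th /andP[th0 th1]] := mean_value y (x - y) df.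
have -> : y + (x - y) = x by rewrite addrC subrK.
move=> E; have {E} := etrans E (fd _ _).
set z := y + _ => ->.
have zd : `|z| < \big[Num.min/1]_i dl i.
  have -> : z = th *: x + (1 - th) *: y by rewrite /z scalerBr scalerBl scale1r; apply/matrixP => i j; rewrite !mxE; ring.
  rewrite (le_lt_trans (ler_normD _ _))// !normrZ (ger0_norm th0) ger0_norm ?subr_ge0//.
  have [t0|t0] := leP th 0; first have E0 : th = 0 by apply/le_anti/andP.
    by rewrite E0 mul0r add0r subr0 mul1r.
  set d := \big[_/_]_i _ in xd yd *.
  have h1 : th * `|x| < th * d by rewrite ltr_pM2l.
  have h2 : (1 - th) * `|y| <= (1 - th) * d by rewrite ler_wpM2l ?subr_ge0// ltW.
  by rewrite (lt_le_trans (ltr_leD h1 h2))// -mulrDl addrC subrK mul1r.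
rewrite (le_trans (ler_norm_sum _ _ _))//.
apply: (@le_trans _ _ (\sum_(i < p) `|x - y| * e')).
  apply: ler_sum => i _; rewrite normrM ler_pM//; first exact: normrV_ge.
  by apply: (Hdl i).2; apply: (lt_le_trans zd); rewrite (bigD1 i)//= ge_min lexx.
rewrite sumr_const card_ord -mulr_natl /e'.
have -> : p%:R * (`|x - y| * (e / (p%:R + 1))) = e * `|x - y| * (p%:R / (p%:R + 1)) by ring.
by rewrite ler_piMr ?mulr_ge0 ?(ltW e0)// ler_pdivrMr// mul1r lerDl.
Qed.

End Orders.

(** * The jet of the transformed nonlinearity *)

Lemma jet_bound_zero (R : realType) T (S : set T) p l psi (f : T -> 'cV[R]_p -> R) :
  jet_bound S l (cst 0) f -> jet_bound S l psi f.
Proof.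
elim: l f => [|l IH] f [[K H0] H]; (split;
  first by exists 0 => t St; rewrite mul0r; have := H0 t St; rewrite mulr0).
  exact: H.
by case: H => H1 H2; split=> // i; exact: IH (H2 i).
Qed.

Lemma continuous_cmul (R : realType) (V : normedModType R) (c : R) (f : V -> R) x :
  {for x, continuous f} -> {for x, continuous (fun y => c * f y)}.
Proof. by move=> cf; apply: cvgM; [exact: cvg_cst|exact: cf]. Qed.

Section NormalFormJet.
Context {R : realType} (p kap M : nat) (ep B : R).
Notation V := 'cV[R]_p.
Notation midx := {ffun 'I_kap -> 'I_p}.
Notation coef := ('I_p -> midx -> R).
Hypothesis ep_gt0 : 0 < ep.
Hypothesis M_even : ~~ odd M.
Hypothesis M_gt1 : (1 < M)%N.
Hypothesis kap_gt1 : (1 < kap)%N.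
Hypothesis ep_small :
  p%:R * (#|{: midx}|%:R * (B * (kap%:R * (ep ^+ kap.-1 * M%:R)))) <= 2^-1.

Lemma ordge_coord (i : 'I_p) : ordge 1 (fun y : V => y i 0).
Proof. by exists 1 => //; exists 1 => // y _; rewrite mul1r expr1 normrV_ge. Qed.

Lemma satv_le (y : V) i : `|satv M ep y i 0| <= `|y|.
Proof. by rewrite mxE (le_trans (sat_le _ _ _))// normrV_ge. Qed.

Lemma ordge_hslope (c : coef) (Z Z' : V -> V) r i :
  (forall y i, `|Z y i 0| <= `|y|) -> (forall y i, `|Z' y i 0| <= `|y|) ->
  ordge kap.-1 (fun y => hslope c (Z y) (Z' y) r i).
Proof.
move=> HZ HZ'; under eq_fun do rewrite mxE.
apply: ordge_sum => d; apply: ordge_scale.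
apply: ordge_sum => q; exists 1 => //; exists 1 => // y _; rewrite mul1r.
exact: tele_bound.
Qed.

Lemma ordge_hpoly (c : coef) (Z : V -> V) r : (forall y i, `|Z y i 0| <= `|y|) ->
  ordge kap (fun y => hpoly c (Z y) r 0).
Proof.
move=> HZ; under eq_fun do rewrite mxE.
apply: ordge_sum => d; apply: ordge_scale.
exists 1 => //; exists 1 => // y _; rewrite mul1r normr_prod.
have -> : `|y| ^+ kap = \prod_(q < kap) `|y| by rewrite prodr_const card_ord.
by apply: ler_prod => q _; rewrite normr_ge0 HZ.
Qed.

Lemma ordge_sat i : ordge M.+1 (fun y : V => sat M ep (y i 0) - y i 0).
Proof.
exists (ep^-1 ^+ M); first by rewrite exprn_ge0// invr_ge0 ltW.
exists 1 => // y _; rewrite (le_trans (sat_flat _ _ _))//.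
have -> : ep^-1 ^+ M * `|y| ^+ M.+1 = `|y| * (`|y| / ep) ^+ M by rewrite exprS exprMn; ring.
rewrite ler_pM ?exprn_ge0 ?normrV_ge// lerXn2r ?nnegrE ?divr_ge0 ?(ltW ep_gt0)//.
by rewrite normrM (ger0_norm (x := ep^-1)) ?invr_ge0 ?(ltW ep_gt0)// ler_wpM2r ?invr_ge0 ?(ltW ep_gt0)// normrV_ge.
Qed.

Lemma ordge_sats i : ordge M (fun y : V => sats M ep (y i 0) (y i 0) - 1).
Proof.
exists (M.+1%:R * ep^-1 ^+ M); first by rewrite mulr_ge0 ?exprn_ge0// invr_ge0 ltW.
exists 1 => // y _; rewrite (le_trans (sats_flat _ _ _ _))//.
rewrite -mulrA -exprMn ler_wpM2l// lerXn2r ?nnegrE ?mulr_ge0 ?invr_ge0 ?(ltW ep_gt0)//.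
rewrite normrM (ger0_norm (x := ep^-1)) ?invr_ge0 ?(ltW ep_gt0)//.
by rewrite mulrC ler_wpM2l ?invr_ge0 ?(ltW ep_gt0)// normrV_ge.
Qed.

Context (A : R -> 'M[R]_p) (F : R -> V -> V) (C Cd a : R -> coef).
Hypothesis HB : forall t, bounded_coef B (C t).
Hypothesis HE : forall t z, hpoly (Cd t) z =
  A t *m hpoly (C t) z - hslope (C t) z z *m (A t *m z) - hpoly (a t) z.

Notation down t := (shear M ep (C t)).
Notation J0 t y := (jac M ep (C t) y y).
Notation sg y := (satv M ep y).
Notation nf := (nform M ep A F C Cd).

(** What replacing y by its saturation leaves in the linear terms. *)
Definition cutoff_error t (y : V) : V :=
  hslope (C t) (sg y) (sg y) *m
  \col_i (sats M ep (y i 0) (y i 0) * (A t *m y) i 0 - (A t *m sg y) i 0).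

Definition nform_core t (y : V) : V :=
  F t (down t y) - hpoly (a t) (sg y) + cutoff_error t y.

(** The homological equation, evaluated at the saturated variable, cancels all
    terms linear in A up to the saturation error; in this form no unbounded
    factor A or h_t is left. *)
Lemma nformE t y : nf t y = invmx (J0 t y) *m nform_core t y.
Proof.
have uJ : J0 t y \in unitmx by apply: (jac_unit ep_gt0 M_even M_gt1 ep_small).
rewrite /nform; have -> : A t *m y = invmx (J0 t y) *m (J0 t y *m (A t *m y)).
  by rewrite mulKmx.
rewrite -mulmxBr; congr (_ *m _).
rewrite HE /nform_core /cutoff_error /shear /sat_hpoly.
have -> : \col_i (sats M ep (y i 0) (y i 0) * (A t *m y) i 0 - (A t *m sg y) i 0) =
    (\col_i (sats M ep (y i 0) (y i 0) * (A t *m y) i 0)) - A t *m sg y.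
  by apply/matrixP => i k; rewrite ord1 mxE [RHS]mxE; congr (_ + _); rewrite [RHS]mxE.
have W : wslope M ep (C t) y y *m (A t *m y) =
    hslope (C t) (sg y) (sg y) *m \col_i (sats M ep (y i 0) (y i 0) * (A t *m y) i 0).
  apply/matrixP => r k; rewrite ord1 [LHS]mxE [RHS]mxE; apply: eq_bigr => i _.
  by rewrite [wslope _ _ _ _ _ _ _]mxE [X in _ = _ * X]mxE mulrA.
rewrite /jac mulmxBl mul1mx W !mulmxBr.
set u := A t *m y; set h := A t *m _; set f := F t _; set s := hslope _ _ _ *m _.
set q := hpoly (a t) _; set w := _ *m \col_i _.
by apply/matrixP => i k; rewrite !(mxE, addrK); ring.
Qed.

Lemma ordge_cutoff_error t r : ordge M.+1 (fun y => cutoff_error t y r 0).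
Proof.
under eq_fun do rewrite mxE.
apply: ordge_sum => i; apply: (@ordge_le _ _ (kap.-1 + M.+1)); first exact: leq_addl.
apply: ordge_mul; first by apply: ordge_hslope => y i'; exact: satv_le.
have E (y : V) : (\col_i (sats M ep (y i 0) (y i 0) * (A t *m y) i 0 - (A t *m sg y) i 0)) i 0 =
   \sum_m A t i m * ((sats M ep (y i 0) (y i 0) - 1) * y m 0 + -1 * (sat M ep (y m 0) - y m 0)).
  rewrite !mxE mulr_sumr -sumrB; apply: eq_bigr => m _; rewrite mxE; ring.
under eq_fun do rewrite E.
apply: ordge_sum => m; apply: ordge_scale.
apply: ordge_add; first by rewrite -addn1; apply: ordge_mul; [exact: ordge_sats|exact: ordge_coord].
by apply: ordge_scale; exact: ordge_sat.
Qed.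

Context (l : nat) (S : set R) (psi : R -> R).
Hypothesis lM : (l <= M)%N.
Hypothesis HF : forall r, jet_bound S l psi (fun t x => F t x r 0).
Hypothesis Ha : forall r c, exists K, forall t, S t -> `|a t r c| <= K * psi t.

(** A(t) has no bound in terms of psi, but the error is flat for each t, so its
    jet vanishes. *)
Lemma jet_bound_cutoff_error r : jet_bound S l psi (fun t y => cutoff_error t y r 0).
Proof.
have HBS t : S t -> bounded_coef B (C t) by move=> _; exact: HB.
apply: jet_bound_zero; apply: (@jet_bound_flat _ _ _ _ _ (fun t => `|A t|)); last first.
  move=> t _; apply: ordge_flat; apply: ordge_le (ordge_cutoff_error t r); exact: lM.
have J2 i : jet_bound S l (fun t => `|A t|)
  (fun t y => \sum_m A t i m * (sats M ep (y i 0) (y i 0) * y m 0 - satv M ep y m 0)).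
  apply: jet_bound_sum => m _; apply: jet_bound_mulc.
    by exists 1 => u _; rewrite mul1r normrM_ge.
  apply: (@jet_bound_sub R R S p l (cst 1) (fun _ (y : V) => sats M ep (y i 0) (y i 0) * y m 0)
    (fun _ y => satv M ep y m 0)); last exact: jet_bound_sat.
  by apply: jet_bound_mul; [exact: jet_bound_sats|exact: jet_bound_coord].
apply: (@jet_bound_eq _ _ _ _ _ _ (fun t (y : V) => \sum_i hslope (C t) (sg y) (sg y) r i *
  \sum_m A t i m * (sats M ep (y i 0) (y i 0) * y m 0 - satv M ep y m 0))).
  move=> t _; apply/funext => y; rewrite [RHS]mxE; apply: eq_bigr => i _; congr (_ * _).
  rewrite [RHS]mxE [in RHS]mxE [X in _ - X]mxE mulr_sumr -sumrB.
  by apply: eq_bigr => m _; ring.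
apply: jet_bound_sum => i _; apply: jet_bound_mul => //.
exact: (jet_bound_hslope ep M_even HBS).
Qed.

Lemma jet_bound_core r : jet_bound S l psi (fun t y => nform_core t y r 0).
Proof.
have HBS t : S t -> bounded_coef B (C t) by move=> _; exact: HB.
apply: (@jet_bound_eq _ _ _ _ _ _ (fun t (y : V) =>
  F t (\col_i down t y i 0) r 0 - hpoly (a t) (sg y) r 0 + cutoff_error t y r 0)).
  move=> t _; apply/funext => y; rewrite [RHS]mxE; congr (_ + _); rewrite [RHS]mxE; congr (_ + _).
    by congr (F t _ r 0); apply/matrixP => i k; rewrite ord1 mxE.
  by rewrite [RHS]mxE.
apply: jet_bound_add; last exact: jet_bound_cutoff_error.
apply: jet_bound_sub; last exact: jet_bound_hpoly.
apply: (@jet_bound_comp R R S p p l psi (fun t x => F t x r 0) (fun t i y => down t y i 0)).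
- by move=> t i _; rewrite (shear0 M ep kap_gt1) mxE.
- exact: HF.
- by move=> i; exact: (jet_bound_shear ep M_even HBS).
Qed.

Lemma jet_bound_nform r : jet_bound S l psi (fun t y => nf t y r 0).
Proof.
have HBS t : S t -> bounded_coef B (C t) by move=> _; exact: HB.
apply: (@jet_bound_eq _ _ _ _ _ _ (fun t (y : V) =>
  \sum_i invmx (J0 t y) r i * nform_core t y i 0)).
  by move=> t _; apply/funext => y; rewrite nformE [RHS]mxE.
apply: jet_bound_sum => i _; apply: jet_bound_mul; last exact: jet_bound_core.
exact: (jet_bound_jacV_diag ep_gt0 M_even M_gt1 kap_gt1 ep_small HBS).
Qed.

Hypothesis kl : (kap <= l)%N.
Hypothesis HD : forall t, S t -> forall r v, 'd (fun x => F t x r 0) 0 v = 0.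
Hypothesis F0 : forall t, F t 0 = 0.

Let l0 : (0 < l)%N.
Proof. exact: leq_trans (ltnW kap_gt1) kl. Qed.

Lemma F_small_lip t r : S t -> forall e, 0 < e -> exists2 dl : R, 0 < dl &
  forall x y, `|x| < dl -> `|y| < dl -> `|F t x r 0 - F t y r 0| <= e * `|x - y|.
Proof.
move=> St; apply: (@small_lip R p (fun x => F t x r 0) (fun i => partial i (fun x => F t x r 0))).
- have H1 : jet_bound S 1 psi (fun t x => F t x r 0) by exact: jet_bound_le (HF r).
  by move=> x; exact: (jet_bound_diff x H1 St).
- by move=> x v; exact: diff_pd.
- move=> i.
  have H1 : jet_bound S 1 psi (fun t x => F t x r 0) by exact: jet_bound_le (HF r).
  have [_ [_ H2]] := H1.
  have cH := @jet_bound_cont R R S p 0 psi (fun t => partial i (fun x => F t x r 0)) t (H2 i) St.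
  exact: cH.
- by move=> i; exact: HD.
Qed.

Lemma shear_le2 t y : `|down t y| <= 2 * `|y|.
Proof.
have := shear_lip ep_gt0 M_even M_gt1 ep_small y 0 (HB t).
by rewrite (shear0 M ep kap_gt1) !subr0.
Qed.

Lemma core_entry t y r : nform_core t y r 0 =
  F t (down t y) r 0 - hpoly (a t) (sg y) r 0 + cutoff_error t y r 0.
Proof. by rewrite mxE [X in X + _ = _]mxE [X in _ + X + _ = _]mxE. Qed.

Lemma flat_core t r : S t -> flat 1 (fun y => nform_core t y r 0).
Proof.
move=> St.
have E y : nform_core t y r 0 = F t (down t y) r 0 + (-1 * hpoly (a t) (sg y) r 0 + cutoff_error t y r 0).
  by rewrite core_entry; ring.
under eq_fun do rewrite E.
apply: flat_add.
  apply: (@flat_comp2 R p 1 (fun x => F t x r 0)); first exact: shear_le2.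
  move=> e e0; have [dl dl0 H] := F_small_lip r St e0.
  exists dl => // y yd; have := H y 0 yd; rewrite normr0 => /(_ dl0).
  by rewrite F0 [(0 : V) r 0]mxE !subr0 expr1.
apply: flat_add.
  apply: ordge_flat; apply: (@ordge_le _ _ kap) => //.
  apply: ordge_scale.
  by apply: ordge_hpoly => y i; exact: satv_le.
apply: ordge_flat; apply: ordge_le (ordge_cutoff_error t r); rewrite ltnS; exact: ltnW.
Qed.

(** With W the Jacobian of h, G = E + J^-1 W E for the core E, which is o(|y|)
    while W = O(|y|^(|k|-1)); and E differs from F - F^k by
    F(y - h) - F(y) = o(|h|) and by saturation errors. *)
Lemma flat_nform t r : S t ->
  flat kap (fun y => nf t y r 0 - (F t y r 0 - hpoly (a t) y r 0)).
Proof.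
move=> St.
have HBS u : S u -> bounded_coef B (C u) by move=> _; exact: HB.
pose Ji y := invmx (J0 t y).
(* separates the core of G from a correction of higher order *)
have JiE y : Ji y = 1%:M + Ji y *m wslope M ep (C t) y y.
  have uJ : J0 t y \in unitmx by apply: (jac_unit ep_gt0 M_even M_gt1 ep_small).
  by rewrite -[X in X + _](mulVmx uJ) -mulmxDr /jac subrK mulmx1.
have E y : nf t y r 0 - (F t y r 0 - hpoly (a t) y r 0) =
   (\sum_i (Ji y *m wslope M ep (C t) y y) r i * nform_core t y i 0) +
   ((F t (down t y) r 0 - F t y r 0) +
   (- 1 * (\sum_i hslope (a t) (sg y) y r i * (sat M ep (y i 0) - y i 0)) + cutoff_error t y r 0)).
  have addE (u v : V) : (u + v) r 0 = u r 0 + v r 0 by rewrite mxE.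
  have subE (u v : V) i : (u - v) i 0 = u i 0 - v i 0 by rewrite !mxE.
  rewrite nformE -/(Ji y).
  have -> : Ji y *m nform_core t y = nform_core t y + Ji y *m wslope M ep (C t) y y *m nform_core t y.
    by rewrite {1}JiE mulmxDl mul1mx.
  have -> : \sum_i hslope (a t) (sg y) y r i * (sat M ep (y i 0) - y i 0) =
      (hslope (a t) (sg y) y *m (sg y - y)) r 0.
    by rewrite [RHS]mxE; apply: eq_bigr => i _; congr (_ * _); rewrite subE; congr (_ - _); rewrite mxE.
  rewrite -hpoly_slope addE subE core_entry.
  have -> : (Ji y *m wslope M ep (C t) y y *m nform_core t y) r 0 =
    \sum_i (Ji y *m wslope M ep (C t) y y) r i * nform_core t y i 0 by rewrite mxE.
  ring.
under eq_fun do rewrite E.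
apply: flat_add.
  (* the core is o(|y|), the Jacobian of h is O(|y|^(kap - 1)) *)
  apply: flat_sum => i; apply: (@flat_mul R p kap kap.-1 1); last exact: flat_core.
    by rewrite addn1 prednK// ltnW.
  under eq_fun do rewrite mxE.
  apply: ordge_sum => m; apply: (@ordge_le R p (0 + kap.-1)) => //; apply: ordge_mul.
    apply: ordge_cont.
    exact: (jet_bound_cont (jet_bound_jacV_diag ep_gt0 M_even M_gt1 kap_gt1 ep_small HBS 0 r m) St).
  under eq_fun do rewrite mxE; apply: (@ordge_le R p (kap.-1 + 0)); [by rewrite addn0|apply: ordge_mul].
    by apply: ordge_hslope => y j; exact: satv_le.
  exists M%:R => //; exists 1 => // y _; rewrite expr0 mulr1; exact: sats_bound.
apply: flat_add.
  (* the displacement is O(|y|^kap), and F has small Lipschitz constant near 0 *)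
  have [K K0 [dl dl0 HK]] : ordge kap (fun y => `|sat_hpoly M ep (C t) y|).
    have [K K0 [dl dl0 HK]] : ordge kap (fun y => \sum_i `|sat_hpoly M ep (C t) y i 0|).
      apply: ordge_sum => i; have [K K0 [dl dl0 HK]] := ordge_hpoly (C t) i satv_le.
      by exists K => //; exists dl => // y yd; rewrite normr_id; exact: HK.
    exists K => //; exists dl => // y yd; rewrite normr_id; apply: le_trans (HK y yd).
    rewrite ger0_norm ?sumr_ge0//; apply: normrM_le => [|i k]; first exact: sumr_ge0.
    by rewrite ord1 (bigD1 i)//= lerDl sumr_ge0.
  move=> e e0; have [|dl' dl'0 H] := F_small_lip r St (e := e / (K + 1)).
    by rewrite divr_gt0// ltr_wpDl.
  exists (Num.min dl (dl' / 2)); first by rewrite lt_min dl0 divr_gt0.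
  move=> y; rewrite lt_min => /andP[y1 y2].
  have y3 : `|down t y| < dl' by rewrite (le_lt_trans (shear_le2 t y))// mulrC -ltr_pdivlMr.
  have y4 : `|y| < dl' by rewrite (lt_le_trans y2)// ler_pdivrMr// ler_peMr ?(ltW dl'0)// ler1n.
  rewrite (le_trans (H _ _ y3 y4))//.
  have -> : down t y - y = - sat_hpoly M ep (C t) y by rewrite /shear addrC addKr.
  rewrite normrN; have := HK y y1; rewrite normr_id => HK'.
  apply: (@le_trans _ _ (e / (K + 1) * (K * `|y| ^+ kap))).
    by rewrite ler_wpM2l// divr_ge0 ?(ltW e0)// addr_ge0.
  have -> : e / (K + 1) * (K * `|y| ^+ kap) = e * (K / (K + 1)) * `|y| ^+ kap by ring.
  rewrite ler_wpM2r ?exprn_ge0// ler_piMr ?(ltW e0)//.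
  by rewrite ler_pdivrMr ?ltr_wpDl// mul1r lerDl.
apply: flat_add; last first.
  apply: ordge_flat; apply: ordge_le (ordge_cutoff_error t r).
  by rewrite ltnS (leq_trans kl).
apply: ordge_flat; apply: ordge_scale.
apply: ordge_sum => i; apply: (@ordge_le _ _ (kap.-1 + M.+1)).
  by rewrite addnS ltnS (leq_trans kl)// (leq_trans lM)// leq_addl.
apply: ordge_mul; last exact: ordge_sat.
by apply: ordge_hslope => y j; [exact: satv_le|exact: normrV_ge].
Qed.

Lemma jet_bound_plain_hpoly r : jet_bound S l psi (fun t y => hpoly (a t) y r 0).
Proof.
apply: (@jet_bound_eq _ _ _ _ _ _ (fun t (y : V) => \sum_c a t r c * \prod_q y (c q) 0)).
  by move=> t _; apply/funext => y; rewrite mxE.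
apply: jet_bound_sum => c _; apply: jet_bound_mulc; first exact: Ha.
by apply: jet_bound_prod => q _; exact: jet_bound_coord.
Qed.

Lemma nder_nform t r vs : S t -> (size vs <= kap)%N ->
  nder (fun y => nf t y r 0) vs 0 =
  nder (fun y => F t y r 0) vs 0 - nder (fun y => hpoly (a t) y r 0) vs 0.
Proof.
move=> St svs.
pose g (i : nat) : V -> R := match i with
  | 0 => fun y => nf t y r 0 | 1 => fun y => F t y r 0 | _ => fun y => hpoly (a t) y r 0 end.
pose c (i : nat) : R := match i with 0 => 1 | 1 => -1 | _ => 1 end.
have dg i ws : (size ws < l)%N -> forall x, differentiable (nder (g i) ws) x.
  case: i => [|[|i]] s x.
  - exact: (@jet_bound_nder_diff _ _ _ _ _ _ _ _ _ x (jet_bound_nform r) St).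
  - exact: (@jet_bound_nder_diff _ _ _ _ _ _ _ _ _ x (HF r) St).
  - exact: (@jet_bound_nder_diff _ _ _ _ _ _ _ _ _ x (jet_bound_plain_hpoly r) St).
have cg i ws : (size ws <= l)%N -> continuous (nder (g i) ws).
  case: i => [|[|i]] s.
  - exact: (jet_bound_nder_cont (jet_bound_nform r) St).
  - exact: (jet_bound_nder_cont (HF r) St).
  - exact: (jet_bound_nder_cont (jet_bound_plain_hpoly r) St).
pose D (y : V) := \sum_(i <- [:: 0; 1; 2]%N) c i * g i y.
have nD ws : (size ws <= l)%N -> nder D ws = (fun x => \sum_(i <- [:: 0; 1; 2]%N) c i * nder (g i) ws x).
  by move=> s; apply: (@nder_sum R p nat _ c g l ws).
have fD : flat kap D.
  have -> : D = (fun y => nf t y r 0 - (F t y r 0 - hpoly (a t) y r 0)).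
    by apply/funext => y; rewrite /D !big_cons big_nil /= mulN1r !mul1r addr0 opprB [_ - _]addrC.
  exact: flat_nform.
have := flat_nder fD _ _ svs.
rewrite nD ?(leq_trans svs)// !big_cons big_nil /= mulN1r !mul1r addr0.
move=> /(_ _ _)/eqP H; apply/eqP; rewrite -subr_eq0 opprB [_ - _]addrC; apply: H.
- move=> ws s x; rewrite nD ?(leq_trans (ltnW s))//.
  have -> : (fun x => \sum_(i <- [:: 0; 1; 2]%N) c i * nder (g i) ws x) =
    (fun x => c 0%N * nder (g 0%N) ws x + (c 1%N * nder (g 1%N) ws x + c 2%N * nder (g 2%N) ws x)).
    by apply/funext => z; rewrite !big_cons big_nil addr0.
  have dc i : differentiable (fun x => c i * nder (g i) ws x) x.
    apply: (diffM_fun (differentiable_cst _ _) (dg i ws _ x)).1.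
    exact: leq_trans s kl.
  by apply: (diffD_fun (dc _) (diffD_fun (dc _) (dc _)).1).1.
- move=> ws s; rewrite nD ?(leq_trans s)//.
  move=> x; apply: continuous_bigsum => i.
  have ci := cg i ws (leq_trans s kl) x.
  exact: continuous_cmul.
Qed.

End NormalFormJet.

(** * Uniform local equivalence *)

Section NormalFormEquivalence.
Context {R : realType} (p kap M : nat) (ep B : R).
Notation V := 'cV[R]_p.
Notation midx := {ffun 'I_kap -> 'I_p}.
Notation coef := ('I_p -> midx -> R).
Hypothesis ep_gt0 : 0 < ep.
Hypothesis M_even : ~~ odd M.
Hypothesis M_gt1 : (1 < M)%N.
Hypothesis kap_gt1 : (1 < kap)%N.
Hypothesis ep_small :
  p%:R * (#|{: midx}|%:R * (B * (kap%:R * (ep ^+ kap.-1 * M%:R)))) <= 2^-1.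
Context (A : R -> 'M[R]_p) (F : R -> V -> V) (C Cd : R -> coef).
Hypothesis HB : forall t, bounded_coef B (C t).
Hypothesis HC : forall t0 t1 r c, t0 <= t1 ->
  abs_cont t0 t1 (fun t => C t r c) (fun t => Cd t r c).
Hypothesis F0 : forall t, F t 0 = 0.

Notation down t := (shear M ep (C t)).
Notation up t := (unshear ep_gt0 M_even M_gt1 ep_small (C t)).

Lemma col_eta (f : V -> V) : f = (fun x => \col_r f x r 0).
Proof. by apply/funext => x; apply/matrixP => i j; rewrite ord1 mxE. Qed.

Lemma Cn_shear l t : Cn l setT (down t).
Proof.
rewrite [down t]col_eta.
exact: (@jet_bound_Cn_set R R setT t p p l (cst 1) (fun t r x => down t x r 0) setT Logic.I
  (fun r => jet_bound_shear ep M_even (fun t _ => HB t) l r)).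
Qed.

Lemma Cn_unshear l t : Cn l setT (up t).
Proof.
rewrite [up t]col_eta.
exact: (@jet_bound_Cn_set R unit setT tt p p l (cst 1) (fun _ r x => up t x r 0) setT Logic.I
  (fun r => jet_bound_unshear ep_gt0 M_even M_gt1 kap_gt1 ep_small l r (HB t))).
Qed.

Lemma unshear_bound t x : `|up t x| <= 2 * `|x|.
Proof.
have := unshear_lip ep_gt0 M_even M_gt1 ep_small x 0 (HB t).
by rewrite (unshear0 ep_gt0 M_even M_gt1 kap_gt1 ep_small (HB t)) !subr0.
Qed.

Lemma lip_tends (f : V -> V) : (forall x, `|f x| <= 2 * `|x|) -> f x @[x --> (0 : V)] --> (0 : V).
Proof.
move=> f2; have f0 : f 0 = 0.
  by apply/eqP; rewrite -normr_le0 (le_trans (f2 0))// normr0 mulr0.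
have : {for 0, continuous f}.
  by apply: (@lipschitz_cont _ _ _ 2) => // y; rewrite f0 !sub0r !normrN.
by rewrite /prop_for /continuous_at f0.
Qed.

Lemma zero_solution (f : R -> V -> V) : (forall t, f t 0 = 0) -> has_zero_solution f.
Proof.
move=> f0 s t _ _ st c.
have E r : f r 0 c 0 = 0 by rewrite f0 mxE.
split; first by apply: Lint_eq (Lint0 (Lm_itv _)) => [|r _]; [exact: Lm_itv|].
have -> : \int[leb]_(r in `[s, t]) f r 0 c 0 = \int[leb]_(r in `[s, t]) 0.
  by apply: LRint_eq => r _.
by rewrite (Rint_cst _ st) mul0r addr0.
Qed.

(** The transformation and its inverse are Lipschitz with constant 2,
    uniformly in t, which gives the tubes of radius 1 and the uniform limit. *)
Lemma nform_equivalent l :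
  uniformly_locally_equivalent l (fun t x => A t *m x + F t x)
    (fun t x => A t *m x + nform M ep A F C Cd t x).
Proof.
have smallE (h : R -> V -> V) : (forall t x, `|h t x| <= 2 * `|x|) -> uniform_limit0 h (fun=> 1).
  move=> h2 e e0; exists (e / 2) => [|t x _ xe]; first by rewrite divr_gt0.
  by rewrite (le_lt_trans (h2 t x))// mulrC -ltr_pdivlMr.
split.
- by apply: zero_solution => t; rewrite F0 mulmx0 addr0.
- apply: zero_solution => t.
  by rewrite (nform0 M ep kap_gt1 A C Cd F0) mulmx0 addr0.
exists (fun=> 1), (fun=> 1), (fun t x => up t x), (fun t y => down t y); split; first split.
- by [].
- move=> t; have HBt := HB t.
  have cd : cancel (down t) (up t) by exact: shear_cancel.
  have cu : cancel (up t) (down t) by exact: unshearK.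
  split.
  + apply: (@Cn_diffeo_cancel _ _ _ _ (down t)) => //; first exact: ball_open.
    * exact: Cn_unshear.
    * exact: Cn_shear.
    * by move=> x; exact: ((Cn_shear 0 t).2 [::] isT x Logic.I).
  + apply: (@Cn_diffeo_cancel _ _ _ _ (up t)) => //; first exact: ball_open.
    * exact: Cn_shear.
    * exact: Cn_unshear.
    * by move=> x; exact: ((Cn_unshear 0 t).2 [::] isT x Logic.I).
  + by move=> x _ _; exact: cu.
  + by move=> y _ _; exact: cd.
- move=> J y iJ sol _.
  exact: (solution_shear ep_gt0 M_even M_gt1 ep_small HB HC iJ sol).
- move=> J x iJ sol _.
  exact: (solution_unshear ep_gt0 M_even M_gt1 ep_small HB HC iJ sol).
- by move=> t; split; apply: lip_tends => x; [exact: unshear_bound|exact: (shear_le2 ep_gt0 M_even M_gt1 kap_gt1 ep_small HB)].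
- by exists 1, 1; rewrite ltr01; split=> // t; rewrite lexx.
- by split; apply: smallE => t x; [exact: unshear_bound|exact: (shear_le2 ep_gt0 M_even M_gt1 kap_gt1 ep_small HB)].
Qed.

End NormalFormEquivalence.

(** * Measurability of superpositions and of derivatives *)

Section Measurability.
Context {R : realType}.
Notation LT := (lebesgueType R).
Notation mL := (@completed_lebesgue_measure R).
Implicit Types (f g : R -> R).

(** 1/f = f (f^2)^(-1), and powers of nonnegative functions are measurable. *)
Lemma Lmeasurable_inv f : Lmeasurable setT f -> Lmeasurable setT (fun t => (f t)^-1).
Proof.
move=> mf.
have -> : (fun t => (f t)^-1) = (fun t => f t * (f t * f t) `^ (-1)).
  apply/funext => t; rewrite powR_inv1; last by rewrite -expr2 sqr_ge0.
  have [->|f0] := eqVneq (f t) 0; first by rewrite invr0 mul0r.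
  by rewrite invfM mulrA divff// mul1r.
apply: measurable_funM; first exact: mf.
apply: (@measurableT_comp _ _ _ LT R R (@powR R ^~ (-1)) setT (fun t => f t * f t)).
  exact: measurable_powR.
by apply: measurable_funM; exact: mf.
Qed.

Lemma ae_imply (P Q : R -> Prop) : (forall t, P t -> Q t) ->
  {ae mL, forall t, P t} -> {ae mL, forall t, Q t}.
Proof.
by move=> PQ [N [mN N0 HN]]; exists N; split=> // t nQ; apply: HN => /PQ.
Qed.

Lemma ae_and (P Q : R -> Prop) : {ae mL, forall t, P t} -> {ae mL, forall t, Q t} ->
  {ae mL, forall t, P t /\ Q t}.
Proof.
move=> nP nQ; have := negligibleU nP nQ; apply: negligibleS => t /= nPQ.
by apply: contrapT => /not_orP[/contrapT Pt /contrapT Qt]; apply: nPQ.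
Qed.

Lemma ae_all (I : finType) (P : I -> R -> Prop) : (forall i, {ae mL, forall t, P i t}) ->
  {ae mL, forall t, forall i, P i t}.
Proof.
move=> H.
suff : {ae mL, forall t, forall i, i \in enum I -> P i t}.
  by apply: ae_imply => t Ht i; apply: Ht; rewrite mem_enum.
elim: (enum I) => [|i s IH].
  by exists set0; split=> // t /= nP; apply: nP.
apply: ae_imply (ae_and (H i) IH) => t [Pi Ps] i'; rewrite inE => /orP[/eqP ->//|].
exact: Ps.
Qed.

Lemma Lmeasurable_ae_eq f g : {ae mL, forall t, f t = g t} ->
  Lmeasurable setT f -> Lmeasurable setT g.
Proof.
move=> fg mf; apply/measurable_EFinP.
apply: (@ae_measurable_fun _ LT R mL (@completed_lebesgue_measure_is_complete R) setT (EFin \o f)).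
  by apply: ae_imply fg => t fgt _ /=; rewrite fgt.
exact/measurable_EFinP.
Qed.

(** Uses completeness of the Lebesgue measure. *)
Lemma Lmeasurable_ae_cvg (f_ : nat -> R -> R) f : (forall m, Lmeasurable setT (f_ m)) ->
  {ae mL, forall t, f_ ^~ t @ \oo --> f t} -> Lmeasurable setT f.
Proof.
move=> mf [N [mN N0 HN]].
have cN t : ~ N t -> f_ ^~ t @ \oo --> f t.
  by move=> Nt; apply: contrapT => H; apply: Nt; exact: HN.
pose i t : R := \1_(~` N) t.
have mi : Lmeasurable setT i by apply: measurable_indic; exact: measurableC.
have Ni t : N t -> i t = 0 by move=> Nt; rewrite /i indicE memNset//; apply.
have Ci t : ~ N t -> i t = 1 by move=> Nt; rewrite /i indicE mem_set.
apply: (@Lmeasurable_ae_eq (fun t => i t * f t)).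
  exists N; split=> // t; apply: contra_notP => Nt /=; by rewrite Ci// mul1r.
apply: (@measurable_fun_cvg _ LT R setT (fun m t => i t * f_ m t)).
  by move=> m; apply: measurable_funM; [exact: mi|exact: mf].
move=> t _; have [Nt|Nt] := pselect (N t).
  by rewrite Ni// mul0r; under eq_fun do rewrite mul0r; exact: cvg_cst.
by rewrite Ci// mul1r; under eq_fun do rewrite mul1r; exact: cN.
Qed.

(** A cell number instead of a time, because measurability is checked on each of
    countably many cells. *)
Definition grid (m : nat) (t : R) : nat := Num.truncn (m.+1%:R * (t + m%:R)).
Definition gridpoint (m i : nat) : R := i%:R / m.+1%:R - m%:R.

Lemma grid_meas m i : measurable ([set t | grid m t = i] : set LT).
Proof.
pose E k : set R := [set t | (grid m t <= k)%N].
have mE k : measurable (E k : set LT).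
  apply: Lm_borel.
  have -> : E k = setT `&` (fun t : R => m.+1%:R * (t + m%:R)) @^-1` `]-oo, k.+1%:R[.
    rewrite setTI; apply/seteqP.
    by split => t /=; rewrite /E /= /grid truncn_le_nat in_itv /=.
  have : measurable_fun setT (fun t : R => m.+1%:R * (t + m%:R)).
    apply: continuous_measurable_fun => t.
    apply: cvgM; first exact: cvg_cst.
    by apply: cvgD; [exact: cvg_id|exact: cvg_cst].
  by apply.
case: i => [|i].
  have -> : [set t | grid m t = 0%N] = E 0%N.
    by apply/seteqP; split => t /=; rewrite /E /= leqn0 => /eqP.
  exact: mE.
have -> : [set t | grid m t = i.+1] = E i.+1 `\` E i.
  apply/seteqP; split => t /=; rewrite /E /=.
    by move=> ->; rewrite leqnn; split=> //; rewrite ltnn.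
  by case=> h1 /negP; rewrite -ltnNge => h2; apply/eqP; rewrite eqn_leq h1.
by apply: measurableD.
Qed.

Lemma grid_cvg (t : R) : (fun m => gridpoint m (grid m t)) @ \oo --> t.
Proof.
apply/cvgrPdist_lt => e e0; near=> m.
have tm : 0 <= t + m%:R.
  suff : `|t| <= m%:R by rewrite ler_norml => /andP[h _]; rewrite -lerBlDr sub0r.
  by near: m; exact: nbhs_infty_ger.
have h : 0 <= m.+1%:R * (t + m%:R) by rewrite mulr_ge0.
have /andP[h1 h2] := truncn_itv h; rewrite -/(grid m t) in h1 h2.
have m0 : 0 < m.+1%:R :> R by [].
have : t - gridpoint m (grid m t) < m.+1%:R^-1.
  rewrite /gridpoint opprB addrA ltrBlDr.
  have -> : m.+1%:R^-1 + (grid m t)%:R / m.+1%:R = (grid m t).+1%:R / m.+1%:R :> R.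
    by rewrite -[(grid m t).+1%:R]natr1 mulrDl mul1r addrC.
  by rewrite ltr_pdivlMr// mulrC.
have : 0 <= t - gridpoint m (grid m t).
  by rewrite /gridpoint opprB addrA subr_ge0 ler_pdivrMr// mulrC.
move=> g0; rewrite ger0_norm// => /lt_trans; apply.
by near: m; exact: near_infty_natSinv_lt (PosNum e0).
Unshelve. all: by end_near. Qed.

(** On each of the countably many cells of the grid F is evaluated at a fixed
    point of space; refining the grid converges by continuity of F t and u. *)
Lemma superposition_meas p (F : R -> 'cV[R]_p -> R) (u : R -> 'cV[R]_p) :
  (forall x, Lmeasurable setT (F ^~ x)) ->
  {ae mL, forall t, continuous (F t)} -> continuous u ->
  Lmeasurable setT (fun t => F t (u t)).
Proof.
move=> mF cF cu.
apply: (@Lmeasurable_ae_cvg (fun m t => F t (u (gridpoint m (grid m t))))).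
  move=> m.
  have setE : [set: R] = \bigcup_i [set t | grid m t = i].
    by apply/esym; rewrite -subTset => t _; exists (grid m t).
  have E := @measurable_fun_bigcup _ _ LT R (fun i => [set t | grid m t = i])
    (fun t => F t (u (gridpoint m (grid m t)))) (fun i => grid_meas m i).
  rewrite /Lmeasurable setE; apply/E => i.
  apply: (@eq_measurable_fun _ _ LT R _ (F ^~ (u (gridpoint m i)))).
    by move=> t; rewrite inE /= => ->.
  exact: (@LmeasurableS R _ setT _ measurableT (@subsetT _ _) (mF (u (gridpoint m i)))).
apply: ae_imply cF => t cFt.
have c1 := @cvg_comp _ _ _ _ _ _ _ _ (grid_cvg (t := t)) (cu t).
exact: (@cvg_comp _ _ _ _ _ _ _ _ c1 (cFt (u t))).
Qed.

Lemma diff_seq (V : normedModType R) (f : V -> R) x v : differentiable f x ->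
  (fun m : nat => (f (x + m.+1%:R^-1 *: v) - f x) * m.+1%:R) @ \oo --> 'd f x v.
Proof.
move=> df; apply/cvgrPdist_lt => e e0.
have df' : derivable f x v by exact: diff_derivable.
have /cvgrPdist_lt H : h^-1 *: (f (h *: v + x) - f x) @[h --> 0^'] --> 'D_v f x by exact: df'.
have dE : 'D_v f x = 'd f x v by exact: deriveE.
have := H e e0; rewrite dE near_withinE /= => /nbhs_ballP[dl /= dl0 K].
near=> m.
have m0 : (m.+1%:R^-1 : R) != 0 by rewrite invr_eq0 pnatr_eq0.
have E : (m.+1%:R^-1)^-1 *: (f (m.+1%:R^-1 *: v + x) - f x) = (f (x + m.+1%:R^-1 *: v) - f x) * m.+1%:R.
  by rewrite invrK /GRing.scale /= [_ + x]addrC [LHS]mulrC.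
rewrite -E; apply: K => //; rewrite /ball /= sub0r normrN ger0_norm//.
by near: m; exact: near_infty_natSinv_lt (PosNum dl0).
Unshelve. all: by end_near. Qed.

(** Derivatives are pointwise limits of difference quotients. *)
Lemma nder_meas p l (S : set R) psi (f : R -> 'cV[R]_p -> R) vs :
  {ae mL, forall t, S t} -> jet_bound S l psi f -> (size vs <= l)%N ->
  (forall x, Lmeasurable setT (f ^~ x)) ->
  forall x, Lmeasurable setT (fun t => nder (f t) vs x).
Proof.
move=> aeS Hf; elim: vs => [//|v vs IH] s mf x.
apply: (@Lmeasurable_ae_cvg (fun m t => (nder (f t) vs (x + m.+1%:R^-1 *: v) - nder (f t) vs x) * m.+1%:R)).
  move=> m; apply: measurable_funM; last exact: measurable_cst.
  by apply: measurable_funB; apply: IH => //; exact: ltnW.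
apply: ae_imply aeS => t St; apply: diff_seq.
exact: (@jet_bound_nder_diff _ _ _ _ _ _ _ _ _ x Hf St).
Qed.

End Measurability.

Lemma jet_bound_caratheodory (R : realType) p q l (S : set R) psi (G : R -> 'cV[R]_p -> 'cV[R]_q) :
  {ae leb, forall t, S t} -> (forall r, jet_bound S l psi (fun t x => G t x r 0)) ->
  (forall x r, Lmeasurable setT (fun t => G t x r 0)) ->
  Cn_caratheodory l setT G.
Proof.
move=> aeS HG mG.
have eta t : G t = (fun x => \col_r G t x r 0).
  by apply/funext => x; apply/matrixP => i j; rewrite ord1 mxE.
have sm t : S t -> (forall vs, (size vs < l)%N -> forall x, differentiable (nder (G t) vs) x) /\
    (forall vs, (size vs <= l)%N -> continuous (nder (G t) vs)).
  by move=> St; rewrite eta; exact: (@jet_bound_Cn R R S t p q l psi (fun t r x => G t x r 0) St HG).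
have car vs : (size vs <= l)%N -> caratheodory setT (fun t => nder (G t) vs).
  move=> svs I U iI oU _; split.
    apply: ae_imply aeS => t St _ x _; exact: (sm t St).2.
  move=> x _ r; apply: (LmeasurableS (E := setT)) => //.
  apply: (@Lmeasurable_ae_eq R (fun t => nder (fun x => G t x r 0) vs x)).
    apply: ae_imply aeS => t St.
    by rewrite (nder_coord r (sm t St).1 svs).
  exact: (nder_meas aeS (HG r) svs).
split; first exact: (car [::]).
  move=> I U iI oU _; apply: ae_imply aeS => t St _ x _ vs s.
  exact: (sm t St).1.
by move=> vs /andP[_ s]; exact: car.
Qed.

(** * Measurability and bounds for the transformed nonlinearity *)

Section LocalToGlobal.
Context {R : realType}.

Lemma locint_meas (f : R -> R) : (forall a b, a <= b -> Lintegrable `[a, b] f) ->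
  Lmeasurable setT f.
Proof.
move=> H; apply: Lmeasurable_cover => m.
by apply: Lint_meas; apply: H; rewrite ge0_cp// ler0n.
Qed.

Lemma cont_on_continuous (h : R -> R) : (forall a b, a <= b -> cont_on a b h) -> continuous h.
Proof.
move=> H x; apply/cvgrPdist_le => e e0.
have x1 : x - 1 <= x + 1 by lra.
have /diag_contP/(_ x _ e e0)[|dl dl0 K] := H _ _ x1; first by lra.
apply/nbhs_ballP; exists (Num.min dl 1) => /=; first by rewrite lt_min dl0 ltr01.
move=> y; rewrite /ball /= lt_min => /andP[xy1 xy2].
have yx : x - 1 <= y <= x + 1 by move: xy2; rewrite ltr_norml => /andP[]; lra.
rewrite distrC; apply: (K y y) => //; by rewrite distrC.
Qed.

End LocalToGlobal.

Section NormalFormMeasurable.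
Context {R : realType} (p kap M : nat) (ep B : R).
Notation V := 'cV[R]_p.
Notation midx := {ffun 'I_kap -> 'I_p}.
Notation coef := ('I_p -> midx -> R).
Hypothesis ep_gt0 : 0 < ep.
Hypothesis M_even : ~~ odd M.
Hypothesis M_gt1 : (1 < M)%N.
Hypothesis kap_gt1 : (1 < kap)%N.
Hypothesis ep_small :
  p%:R * (#|{: midx}|%:R * (B * (kap%:R * (ep ^+ kap.-1 * M%:R)))) <= 2^-1.
Context (A : R -> 'M[R]_p) (F : R -> V -> V) (C Cd : R -> coef).
Hypothesis HA : loc_integrable A.
Hypothesis HB : forall t, bounded_coef B (C t).
Hypothesis HC : forall t0 t1 r c, t0 <= t1 ->
  abs_cont t0 t1 (fun t => C t r c) (fun t => Cd t r c).
Hypothesis mF : forall x r, Lmeasurable setT (fun t => F t x r 0).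
Hypothesis cF : {ae leb, forall t, continuous (F t)}.

Notation down t := (shear M ep (C t)).

Let Pc (f : R -> R) := Lmeasurable setT f.
Let Pcst c : Pc (fun=> c). Proof. exact: measurable_cst. Qed.
Let Padd f g : Pc f -> Pc g -> Pc (fun x => f x + g x).
Proof. by move=> mf mg; apply: measurable_funD; [exact: mf|exact: mg]. Qed.
Let Pmul f g : Pc f -> Pc g -> Pc (fun x => f x * g x).
Proof. by move=> mf mg; apply: measurable_funM; [exact: mf|exact: mg]. Qed.

Lemma coef_meas r c : Lmeasurable setT (fun t => C t r c).
Proof. by apply: cont_on_all_meas => a b ab; exact: abs_cont_con (HC r c ab). Qed.

Lemma dcoef_meas r c : Lmeasurable setT (fun t => Cd t r c).
Proof. by apply: locint_meas => a b ab; exact: (HC r c ab).1. Qed.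

Lemma matrix_meas i i' : Lmeasurable setT (fun t => A t i i').
Proof. by apply: locint_meas => a b ab; exact: HA. Qed.

Lemma hpoly_meas (c : R -> coef) (z : V) r : (forall d, Lmeasurable setT (fun t => c t r d)) ->
  Lmeasurable setT (fun t => hpoly (c t) z r 0).
Proof.
move=> mc; under eq_fun do rewrite mxE.
apply: (class_sum Pcst Padd) => d _; apply: Pmul; [exact: mc|exact: Pcst].
Qed.

Lemma shear_entry t y r : down t y r 0 = y r 0 + -1 * hpoly (C t) (satv M ep y) r 0.
Proof. by rewrite mulN1r mxE [X in _ + X = _]mxE. Qed.

Lemma shear_time_continuous y : continuous (fun t => down t y).
Proof.
have -> : (fun t => down t y) = (fun t => \col_r down t y r 0).
  by apply/funext => u; apply/matrixP => i j; rewrite ord1 [RHS]mxE.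
move=> t; apply: continuous_col => r; move: t.
apply: (@cont_on_continuous R (fun t => down t y r 0)) => a b ab.
pose g c (t s : R) := C t r c * - \prod_q satv M ep y (c q) 0.
have -> : (fun t => down t y r 0) = (fun t => y r 0 + \sum_c g c t t).
  apply/funext => t; rewrite shear_entry mxE mulr_sumr; congr (_ + _).
  by apply: eq_bigr => c _; rewrite /g; ring.
apply: (@diag_contD R a b (fun _ _ => y r 0) (fun t s => \sum_c g c t t)); first exact: diag_cont_cst.
apply: (@diag_cont_sum R a b _ _ _ (fun c t s => g c t t)) => c _.
apply: (@diag_contM R a b (fun t _ => C t r c) (fun _ _ => - \prod_q satv M ep y (c q) 0)); last exact: diag_cont_cst.
exact: abs_cont_con (HC r c ab).
Qed.

Lemma mulmx_meas q (X : R -> 'M[R]_(p, q)) (Z : R -> 'M[R]_(q, 1)) r :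
  (forall i i', Lmeasurable setT (fun t => X t i i')) ->
  (forall i, Lmeasurable setT (fun t => Z t i 0)) ->
  Lmeasurable setT (fun t => (X t *m Z t) r 0).
Proof.
move=> mX mZ; under eq_fun do rewrite mxE.
by apply: (class_sum Pcst Padd) => i _; apply: Pmul; [exact: mX|exact: mZ].
Qed.

Lemma nform_meas y r : Lmeasurable setT (fun t => nform M ep A F C Cd t y r 0).
Proof.
have mdown i : Lmeasurable setT (fun t => down t y i 0).
  under eq_fun do rewrite shear_entry.
  apply: Padd; first exact: Pcst.
  apply: Pmul; first exact: Pcst.
  by apply: hpoly_meas => d; exact: coef_meas.
have mjac i i' : Lmeasurable setT (fun t => jac M ep (C t) y y i i').
  apply: (@class_jac R R Pc Pcst Padd Pmul _ p kap M ep M_even C (fun=> y) (fun=> y)).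
  - by move=> f _ mf; exact: Lmeasurable_inv.
  - exact: coef_meas.
  - by move=> i0; exact: Pcst.
  - by move=> i0; exact: Pcst.
have minv i i' : Lmeasurable setT (fun t => invmx (jac M ep (C t) y y) i i').
  apply: (@class_invmx R R Pc Pcst Padd Pmul p (fun t => jac M ep (C t) y y)).
  - by move=> t; apply: (jac_unit ep_gt0 M_even M_gt1 ep_small); exact: HB.
  - exact: mjac.
  - by apply: Lmeasurable_inv; apply: (@class_det R R Pc Pcst Padd Pmul); exact: mjac.
have E t : nform M ep A F C Cd t y r 0 = (invmx (jac M ep (C t) y y) *m
    (A t *m down t y + F t (down t y) + hpoly (Cd t) (satv M ep y))) r 0 + -1 * (A t *m y) r 0.
  by rewrite mulN1r mxE [X in _ + X = _]mxE.
under eq_fun do rewrite E.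
apply: Padd; last first.
  apply: Pmul; first exact: Pcst.
  by apply: mulmx_meas; [exact: matrix_meas|move=> i; exact: Pcst].
apply: mulmx_meas; first exact: minv.
move=> i.
have E' t : (A t *m down t y + F t (down t y) + hpoly (Cd t) (satv M ep y)) i 0 =
    (A t *m down t y) i 0 + F t (down t y) i 0 + hpoly (Cd t) (satv M ep y) i 0.
  by rewrite mxE [X in X + _ = _]mxE.
under eq_fun do rewrite E'.
apply: Padd; last by apply: hpoly_meas => d; exact: dcoef_meas.
apply: Padd; first by apply: mulmx_meas; [exact: matrix_meas|exact: mdown].
apply: (@superposition_meas R p (fun t x => F t x i 0) (fun t => down t y)).
- by move=> x; exact: mF.
- apply: ae_imply cF => t ct x.
  by apply: (@continuous_comp _ _ _ (F t) (fun z : V => z i 0)); [exact: ct|exact: coord_continuous].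
- exact: shear_time_continuous.
Qed.

End NormalFormMeasurable.

Section Scaling.
Context {R : realType} (mu psi : R -> R).
Hypothesis hmu : differentiable_growth_rate mu.
Hypothesis hpsi : uniformly_admissible mu psi.

Lemma uniformly_admissible_scale c : 0 <= c -> uniformly_admissible mu (fun t => c * psi t).
Proof.
move=> c0; have p0 := psi_ge0 hpsi.
have mw t g : Lmeasurable setT (fun s => psi s * (mu t / mu s) `^ g) by exact: Lmeasurable_weight.
have scale (D : set R) (w : R -> R) : measurable (D : set (lebesgueType R)) -> (forall s, 0 <= w s) ->
    Lmeasurable setT (fun s => psi s * w s) ->
    (\int[leb]_(s in D) (c * psi s * w s)%:E = c%:E * \int[leb]_(s in D) (psi s * w s)%:E)%E.
  move=> mD w0 mpw; rewrite -ge0_integralZl_EFin; [|exact: mD| | |exact: c0].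
  - by apply: eq_integral => s _; rewrite -EFinM mulrA.
  - by move=> s _; rewrite lee_fin mulr_ge0.
  - by apply/measurable_EFinP; exact: (@LmeasurableS R _ setT _ measurableT (@subsetT _ _) mpw).
have fin (X Y : \bar R) : (0 <= X)%E -> (0 <= Y)%E -> (X + Y < +oo)%E -> (c%:E * X + c%:E * Y < +oo)%E.
  move=> X0 Y0 XY; rewrite -ge0_muleDr//.
  by rewrite lte_mul_pinfty.
have i0 (D : set R) (w : R -> R) : (forall s, 0 <= w s) -> (0 <= \int[leb]_(s in D) (psi s * w s)%:E)%E.
  by move=> w0; apply: integral_ge0 => s _; rewrite lee_fin mulr_ge0.
have muE s g : mu s `^ g = (mu 0 / mu s) `^ (- g).
  have [[_ _ -> _ _] _] := hmu; rewrite mul1r -(powR_inv1 (ltW (mu_gt0 hmu s))) -powRrM.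
  by rewrite mulrNN mul1r.
split; first split.
- by apply: measurable_funM; [exact: measurable_cst|case: hpsi => -[]].
- by move=> t; rewrite mulr_ge0.
- move=> delta t d0; have [[_ _ /(_ _ t d0) H] _] := hpsi.
  rewrite !scale; first (by apply: fin => //; apply: i0 => s; exact: powR_ge0);
    try (by exact: Lm_itv); try (by move=> s; exact: powR_ge0).
    by under eq_fun do rewrite muE; exact: mw.
  by under eq_fun do rewrite muE; exact: mw.
move=> delta d0; have [_ /(_ _ d0) H] := hpsi.
apply: le_lt_trans (_ : c%:E * ereal_sup (range (fun t : R =>
       \int[leb]_(s in `]-oo, t]) (psi s * (mu t / mu s) `^ (- delta))%:E
       + \int[leb]_(s in `[t, +oo[) (psi s * (mu t / mu s) `^ delta)%:E)) < +oo)%E; last first.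
  by rewrite lte_mul_pinfty.
apply: ge_ereal_sup => _ [t _ <-].
rewrite !scale; try (by exact: Lm_itv); try (by move=> s; exact: powR_ge0); try (exact: mw).
rewrite -ge0_muleDr; try (by apply: i0 => s; exact: powR_ge0).
apply: lee_wpmul2l; first by rewrite lee_fin.
by apply: ereal_sup_ubound; exists t.
Qed.

Lemma jet_bound_derivative_bound p l (S : set R) (G : R -> 'cV[R]_p -> 'cV[R]_p) :
  {ae leb, forall t, S t} -> (forall r, jet_bound S l psi (fun t x => G t x r 0)) ->
  exists2 psi', uniformly_admissible mu psi' & derivative_bound l G psi'.
Proof.
move=> aeS HG; have p0 t : S t -> 0 <= psi t by move=> _; exact: (psi_ge0 hpsi).
have /choice[K HK] : forall r, exists C, 0 <= C /\ forall t vs, S t -> (size vs <= l)%N ->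
    `|nder (fun x => G t x r 0) vs 0| <= C * psi t * \prod_(v <- vs) `|v|.
  by move=> r; have [C C0 HC] := jet_bound_nder_bound p0 (HG r); exists C.
have sK : 0 <= \sum_r K r by apply: sumr_ge0 => r _; exact: (HK r).1.
exists (fun t => (\sum_r K r) * psi t); first exact: uniformly_admissible_scale.
apply: ae_imply aeS => t St vs /andP[_ svs].
have v0 : 0 <= \prod_(v <- vs) `|v| by apply: prodr_ge0 => v _.
apply: normrM_le => [|r i]; first by rewrite mulr_ge0// mulr_ge0// p0.
have eta : G t = (fun x => \col_r G t x r 0).
  by apply/funext => x; apply/matrixP => i' j'; rewrite ord1 mxE.
have sm : forall ws, (size ws < l)%N -> forall x, differentiable (nder (G t) ws) x.
  by rewrite eta; exact: (@jet_bound_Cn R R S t p p l psi (fun t r x => G t x r 0) St HG).1.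
rewrite ord1; have := nder_coord r sm svs => /(congr1 (fun f => f 0)) <-.
rewrite (le_trans ((HK r).2 t vs St svs))// ler_wpM2r// ler_wpM2r ?p0//.
by rewrite (bigD1 r)//= lerDl sumr_ge0// => i' _; exact: (HK i').1.
Qed.

End Scaling.

Section GoodTimes.
Context {R : realType} (p l : nat) (F : R -> 'cV[R]_p -> 'cV[R]_p) (psi : R -> R).
Hypothesis l_gt0 : (0 < l)%N.
Hypothesis hF : Cn_caratheodory l setT F.
Hypothesis F0 : forall t, F t 0 = 0.
Hypothesis hDF0 : {ae leb, forall t, forall v, nder (F t) [:: v] 0 = 0}.
Hypothesis psi0 : forall t, 0 <= psi t.
Hypothesis hbound : derivative_bound l F psi.

(** Finitely many basis tuples carry all derivatives, so a single null set
    serves for all of them. *)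
Lemma good_times : exists S : set R, [/\ {ae leb, forall t, S t},
  (forall t, S t -> forall vs, (size vs < l)%N -> forall x, differentiable (nder (F t) vs) x),
  (forall t, S t -> continuous (F t)),
  (forall r, jet_bound S l psi (fun t x => F t x r 0)) &
  (forall t, S t -> forall r v, 'd (fun x => F t x r 0) 0 v = 0)].
Proof.
have [H1 H2 H3] := hF.
have iT : is_interval [set: R] by [].
have oT : open [set: 'cV[R]_p] by exact: openT.
have sT : [set: R] `*` [set: 'cV[R]_p] `<=` setT by [].
have cont bs : (size bs <= l)%N ->
    {ae leb, forall t, continuous (nder (F t) (map (@bvec R p) bs))}.
  case: bs => [_|b bs s].
    by apply: ae_imply (H1 _ _ iT oT sT).1 => t Ht x; exact: Ht.
  have s' : (1 <= size (map (@bvec R p) (b :: bs)) <= l)%N by rewrite size_map.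
  by apply: ae_imply (H3 _ s' _ _ iT oT sT).1 => t Ht x; exact: Ht.
have contall : {ae leb, forall t, forall bs, (size bs <= l)%N ->
    continuous (nder (F t) (map (@bvec R p) bs))}.
  have := @ae_all R {m : 'I_l.+1 & m.-tuple 'I_p}
    (fun k t => continuous (nder (F t) (map (@bvec R p) (tagged k)))).
  move=> /(_ _)/ae_imply; apply.
    by move=> t Ht bs s; exact: (Ht (Tagged (fun m : 'I_l.+1 => m.-tuple 'I_p) (in_tuple bs : (Ordinal (s : (size bs < l.+1)%N)).-tuple 'I_p))).
  by case=> m bs /=; apply: cont; rewrite size_tuple -ltnS.
have diffall := H2 _ _ iT oT sT.
pose S : set R := [set t | ((forall bs, (size bs <= l)%N ->
    continuous (nder (F t) (map (@bvec R p) bs))) /\ (forall x, nderivable l (F t) x)) /\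
   ((forall v, nder (F t) [:: v] 0 = 0) /\ (forall vs, (2 <= size vs <= l)%N ->
     `|nder (F t) vs 0| <= psi t * \prod_(v <- vs) `|v|))].
have dS t : S t -> forall vs, (size vs < l)%N -> forall x, differentiable (nder (F t) vs) x.
  by move=> [[_ H] _] vs s x; exact: H.
exists S; split.
- apply: ae_and; apply: ae_and => //.
  by apply: ae_imply diffall => t Ht x; exact: Ht.
- exact: dS.
- by move=> t [[H _] _]; exact: (H [::]).
- move=> r; apply: nder_jet_bound.
  + move=> t bs St s x; have s' : (size (map (@bvec R p) bs) < l)%N by rewrite size_map.
    rewrite (nder_coord r (dS t St) (ltnW s')).
    exact: (diff_comp_fun (dS t St _ s' x) (differentiable_coord _ _ _)).1.
  + move=> t bs St s; have s' : (size (map (@bvec R p) bs) <= l)%N by rewrite size_map.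
    rewrite (nder_coord r (dS t St) s') => x.
    apply: (@continuous_comp _ _ _ (nder (F t) (map (@bvec R p) bs)) (fun z : 'cV[R]_p => z r 0) x).
      exact: (St.1.1 bs s x).
    exact: coord_continuous.
  + move=> bs s; have s' : (size (map (@bvec R p) bs) <= l)%N by rewrite size_map.
    exists 1 => t St; rewrite mul1r (nder_coord r (dS t St) s').
    case: bs s s' => [|b [|b' bs]] s s'.
    * by rewrite /= F0 mxE normr0.
    * by rewrite [map _ _]/= (St.2.1 (bvec b)) mxE normr0.
    * rewrite (le_trans (normrV_ge _ _))//.
      have s2 : (2 <= size (map (@bvec R p) [:: b, b' & bs]) <= l)%N by [].
      rewrite (le_trans (St.2.2 _ s2))// ler_piMr//.
      elim: [:: b, b' & bs] => [|c cs IH]; first by rewrite big_nil.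
      rewrite /= big_cons mulr_ile1//; last exact: norm_bvec.
      by apply: prodr_ge0 => v _.
- move=> t St r v.
  have := nder_coord r (dS t St) (vs := [:: v]) l_gt0 => /(congr1 (fun f => f 0)).
  rewrite (St.2.1 v) mxE; exact.
Qed.

End GoodTimes.

(** * Symmetry of iterated derivatives *)

Section Symmetry.
Context {R : realType} (p : nat).
Notation V := 'cV[R]_p.
Implicit Types (f : V -> R).

Lemma close_pair (a b c d e : R) : c = d -> `|a - c| <= e / 2 -> `|b - d| <= e / 2 ->
  `|a - b| <= e + 0.
Proof.
move=> -> h1 h2; have -> : a - b = (a - d) - (b - d) by ring.
by rewrite addr0 (le_trans (ler_normB _ _))// [leRHS]splitr; exact: lerD.
Qed.

(** Second differences are symmetric and equal second derivatives at nearby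
    points. *)
Lemma schwarz f u v :
  (forall ws, (size ws < 2)%N -> forall x, differentiable (nder f ws) x) ->
  (forall ws, (size ws <= 2)%N -> continuous (nder f ws)) ->
  nder f [:: u; v] = nder f [:: v; u].
Proof.
move=> df cf; apply/funext => x.
set a := nder f _ x; set b := nder f _ x.
apply/eqP; rewrite -subr_eq0 -normr_le0; apply/ler_addgt0Pl => e e0.
have e2 : 0 < e / 2 by rewrite divr_gt0.
have near0 (g : V -> R) : continuous g -> exists2 dl : R, 0 < dl & forall y, `|y - x| < dl -> `|g x - g y| <= e / 2.
  move=> cg; have /cvgrPdist_le/(_ _ e2)/nbhs_ballP[dl /= dl0 H] := cg x.
  by exists dl => // y yx; apply: H; rewrite -ball_normE /= distrC.
have [d1 d10 H1] := near0 _ (cf [:: u; v] isT).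
have [d2 d20 H2] := near0 _ (cf [:: v; u] isT).
have q0 : 0 < `|u| + `|v| + 1 by rewrite ltr_wpDl ?addr_ge0.
have m0 : 0 < Num.min d1 d2 by rewrite lt_min d10 d20.
have [s s0 small] : exists2 s : R, 0 < s & s * (`|u| + `|v|) < Num.min d1 d2.
  exists (Num.min d1 d2 / (`|u| + `|v| + 1)); first by rewrite divr_gt0.
  by rewrite mulrAC ltr_pdivrMr// ltr_pM2l// ltrDl.
have sz w w' : \sum_(z <- [:: s *: w; s *: w']) `|z| = s * (`|w| + `|w'|).
  by rewrite !big_cons big_nil addr0 mulrDr !normrZ gtr0_norm.
have [xi1 X1 E1] := @fdiff_nder R p f 2 [:: s *: v; s *: u] isT df x.
have [xi2 X2 E2] := @fdiff_nder R p f 2 [:: s *: u; s *: v] isT df x.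
have E : fdiff f [:: s *: v; s *: u] x = fdiff f [:: s *: u; s *: v] x.
  by rewrite /= [x + _ + _]addrAC; ring.
have sc w w' y : nder f (rev [:: s *: w; s *: w']) y = s ^+ 2 * nder f [:: w'; w] y.
  have := @nder_scale R p f 2 s [:: w'; w] df isT => /(congr1 (fun g => g y)) <-.
  by [].
have {}E : nder f [:: u; v] xi1 = nder f [:: v; u] xi2.
  apply: (mulfI (x := s ^+ 2)); first by rewrite expf_neq0 ?gt_eqF.
  by rewrite -!sc; apply: etrans (esym E1) _; rewrite E; exact: E2.
rewrite sz [`|v| + `|u|]addrC in X1; rewrite sz in X2.
have h1 : `|a - nder f [:: u; v] xi1| <= e / 2.
  apply: H1; apply: (le_lt_trans X1); apply: (lt_le_trans small).
  by rewrite ge_min lexx.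
have h2 : `|b - nder f [:: v; u] xi2| <= e / 2.
  apply: H2; apply: (le_lt_trans X2); apply: (lt_le_trans small).
  by rewrite ge_min lexx orbT.
exact: (close_pair E h1 h2).
Qed.

Lemma nder_cat (W U : normedModType R) (f : W -> U) vs ws : nder f (vs ++ ws) = nder (nder f ws) vs.
Proof. by elim: vs => [//|v vs IH] /=; rewrite IH. Qed.

Section Perm.
Context (l : nat) (f : V -> R).
Hypothesis df : forall ws, (size ws < l)%N -> forall x, differentiable (nder f ws) x.
Hypothesis cf : forall ws, (size ws <= l)%N -> continuous (nder f ws).

Lemma nder_swap ps u v ws : (size (ps ++ u :: v :: ws) <= l)%N ->
  nder f (ps ++ u :: v :: ws) = nder f (ps ++ v :: u :: ws).
Proof.
rewrite size_cat /= => s.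
have sw : ((size ws).+2 <= l)%N by apply: leq_trans s; exact: leq_addl.
rewrite !nder_cat; congr (nder _ ps).
rewrite -[u :: v :: ws]/([:: u; v] ++ ws) -[v :: u :: ws]/([:: v; u] ++ ws) !nder_cat.
apply: schwarz => ws' s' ; rewrite -nder_cat.
  move=> x; apply: df; rewrite size_cat; apply: leq_trans sw.
  by rewrite -addSn -addn2 addnC leq_add2l.
by apply: cf; rewrite size_cat (leq_trans _ sw)// -addn2 addnC leq_add2l.
Qed.

Lemma nder_move v s ws : (size (v :: s ++ ws) <= l)%N ->
  nder f (v :: s ++ ws) = nder f (s ++ v :: ws).
Proof.
suff H ps : (size (ps ++ v :: s ++ ws) <= l)%N ->
    nder f (ps ++ v :: s ++ ws) = nder f (ps ++ s ++ v :: ws) by exact: (H [::]).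
elim: s ps => [//|u s IH] ps sz.
rewrite /= nder_swap// -cat_rcons IH; first by rewrite -cats1 -catA.
by move: sz; rewrite !size_cat size_rcons /= !addnS !addSn !size_cat.
Qed.

Lemma nder_catCA s1 s2 s3 : (size (s1 ++ s2 ++ s3) <= l)%N ->
  nder f (s1 ++ s2 ++ s3) = nder f (s2 ++ s1 ++ s3).
Proof.
elim: s1 => [//|v s1 IH] sz.
rewrite -[(v :: s1) ++ s3]/(v :: (s1 ++ s3)) -nder_move; last first.
  by move: sz; rewrite /= !size_cat addnCA.
by rewrite /= IH//; exact: ltnW.
Qed.

(** Adjacent transpositions, applied as block exchanges. *)
Lemma nder_perm vs ws : (size vs <= l)%N -> perm_eq vs ws -> nder f vs = nder f ws.
Proof.
move=> s pvw.
apply: (@catCA_perm_ind _ (fun ws => (size ws <= l)%N -> nder f vs = nder f ws) _ vs ws) => //.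
  move=> s1 s2 s3 H sz; rewrite -nder_catCA; first apply: H.
    by move: sz; rewrite !size_cat addnCA.
  by move: sz; rewrite !size_cat addnCA.
by rewrite -(perm_size pvw).
Qed.

End Perm.
End Symmetry.

(** * Symmetric multilinear forms and their diagonals *)

Section DiagonalForm.
Context {R : realType} (p N : nat).
Notation V := 'cV[R]_p.
Context (T : seq V -> R).
Hypothesis Tlin : forall v ws, (size ws).+1 = N ->
  T (v :: ws) = \sum_i v i 0 * T (bvec i :: ws).
Hypothesis Tperm : forall vs ws, size vs = N -> perm_eq vs ws -> T vs = T ws.

(** Derivative of a diagonal: m equal contributions, by symmetry. *)
Lemma form_diag m ws : (m + size ws)%N = N -> forall y,
  differentiable (fun y => T (nseq m y ++ ws)) y /\
  forall v, 'd (fun y => T (nseq m y ++ ws)) y v = m%:R * T (v :: nseq m.-1 y ++ ws).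
Proof.
elim: m ws => [|m IH] ws sN y.
  have [d1 d2] := diff_const (T ws) y; split=> // v.
  by apply: etrans (d2 v) _; rewrite mul0r.
have perm_e e z : T (e :: nseq m z ++ ws) = T (nseq m z ++ e :: ws).
  apply: Tperm; first by rewrite /= size_cat size_nseq.
  by rewrite -[e :: (_ ++ _)]/([:: e] ++ nseq m z ++ ws) perm_catCA.
have fE : (fun z : V => T (nseq m.+1 z ++ ws)) =
    (fun z => \sum_(i < p) z i 0 * T (nseq m z ++ bvec i :: ws)).
  apply/funext => z; rewrite /= Tlin; last by rewrite size_cat size_nseq.
  by apply: eq_bigr => i _; rewrite perm_e.
have IHi (i : 'I_p) := IH (bvec i :: ws) (etrans (addnS _ _) sN) y.
have dc (i : 'I_p) : differentiable (fun z : V => z i 0) y by exact: differentiable_coord.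
have Mi i := diffM_fun (dc i) (IHi i).1.
rewrite fE; have [d1 d2] := @diff_bigsum R V R 'I_p (index_enum 'I_p)
  (fun i z => z i 0 * T (nseq m z ++ bvec i :: ws)) y (fun i => (Mi i).1).
split=> // v; apply: etrans (d2 v) _.
transitivity (\sum_(i < p) (y i 0 * (m%:R * T (v :: nseq m.-1 y ++ bvec i :: ws)) +
    T (nseq m y ++ bvec i :: ws) * v i 0)).
  apply: eq_bigr => i _; apply: etrans ((Mi i).2 v) _.
  by congr (_ * _ + _ * _); [exact: (IHi i).2|exact: diff_coord].
rewrite big_split /= -[m.+1%:R]natr1 mulrDl mul1r; congr (_ + _); last first.
  rewrite [RHS]Tlin; last by rewrite size_cat size_nseq.
  by apply: eq_bigr => i _; rewrite mulrC perm_e.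
under eq_bigr do rewrite mulrCA.
rewrite -mulr_sumr; case: m sN {IH perm_e fE IHi dc Mi d1 d2} => [|m] sN; first by rewrite !mul0r.
congr (_ * _); rewrite /=.
have -> : T (v :: y :: nseq m y ++ ws) = T (y :: v :: nseq m y ++ ws).
  apply: Tperm; first by rewrite /= size_cat size_nseq.
  by rewrite -[X in perm_eq X _]/([:: v] ++ [:: y] ++ nseq m y ++ ws) perm_catCA.
rewrite Tlin; last by rewrite /= size_cat size_nseq.
apply: eq_bigr => i _; congr (_ * _); apply: Tperm; first by rewrite /= size_cat size_nseq /= addnS.
rewrite -[X in perm_eq _ X]/([:: bvec i] ++ (v :: nseq m y) ++ ws) perm_sym perm_catCA.
by [].
Qed.

Lemma form_nder m vs ws : (m + size ws)%N = N -> (size vs <= m)%N ->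
  nder (fun y => T (nseq m y ++ ws)) vs =
  (fun y => (m ^_ size vs)%:R * T (nseq (m - size vs) y ++ vs ++ ws)).
Proof.
move=> sN; elim: vs => [_|v vs IH sv].
  by apply/funext => y; rewrite subn0 mul1r.
rewrite /= IH ?(ltnW sv)//; apply/funext => y.
have sz : (m - size vs + size (vs ++ ws))%N = N.
  by rewrite size_cat addnA subnK ?sN// ltnW.
have [d1 d2] := form_diag sz y.
have [e1 e2] := diff_const ((m ^_ size vs)%:R : R) y.
apply: etrans ((diffM_fun e1 d1).2 v) _.
transitivity ((m ^_ size vs)%:R * ((m - size vs)%:R * T (v :: nseq (m - size vs).-1 y ++ vs ++ ws)) +
    T (nseq (m - size vs) y ++ vs ++ ws) * 0).
  by congr (_ * _ + _ * _); [exact: d2|exact: e2].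
rewrite mulr0 addr0 mulrA -natrM ffactnSr; congr (_ * _).
apply: Tperm.
  by rewrite /= size_cat size_nseq -addSn prednK ?subn_gt0.
rewrite -[X in perm_eq X _]/([:: v] ++ _ ++ _) perm_catCA.
by rewrite subnS.
Qed.

Lemma form_nder_full vs : size vs = N -> nder (fun y => T (nseq N y)) vs 0 = N`!%:R * T vs.
Proof.
move=> sv; have -> : (fun y => T (nseq N y)) = (fun y => T (nseq N y ++ [::])).
  by apply/funext => y; rewrite cats0.
by rewrite form_nder ?addn0 ?sv// ffactnn subnn /= cats0.
Qed.

Lemma form_nder_low vs : (size vs < N)%N -> nder (fun y => T (nseq N y)) vs 0 = 0.
Proof.
move=> sv; have -> : (fun y => T (nseq N y)) = (fun y => T (nseq N y ++ [::])).
  by apply/funext => y; rewrite cats0.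
rewrite form_nder ?addn0// ?(ltnW sv)// cats0.
case E : (N - size vs)%N => [|m]; first by move: sv; rewrite -subn_gt0 E.
rewrite /= Tlin; last first.
  by rewrite size_cat size_nseq -addSn -E subnK// ltnW.
by rewrite big1 ?mulr0// => i _; rewrite mxE mul0r.
Qed.

End DiagonalForm.

Section Expansion.
Context {R : realType} (p : nat).
Notation V := 'cV[R]_p.

Definition basis_seq m (c : {ffun 'I_m -> 'I_p}) : seq V := [seq bvec (c q) | q <- enum 'I_m].

Definition fcons m (i : 'I_p) (c : {ffun 'I_m -> 'I_p}) : {ffun 'I_m.+1 -> 'I_p} :=
  [ffun q => if unlift ord0 q is Some q' then c q' else i].

Lemma fcons0 m i (c : {ffun 'I_m -> 'I_p}) : fcons i c ord0 = i.
Proof. by rewrite ffunE unlift_none. Qed.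

Lemma fconsS m i (c : {ffun 'I_m -> 'I_p}) q : fcons i c (lift ord0 q) = c q.
Proof. by rewrite ffunE liftK. Qed.

Lemma big_fcons m (f : {ffun 'I_m.+1 -> 'I_p} -> R) :
  \sum_c f c = \sum_i \sum_(c : {ffun 'I_m -> 'I_p}) f (fcons i c).
Proof.
rewrite pair_bigA /= (reindex (fun x : 'I_p * {ffun 'I_m -> 'I_p} => fcons x.1 x.2))//=.
apply: onW_bij; exists (fun c : {ffun 'I_m.+1 -> 'I_p} => (c ord0, [ffun q => c (lift ord0 q)])).
  by move=> [i c] /=; rewrite fcons0; congr pair; apply/ffunP => q; rewrite ffunE fconsS.
move=> c; apply/ffunP => q; rewrite ffunE.
by case: unliftP => [q' ->|->]; rewrite ?ffunE.
Qed.

Lemma basis_seq_cons m i (c : {ffun 'I_m -> 'I_p}) : basis_seq (fcons i c) = bvec i :: basis_seq c.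
Proof.
rewrite /basis_seq enum_ordSl /= fcons0 -map_comp; congr cons.
by apply: eq_map => q /=; rewrite fconsS.
Qed.

Lemma size_basis_seq m (c : {ffun 'I_m -> 'I_p}) : size (basis_seq c) = m.
Proof. by rewrite size_map size_enum_ord. Qed.

Lemma multilinear_expansion m (Q : seq V -> R) :
  (forall ps v ws, size (ps ++ v :: ws) = m ->
    Q (ps ++ v :: ws) = \sum_i v i 0 * Q (ps ++ bvec i :: ws)) ->
  forall ws, size ws = m ->
  Q ws = \sum_(c : {ffun 'I_m -> 'I_p}) Q (basis_seq c) * \prod_(q < m) (nth 0 ws q : V) (c q) 0.
Proof.
elim: m Q => [|m IH] Q Qlin ws.
  move=> /size0nil ->.
  have [c0 Hc] : exists c0 : {ffun 'I_0 -> 'I_p}, forall c, c = c0.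
    exists (ffun0 (card_ord 0)) => c.
    by apply/ffunP => -[].
  rewrite (bigD1 c0)//= big_ord0 mulr1 big1 ?addr0 => [|c]; last by rewrite (Hc c) eqxx.
  by rewrite /basis_seq; have -> : enum 'I_0 = [::] by apply/size0nil; rewrite size_enum_ord.
case: ws => [//|v ws] [sw].
rewrite (Qlin [::]) /= ?sw// big_fcons; apply: eq_bigr => i _.
rewrite (IH (fun l => Q (bvec i :: l)))//; last first.
  by move=> ps u us su; apply: (Qlin (bvec i :: ps)); rewrite /= su.
rewrite mulr_sumr; apply: eq_bigr => c _.
rewrite basis_seq_cons big_ord_recl /= fcons0 mulrCA; congr (_ * (_ * _)).
by apply: eq_bigr => q _; rewrite fconsS.
Qed.

End Expansion.

(** * Block types and block derivatives *)

Section TypeForm.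
Context {R : realType} (p n kap : nat) (blk : 'I_p -> 'I_n) (k : {ffun 'I_n -> nat}).
Notation V := 'cV[R]_p.
Notation midx := {ffun 'I_kap -> 'I_p}.
Context (l : nat) (f : V -> R).
Hypothesis df : forall ws, (size ws < l)%N -> forall x, differentiable (nder f ws) x.
Hypothesis cf : forall ws, (size ws <= l)%N -> continuous (nder f ws).
Hypothesis kl : (kap <= l)%N.
Hypothesis kap_gt0 : (0 < kap)%N.

Definition tcoef (c : midx) : R := if has_type blk k c then nder f (basis_seq c) 0 else 0.

(** The part of block type k of the |k|-th derivative at 0, as a multilinear
    form in a list of vectors. *)
Definition tform (ws : seq V) : R :=
  \sum_c tcoef c * \prod_(q < kap) (nth 0 ws q : V) (c q) 0.

Lemma tform_lin v ws : (size ws).+1 = kap ->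
  tform (v :: ws) = \sum_i v i 0 * tform (bvec i :: ws).
Proof.
move=> sw; pose q0 := Ordinal kap_gt0.
pose P c := \prod_(q < kap | q != q0) (nth 0 ws q.-1 : V) (c q) 0.
have E w (c : midx) : \prod_(q < kap) (nth 0 (w :: ws) q : V) (c q) 0 = w (c q0) 0 * P c.
  rewrite (bigD1 q0)//=; congr (_ * _); apply: eq_bigr => q qq0.
  case: q qq0 => -[|q] hq qq0 //=; by rewrite -val_eqE eqxx in qq0.
rewrite /tform; under eq_bigr do rewrite E.
under [RHS]eq_bigr do rewrite mulr_sumr; rewrite exchange_big; apply: eq_bigr => c _ /=.
under eq_bigr do rewrite E.
rewrite (bigD1 (c q0))//= mxE !eqxx mul1r big1 ?addr0; first by rewrite mulrCA.
by move=> i ic; rewrite mxE eq_sym (negbTE ic) mul0r !mulr0.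
Qed.

Lemma has_type_perm (s : {perm 'I_kap}) (c : midx) :
  has_type blk k [ffun q => c (s q)] = has_type blk k c.
Proof.
apply: eq_forallb => i; congr (_ == _).
rewrite -!sum1_card (reindex_inj (@perm_inj _ s) (P := mem [pred q | blk (c q) == i])) /=.
by apply: eq_bigl => q; rewrite !inE ffunE.
Qed.

Lemma tcoef_perm (s : {perm 'I_kap}) (c : midx) : tcoef [ffun q => c (s q)] = tcoef c.
Proof.
rewrite /tcoef has_type_perm; case: ifP => // _.
have -> : nder f (basis_seq [ffun q => c (s q)]) = nder f (basis_seq c).
  apply: (nder_perm df cf); first by rewrite size_basis_seq.
  rewrite /basis_seq (eq_map (g := (fun q => bvec (c q)) \o s)); last by move=> q /=; rewrite ffunE.
  rewrite map_comp; apply: perm_map; apply: uniq_perm.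
  - by rewrite map_inj_uniq ?enum_uniq//; exact: perm_inj.
  - exact: enum_uniq.
  - move=> q; rewrite mem_enum; apply/mapP; exists ((s^-1)%g q); first by rewrite mem_enum.
    by rewrite permKV.
by [].
Qed.

(** Permuting the vectors permutes the positions of multi-indices, which
    preserves types, and the derivative is symmetric. *)
Lemma tform_perm vs ws : size vs = kap -> perm_eq vs ws -> tform vs = tform ws.
Proof.
move=> sv pvw; have sw : size ws == kap by rewrite -(perm_size pvw) sv.
move/eqP: sv => sv.
have /tuple_permP[s E] : perm_eq (Tuple sv) (Tuple sw) by [].
rewrite /tform (reindex_inj (h := fun c : midx => [ffun q => c (s q)])) /=; last first.
  move=> c c' /ffunP H; apply/ffunP => q; have := H ((s^-1)%g q).
  by rewrite !ffunE permKV.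
apply: eq_bigr => c _; rewrite tcoef_perm; congr (_ * _).
rewrite [RHS](reindex_inj (@perm_inj _ s)); apply: eq_bigr => q _.
rewrite ffunE; congr ((_ : V) _ 0).
transitivity (tnth [tuple tnth (Tuple sw) (s i)  | i < kap] q).
  by rewrite (tnth_nth 0) -E.
by rewrite tnth_mktuple (tnth_nth 0).
Qed.

Lemma tform_diag y : tform (nseq kap y) = \sum_c tcoef c * \prod_q y (c q) 0.
Proof.
apply: eq_bigr => c _; congr (_ * _); apply: eq_bigr => q _.
by rewrite nth_nseq ltn_ord.
Qed.

Lemma nder_expansion vs : size vs = kap ->
  nder f vs 0 = \sum_(c : midx) nder f (basis_seq c) 0 * \prod_(q < kap) (nth 0 vs q : V) (c q) 0.
Proof.
move=> sv; apply: (@multilinear_expansion R p kap (fun ws => nder f ws 0)) => // ps v ws sz.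
have mv u : nder f (ps ++ u :: ws) = nder f (u :: ps ++ ws).
  by rewrite -(nder_move df cf)// /= size_cat; move: sz; rewrite size_cat /= addnS => ->.
rewrite mv; apply: etrans (diff_pd _ _ _) _.
by apply: eq_bigr => i _; rewrite mv.
Qed.

Section Typed.
Context (vs : seq V) (beta : 'I_kap -> 'I_n).
Hypothesis svs : size vs = kap.
Hypothesis Hbeta : forall q r, blk r != beta q -> (nth 0 vs q : V) r 0 = 0.

Lemma typed_prod (c : midx) :
  (exists q, blk (c q) != beta q) -> \prod_(q < kap) (nth 0 vs q : V) (c q) 0 = 0.
Proof. by move=> [q qb]; rewrite (bigD1 q)//= Hbeta// mul0r. Qed.

(** On vectors lying in blocks of total type k all multi-indices of other types
    have a vanishing factor. *)
Lemma tform_typed : (forall i, #|[pred q | beta q == i]| = k i) -> tform vs = nder f vs 0.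
Proof.
move=> kb; rewrite nder_expansion//; apply: eq_bigr => c _.
rewrite /tcoef; case: ifPn => // nt.
rewrite mul0r typed_prod ?mulr0//.
apply/existsP; apply: contraNT nt => /existsPn H.
apply/forallP => i; rewrite -kb; apply/eqP; apply: eq_card => q; rewrite !inE.
by have := H q; rewrite negbK => /eqP ->.
Qed.

Lemma tform_untyped i : #|[pred q | beta q == i]| <> k i -> tform vs = 0.
Proof.
move=> kb; apply: big1 => c _; rewrite /tcoef; case: ifPn => [ct|_]; last by rewrite mul0r.
rewrite typed_prod ?mulr0//.
apply/existsP; apply: contra_notT kb => /existsPn H.
move/forallP: ct => /(_ i)/eqP <-; apply: eq_card => q; rewrite !inE.
by have := H q; rewrite negbK => /eqP ->.
Qed.

End Typed.
End TypeForm.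

Lemma diff_linear (R : realType) (V W : normedModType R) (L : {linear V -> W}) (y : V) :
  continuous L -> differentiable L y /\ forall v, 'd L y v = L v.
Proof.
move=> cL; split; first exact: linear_differentiable.
by move=> v; rewrite diff_lin.
Qed.

Section BlockDer.
Context {R : realType} (n : nat) (d_ : 'I_n -> nat).
Notation p := (\sum_i d_ i)%N.
Notation V := 'cV[R]_p.
Notation blk := (@tagnat.sig1 n d_).
Notation vecs := {i : 'I_n & 'cV[R]_(d_ i)}.

Lemma set_block_in (x : V) i (u : 'cV[R]_(d_ i)) y : set_block x u (tagnat.Rank i y) 0 = u y 0.
Proof.
have := mxcolK (fun h => dfwith (fun h => submxcol x h) i u h) i.
by move=> /matrixP/(_ y 0); rewrite dfwithin mxE.
Qed.

Lemma set_block_out (x : V) i (u : 'cV[R]_(d_ i)) r : blk r != i -> set_block x u r 0 = x r 0.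
Proof.
move=> ri; have := mxcolK (fun h => dfwith (fun h => submxcol x h) i u h) (blk r).
move=> /matrixP/(_ (tagnat.sig2 r) 0); rewrite mxE tagnat.sig2K dfwithout; last by rewrite eq_sym.
by rewrite [X in _ = X -> _]mxE tagnat.sig2K.
Qed.

Lemma block_index r i : blk r = i -> exists y, r = tagnat.Rank i y.
Proof. by move=> <-; exists (tagnat.sig2 r); rewrite tagnat.sig2K. Qed.

Lemma set_blockE (x : V) i (u : 'cV[R]_(d_ i)) :
  set_block x u = set_block x (0 : 'cV[R]_(d_ i)) + set_block 0 u.
Proof.
apply/matrixP => r c; rewrite ord1 [RHS]mxE.
have [/block_index[y ->]|ri] := eqVneq (blk r) i.
  by rewrite !set_block_in mxE add0r.
by rewrite !set_block_out// mxE addr0.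
Qed.

Lemma set_block_self (x : V) i : set_block x (submxcol x i) = x.
Proof.
apply/matrixP => r c; rewrite ord1.
have [/block_index[y ->]|ri] := eqVneq (blk r) i; last by rewrite set_block_out.
by rewrite set_block_in mxE.
Qed.

Lemma set_block_linear i : linear (fun u : 'cV[R]_(d_ i) => set_block (0 : V) u).
Proof.
move=> a u w; apply/matrixP => r c; rewrite ord1.
have E (X Y : V) : (a *: X + Y) r 0 = a * X r 0 + Y r 0 by rewrite !mxE.
rewrite [RHS]E.
have [/block_index[y ->]|ri] := eqVneq (blk r) i.
  by rewrite !set_block_in !mxE.
by rewrite !set_block_out// mxE mulr0 addr0.
Qed.

Definition set_blockL i : {linear 'cV[R]_(d_ i) -> V} :=
  HB.pack (fun u : 'cV[R]_(d_ i) => set_block (0 : V) u)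
    (GRing.isLinear.Build R _ _ _ _ (@set_block_linear i)).

Definition embed (u : vecs) : V := set_block 0 (tagged u).

Lemma embed_out (u : vecs) r : blk r != tag u -> embed u r 0 = 0.
Proof. by move=> ri; rewrite /embed set_block_out// mxE. Qed.

Lemma diff_set_block (x : V) i (u0 : 'cV[R]_(d_ i)) :
  differentiable (fun u : 'cV[R]_(d_ i) => set_block x u) u0 /\
  forall u, 'd (fun u : 'cV[R]_(d_ i) => set_block x u) u0 u = set_block 0 u.
Proof.
have -> : (fun u : 'cV[R]_(d_ i) => set_block x u) =
    (fun u => set_block x (0 : 'cV[R]_(d_ i)) + set_blockL i u).
  by apply/funext => u; exact: set_blockE.
have cL := @linear_cV_continuous R (d_ i) V (set_blockL i).
have [dL1 dL2] := diff_linear u0 cL.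
have [dC1 dC2] := diff_const (set_block x (0 : 'cV[R]_(d_ i))) u0.
have [d1 d2] := diffD_fun dC1 dL1.
split; first exact: d1.
move=> u; apply: etrans (d2 u) _.
exact: (etrans (congr2 +%R (dC2 u) (dL2 u)) (add0r _)).
Qed.

(** set_block is affine in the inserted block, so a block derivative is the
    derivative along the embedded vector. *)
Lemma block_der_nder (W : normedModType R) l (g : V -> W) (us : seq vecs) :
  (forall ws, (size ws < l)%N -> forall x, differentiable (nder g ws) x) ->
  (size us <= l)%N -> block_der g us = nder g (map embed us).
Proof.
move=> dg; elim: us => [//|[i u] us IH] s.
rewrite [block_der _ _]/= IH ?(ltnW s)//; apply/funext => x; rewrite /partial_der.
have s' : (size (map embed us) < l)%N by rewrite size_map.
have [d1 d2] := diff_set_block x (submxcol x i).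
have d3 : differentiable (nder g (map embed us)) (set_block x (submxcol x i)).
  exact: dg.
have [_ E] := @diff_comp_fun _ _ _ _ (fun u : 'cV[R]_(d_ i) => set_block x u)
  (nder g (map embed us)) (submxcol x i) d1 d3.
apply: etrans (E u) _; rewrite set_block_self.
congr ('d _ x _); exact: d2.
Qed.

Definition multi_vecs (m : {ffun 'I_n -> nat}) (w : forall i, (m i).-tuple 'cV[R]_(d_ i)) : seq vecs :=
  flatten [seq [seq Tagged (fun i => 'cV[R]_(d_ i)) u | u <- w i] | i <- enum 'I_n].

Lemma count_multi_vecs (m : {ffun 'I_n -> nat}) (w : forall i, (m i).-tuple 'cV[R]_(d_ i)) i :
  count (fun u => tag u == i) (multi_vecs w) = m i.
Proof.
rewrite count_flatten -map_comp sumnE big_map big_enum /=.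
rewrite (bigD1 i)//= count_map [X in (X + _)%N](_ : _ = m i); last first.
  rewrite (eq_count (a2 := predT)) ?count_predT ?size_tuple// => u /=; exact: eqxx.
rewrite big1 ?addn0// => h hi; rewrite count_map.
by rewrite (eq_count (a2 := pred0)) ?count_pred0// => u /=; exact: negbTE.
Qed.

Lemma size_multi_vecs (m : {ffun 'I_n -> nat}) (w : forall i, (m i).-tuple 'cV[R]_(d_ i)) :
  size (multi_vecs w) = mdeg m.
Proof.
rewrite size_flatten /shape -map_comp sumnE big_map big_enum /=.
by apply: eq_bigr => i _; rewrite size_map size_tuple.
Qed.

End BlockDer.

(** * The Taylor polynomial of a given block type *)

Section TaylorTerm.
Context {R : realType} (n : nat) (d_ : 'I_n -> nat).
Notation p := (\sum_i d_ i)%N.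
Notation V := 'cV[R]_p.
Notation blk := (@tagnat.sig1 n d_).

Lemma nder_zero (U : normedModType R) vs : nder (fun _ : U => 0 : R) vs = fun=> 0.
Proof.
elim: vs => [//|v vs IH] /=; rewrite IH; apply/funext => x.
exact: (diff_const _ _).2.
Qed.

Lemma multi_der_entries l (S : set R) psi (H : R -> V -> V) t :
  (forall r, jet_bound S l psi (fun t x => H t x r 0)) -> S t ->
  forall (m : {ffun 'I_n -> nat}) (w : forall h, (m h).-tuple 'cV[R]_(d_ h)) i,
  (mdeg m <= l)%N ->
  multi_der (fun x => submxcol (H t x) i) 0 w =
  \col_y nder (fun x => H t x (tagnat.Rank i y) 0) (map (@embed R n d_) (multi_vecs w)) 0.
Proof.
move=> HJ St m w i ml.
have E : (fun x => submxcol (H t x) i) = (fun x => \col_y H t x (tagnat.Rank i y) 0).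
  by apply/funext => x; apply/matrixP => y c; rewrite ord1 !mxE.
have sm := @jet_bound_Cn R R S t p (d_ i) l psi (fun t y x => H t x (tagnat.Rank i y) 0) St
  (fun y => HJ (tagnat.Rank i y)).
rewrite /multi_der -/(multi_vecs w) E.
rewrite (block_der_nder sm.1); last by rewrite size_multi_vecs.
rewrite (@nder_col R V (d_ i) (fun y x => H t x (tagnat.Rank i y) 0) l)//.
  by move=> r ws s x; exact: (@jet_bound_nder_diff _ _ _ _ _ _ _ _ _ x (HJ (tagnat.Rank i r)) St).
by rewrite size_map size_multi_vecs.
Qed.

Context (k : {ffun 'I_n -> nat}) (l : nat) (f : V -> R).
Notation kap := (mdeg k).
Hypothesis df : forall ws, (size ws < l)%N -> forall x, differentiable (nder f ws) x.
Hypothesis cf : forall ws, (size ws <= l)%N -> continuous (nder f ws).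
Hypothesis kl : (kap <= l)%N.
Hypothesis kap_gt0 : (0 < kap)%N.

Lemma count_tags (us : seq {i : 'I_n & 'cV[R]_(d_ i)}) u0 i : size us = kap ->
  #|[pred q : 'I_kap | tag (nth u0 us q) == i]| = count (fun u => tag u == i) us.
Proof. by move=> su; rewrite -sum1_card -sum1_count (big_nth u0) big_mkord su. Qed.

(** The polynomial is the diagonal of a symmetric form divided by |k|!, so its
    derivative of order |k| is that form and the lower ones vanish at 0; on
    vectors of block type m the form is the full derivative if m = k and 0
    otherwise. *)
Lemma nder_type_part (j : 'I_n) (m : {ffun 'I_n -> nat})
    (w : forall h, (m h).-tuple 'cV[R]_(d_ h)) : (mdeg m <= kap)%N ->
  nder (fun y : V => \sum_(c : {ffun 'I_kap -> 'I_p}) (kap`!%:R^-1 * tcoef blk k f c) * \prod_q y (c q) 0)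
    (map (@embed R n d_) (multi_vecs w)) 0 =
  if m == k then nder f (map (@embed R n d_) (multi_vecs w)) 0 else 0.
Proof.
move=> mk; set us := multi_vecs w; set vs := map _ us.
have su : size us = mdeg m by exact: size_multi_vecs.
have sv : size vs = mdeg m by rewrite size_map.
pose T ws : R := kap`!%:R^-1 * @tform R p n kap blk k f ws.
have Tlin (v : V) ws : (size ws).+1 = kap -> T (v :: ws) = \sum_i v i 0 * T (bvec i :: ws).
  move=> sw; rewrite /T (tform_lin _ _ _ kap_gt0)// mulr_sumr.
  by apply: eq_bigr => i _; rewrite mulrCA.
have Tperm (u1 u2 : seq V) : size u1 = kap -> perm_eq u1 u2 -> T u1 = T u2.
  by move=> s1 p12; rewrite /T (tform_perm blk k df cf kl s1 p12).
have -> : (fun y : V => \sum_(c : {ffun 'I_kap -> 'I_p}) (kap`!%:R^-1 * tcoef blk k f c) * \prod_q y (c q) 0) =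
    (fun y => T (nseq kap y)).
  apply/funext => y; rewrite /T tform_diag mulr_sumr.
  by apply: eq_bigr => c _; rewrite mulrA.
have [mk'|mk'] := ltnP (mdeg m) kap.
  rewrite (form_nder_low Tlin Tperm) ?sv//.
  by case: eqP => // E; rewrite E ltnn in mk'.
have sk : mdeg m = kap by apply/eqP; rewrite eqn_leq mk.
rewrite (form_nder_full Tlin Tperm) ?sv// /T mulrA mulfV ?mul1r ?pnatr_eq0 -?lt0n ?fact_gt0//.
have u0 : {i : 'I_n & 'cV[R]_(d_ i)} := Tagged (fun i => 'cV[R]_(d_ i)) (0 : 'cV[R]_(d_ j)).
pose beta (q : 'I_kap) := tag (nth u0 us q).
have Hb (q : 'I_kap) r : blk r != beta q -> (nth 0 vs q : V) r 0 = 0.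
  by move=> rq; rewrite (nth_map u0) ?su ?sk// embed_out.
have cb i : #|[pred q | beta q == i]| = m i.
  by rewrite (count_tags _ _) ?su// count_multi_vecs.
case: eqP => [E|E].
  apply: (tform_typed df cf kl _ Hb); first by rewrite sv.
  by move=> i; rewrite cb E.
have [i mi] : exists i, m i <> k i.
  apply: contrapT => /forallNP H; apply: E; apply/ffunP => i.
  by have := H i => /contrapT.
by apply: (tform_untyped _ Hb (i := i)); rewrite cb.
Qed.

End TaylorTerm.

Section Clamp.
Context {R : realType}.

(** Truncation makes a bound that holds almost everywhere hold everywhere,
    without losing measurability. *)
Definition clamp (b x : R) : R := Num.max (- b) (Num.min b x).

Lemma clamp_le b x : 0 <= b -> `|clamp b x| <= b.
Proof.
move=> b0; rewrite ler_norml /clamp le_max lexx /= ge_max ge_min lexx /= andbT.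
by lra.
Qed.

Lemma clamp_id b x : `|x| <= b -> clamp b x = x.
Proof.
by rewrite ler_norml => /andP[h1 h2]; rewrite /clamp (min_idPr h2) (max_idPr h1).
Qed.

Lemma clamp_meas (b f : R -> R) : Lmeasurable setT b -> Lmeasurable setT f ->
  Lmeasurable setT (fun t => clamp (b t) (f t)).
Proof.
move=> mb mf; apply: measurable_maxr; last by apply: measurable_minr; [exact: mb|exact: mf].
have -> : (fun t => - b t) = (fun t => -1 * b t) by apply/funext => t; rewrite mulN1r.
by apply: measurable_funM; [exact: measurable_cst|exact: mb].
Qed.

Lemma small_scale (Q M : R) kap : 0 <= Q -> (1 < kap)%N ->
  exists2 ep : R, 0 < ep & Q * ep ^+ kap.-1 <= 2^-1.
Proof.
move=> Q0 k1; exists ((2 * Q + 1)^-1); first by rewrite invr_gt0; lra.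
have h0 : 0 < 2 * Q + 1 by lra.
have h1 : (2 * Q + 1)^-1 <= 1 by rewrite invf_le1//; lra.
apply: (@le_trans _ _ (Q * (2 * Q + 1)^-1)).
  rewrite ler_wpM2l// -[leRHS]expr1 ler_wiXn2l//; first by rewrite invr_ge0 ltW.
  by rewrite -ltnS prednK// ltnW.
rewrite ler_pdivrMr//; lra.
Qed.

End Clamp.

(** * Elimination of a nonresonant Taylor term *)

Theorem lemma3p3 (R : realType) (mu : R -> R)
  (hmu : differentiable_growth_rate mu)
  (l : nat) (hl : (0 < l)%N)
  (n : nat) (d_ : 'I_n -> nat) (hd : forall i, (0 < d_ i)%N)
  (A : R -> 'M[R]_(\sum_i d_ i))
  (F : R -> 'cV[R]_(\sum_i d_ i) -> 'cV[R]_(\sum_i d_ i))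
  (hA : loc_integrable A)
  (hbg : uniform_bounded_growth mu A)
  (A_ : forall i : 'I_n, R -> 'M[R]_(d_ i))
  (hdiag : forall t, A t = \mxdiag_i A_ i t)
  (lambda : 'I_n -> R * R)
  (hlam : forall i, spectral_interval (dichotomy_spectrum mu A) (lambda i))
  (hlam_inj : injective lambda)
  (hspec : dichotomy_spectrum mu A = \bigcup_i cint (lambda i))
  (hspec_i : forall i, dichotomy_spectrum mu (A_ i) = cint (lambda i))
  (hF : Cn_caratheodory l setT F)
  (hF0 : forall t, F t 0 = 0)
  (hDF0 : {ae leb, forall t, forall v, nder (F t) [:: v] 0 = 0})
  (psi : R -> R) (hpsi : uniformly_admissible mu psi)
  (hbound : derivative_bound l F psi)
  (j : 'I_n) (k : {ffun 'I_n -> nat})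
  (hk : (2 <= mdeg k <= l)%N)
  (hres : cint (lambda j) `&` cint (\sum_i lambda i *+ k i) = set0) :
  exists G : R -> 'cV[R]_(\sum_i d_ i) -> 'cV[R]_(\sum_i d_ i),
  [/\ Cn_caratheodory l setT G,
      uniformly_locally_equivalent l (fun t x => A t *m x + F t x)
        (fun t x => A t *m x + G t x),
      forall (m : {ffun 'I_n -> nat}) (i : 'I_n), (1 <= mdeg m <= mdeg k)%N ->
        {ae leb, forall t, forall w : forall h, (m h).-tuple 'cV[R]_(d_ h),
           multi_der (fun x => submxcol (G t x) i) 0 w =
           if (m == k) && (i == j) then 0
           else multi_der (fun x => submxcol (F t x) i) 0 w} &
      exists2 psi', uniformly_admissible mu psi' & derivative_bound l G psi'].
Proof.
have [Phi HPhi Hgrow] := hbg.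
have /andP[k2 kl] := hk.
have k1 : (0 < mdeg k)%N by exact: ltnW.
have psi0 : forall t, 0 <= psi t by exact: psi_ge0 hpsi.
have [S0 [aeS0 dS0 cS0 jS0 DS0]] := good_times hl hF hF0 hDF0 psi0 hbound.
(* the times at which every almost everywhere hypothesis holds *)
pose S : set R := [set t | S0 t /\ forall vs : seq 'cV[R]_(\sum_i d_ i), (2 <= size vs <= l)%N ->
     `|nder (F t) vs 0| <= psi t * \prod_(v <- vs) `|v|].
have aeS : {ae leb, forall t, S t} := ae_and aeS0 hbound.
have jS r : jet_bound S l psi (fun t x => F t x r 0).
  by apply: jet_bound_sub_set (jS0 r) => t [].
have DS t : S t -> forall r v, 'd (fun x => F t x r 0) 0 v = 0 by case=> St _; exact: DS0.
have mF x r : Lmeasurable setT (fun t => F t x r 0).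
  have [carF _ _] := hF; have [_ H] := carF setT setT (fun _ _ _ _ _ _ => Logic.I) openT (fun _ _ => Logic.I).
  exact: H.
have cF : {ae leb, forall t, continuous (F t)}.
  by apply: ae_imply aeS => t [St _]; exact: cS0.
pose p := (\sum_i d_ i)%N; pose V := 'cV[R]_p.
pose blk := @tagnat.sig1 n d_.
pose midx := {ffun 'I_(mdeg k) -> 'I_p}.
(* coefficients of the Taylor term of type k in position j *)
pose coeff (x : 'I_p * midx) (t : R) : R :=
  if blk x.1 == j then (mdeg k)`!%:R^-1 * tcoef blk k (fun y => F t y x.1 0) x.2 else 0.
(* clamped, they are bounded by psi at every time, not only almost everywhere *)
pose a t x := clamp (psi t) (coeff x t).
have a_meas x : Lmeasurable setT (a^~ x).
  apply: clamp_meas; first by case: hpsi => -[].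
  rewrite /coeff; case: (blk x.1 == j); last exact: measurable_cst.
  apply: measurable_funM; first exact: measurable_cst.
  rewrite /tcoef; case: (has_type blk k x.2); last exact: measurable_cst.
  by apply: (nder_meas aeS (jS x.1)) => [|y]; [rewrite size_basis_seq|exact: mF].
have a_le t x : `|a t x| <= psi t by exact: clamp_le.
have a_type t x : a t x != 0 -> blk x.1 = j /\ has_type blk k x.2.
  rewrite /a /coeff /tcoef; case: (eqVneq (blk x.1) j) => [-> |_]; last first.
    by rewrite clamp_id ?normr0// eqxx.
  by case: ifP => // _; rewrite mulr0 clamp_id ?normr0// eqxx.
have basis_le t (x : 'I_p * midx) : S t -> `|nder (fun y => F t y x.1 0) (basis_seq x.2) 0| <= psi t.
  move=> [St bt]; have sb : size (@basis_seq R p _ x.2) = mdeg k by exact: size_basis_seq.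
  rewrite (nder_coord x.1 (dS0 t St)) ?sb// (le_trans (normrV_ge _ _))//.
  rewrite (le_trans (bt _ _)) ?sb ?k2// ler_piMr//.
  rewrite /basis_seq big_map.
  suff /andP[] : 0 <= \prod_(q <- enum 'I_(mdeg k)) `|@bvec R p (x.2 q)| <= 1 by [].
  apply: (big_ind (fun z : R => 0 <= z <= 1)).
  - by rewrite ler01 lexx.
  - by move=> y z /andP[y0 y1] /andP[z0 z1]; rewrite mulr_ge0//= mulr_ile1.
  - by move=> i _; rewrite normr_ge0 norm_bvec.
have fact_gt0R : 0 < (mdeg k)`!%:R :> R by rewrite ltr0n fact_gt0.
have aE t x : S t -> a t x = coeff x t.
  move=> St; apply: clamp_id; rewrite /coeff; case: (blk x.1 == j); last by rewrite normr0.
  rewrite /tcoef; case: (has_type blk k x.2); last by rewrite mulr0 normr0.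
  rewrite normrM (le_trans _ (basis_le t x St))// ler_piMl//.
  by rewrite ger0_norm ?invr_ge0 ?(ltW fact_gt0R)// invf_le1// ler1n fact_gt0.
have lam_le i : (lambda i).1 <= (lambda i).2 by have [] := hlam i.
have [C [Cd [B' [HB' HC HE]]]] := homological_block hdiag hA HPhi hmu Hgrow hspec_i hpsi
  lam_le hres a_meas a_le a_type.
(* B' may be negative when there are no coefficients *)
pose B : R := `|B'|.
have HB t : bounded_coef B (C t).
  by move=> r c; rewrite (le_trans (HB' t r c))// ler_norm.
(* beyond l, so that saturation leaves the jet of order l alone *)
pose M := (l.+1).*2.
have M_even : ~~ odd M by rewrite odd_double.
have M_gt1 : (1 < M)%N by rewrite /M -addnn addSn addnS.
have lM : (l <= M)%N by rewrite /M -addnn (leq_trans (leqnSn l))// leq_addr.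
have [ep ep_gt0 Hep] := @small_scale R (p%:R * (#|{: midx}|%:R * (B * ((mdeg k)%:R * M%:R))))
  0 (mdeg k) (mulr_ge0 (ler0n _ _) (mulr_ge0 (ler0n _ _) (mulr_ge0 (normr_ge0 _)
    (mulr_ge0 (ler0n _ _) (ler0n _ _))))) k2.
have ep_small : p%:R * (#|{: midx}|%:R * (B * ((mdeg k)%:R * (ep ^+ (mdeg k).-1 * M%:R)))) <= 2^-1.
  by apply: le_trans Hep; rewrite le_eqVlt; apply/orP; left; apply/eqP; ring.
pose a' t r c := a t (r, c).
have Ha' r c : exists K, forall t, S t -> `|a' t r c| <= K * psi t.
  by exists 1 => t _; rewrite mul1r; exact: a_le.
pose G := nform M ep A F C Cd.
have jG r : jet_bound S l psi (fun t x => G t x r 0).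
  exact: (jet_bound_nform ep_gt0 M_even M_gt1 k2 ep_small HB HE lM jS Ha').
exists G; split.
- apply: (jet_bound_caratheodory aeS jG) => x r.
  exact: (nform_meas ep_gt0 M_even M_gt1 ep_small hA HB HC mF cF).
- exact: (nform_equivalent ep_gt0 M_even M_gt1 k2 ep_small A HB HC hF0).
- move=> m i /andP[m1 mk]; apply: ae_imply aeS => t St w.
  have ml : (mdeg m <= l)%N by exact: leq_trans kl.
  rewrite (multi_der_entries jG St w i ml) (multi_der_entries jS St w i ml).
  set vs := map _ _.
  have svs : (size vs <= mdeg k)%N by rewrite size_map size_multi_vecs.
  have nG r := nder_nform ep_gt0 M_even M_gt1 k2 ep_small HB HE lM jS Ha' kl DS hF0 r St svs.
  have entry r : nder (fun x => G t x r 0) vs 0 =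
      if (m == k) && (blk r == j) then 0 else nder (fun x => F t x r 0) vs 0.
    rewrite nG.
    have dr ws : (size ws < l)%N -> forall x, differentiable (nder (fun y => F t y r 0) ws) x.
      by move=> s x; exact: (@jet_bound_nder_diff _ _ _ _ _ _ _ _ _ x (jS r) St).
    have cr ws : (size ws <= l)%N -> continuous (nder (fun y => F t y r 0) ws).
      by move=> s; exact: (jet_bound_nder_cont (jS r) St).
    case: (eqVneq (blk r) j) => rj; last first.
      have -> : (fun y : V => hpoly (a' t) y r 0) = (fun=> 0).
        apply/funext => y; rewrite mxE big1// => c _.
        by rewrite /a' aE// /coeff /= (negbTE rj) mul0r.
      by rewrite nder_zero subr0 andbF.
    have -> : (fun y : V => hpoly (a' t) y r 0) = (fun y : V => \sum_(c : midx)
        ((mdeg k)`!%:R^-1 * tcoef blk k (fun y => F t y r 0) c) * \prod_q y (c q) 0).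
      apply/funext => y; rewrite mxE; apply: eq_bigr => c _.
      by rewrite /a' aE// /coeff /= rj eqxx.
    rewrite (nder_type_part dr cr kl k1 j w mk) -/vs andbT.
    by case: (m == k); rewrite ?subrr ?subr0.
  (* the rows of block i are the indices whose block is i *)
  apply/matrixP => y c; rewrite mxE entry.
  rewrite /blk tagnat.Rank1K; case: ifP => _; first by rewrite mxE.
  by rewrite mxE.
- exact: (jet_bound_derivative_bound hmu hpsi aeS jG).
Qed.
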